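(* Let $R$ be a commutative Noetherian ring with non-zero identity, $\mathfrak a$ an ideal of $R$, and $M$ a finitely generated $R$-module such that $\mathfrak a+\operatorname{Ann}_RM=(x_1,\dots,x_r)$. Let $\mathcal M$ be a Melkersson subcategory with respect to the ideal $\mathfrak a+\operatorname{Ann}_RM$, let $X$ be an arbitrary $R$-module and $n$ a non-negative integer. Then the following statements are equivalent: (i) $H^i_{\mathfrak a}(M,X)$ is in $\mathcal M$ for all $i\le n$. (ii) $\operatorname{Ext}^i_R(M/\mathfrak aM,X)$ is in $\mathcal M$ for all $i\le n$. (iii) The Koszul cohomology module $H^i(x_1,\dots,x_r;X)$ is in $\mathcal M$ for all $i\le n$. When $X$ is finitely generated, these conditions are also equivalent to: (iv) There is a sequence of length $n+1$ in $\mathfrak a+\operatorname{Ann}_RM$ that is $\mathcal M$-regular on $X$. Moreover, the equivalence of (i), (ii) and (iii) also holds with ''for all $i\le n$'' replaced by ''for all $i$'' in each of them.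
   Context: $H^i_{\mathfrak a}(M,X)=\varinjlim_{k}\operatorname{Ext}^i_R(M/\mathfrak a^kM,X)$ is the $i$-th generalized local cohomology module. A Serre subcategory of the category of $R$-modules is a (nonempty) class of $R$-modules such that for every short exact sequence $0\to X'\to X\to X''\to 0$, $X$ is in the class if and only if $X'$ and $X''$ are. A Serre subcategory $\mathcal M$ is a Melkersson subcategory with respect to an ideal $\mathfrak b$ if for every $\mathfrak b$-torsion $R$-module $Y$ (every element of $Y$ is killed by a power of $\mathfrak b$), $0:_Y\mathfrak b\in\mathcal M$ implies $Y\in\mathcal M$. A sequence $y_1,\dots,y_t$ of elements of $R$ is $\mathcal M$-regular on $X$ if for each $j=1,\dots,t$ the module $0:_{X/(y_1,\dots,y_{j-1})X}y_j$ belongs to $\mathcal M$. *)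

(* Defs.v *)
From HB Require Import structures.
From mathcomp Require Import all_boot all_algebra.
From mathcomp Require Import boolp functions freeg ring.

Set Implicit Arguments.
Unset Strict Implicit.
Unset Printing Implicit Defensive.

Import GRing.Theory.
Local Open Scope ring_scope.
Local Open Scope quotient_scope.

Section SubQuotient.
Context (R : comNzRingType) (V : lmodType R) (S : submodClosed V).

Record submod := Submod { submod_val : V; submod_valP : submod_val \in (S : {pred V}) }.
HB.instance Definition _ := [isSub for submod_val].
HB.instance Definition _ := [Choice of submod by <:].
HB.instance Definition _ := [SubChoice_isSubLmodule of submod by <:].

(* The library's quotients need a [zmodClosed], which [submodClosed] does not
   inherit from: hence the detour by quot_pred. *)
Definition quot_pred (v : V) : bool := v \in S.
Fact quot_pred_closed : submod_closed quot_pred.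
Proof. exact: submodClosedP. Qed.
HB.instance Definition _ := GRing.isSubmodClosed.Build R V quot_pred quot_pred_closed.

Definition quot_closed := Algebra.ZmodClosed.clone V quot_pred _.
Definition quotmod := Quotient.quot quot_closed.
HB.instance Definition _ := GRing.Zmodule.on quotmod.
HB.instance Definition _ := Quotient.on quotmod.

Definition quotmod_pi (v : V) : quotmod := \pi v.

Lemma quotmod_pi_eq (u v : V) : (quotmod_pi u == quotmod_pi v) = (u - v \in S).
Proof. exact: esym (Quotient.idealrBE quot_closed u v). Qed.

Lemma quotmod_repr (q : quotmod) : quotmod_pi (repr q) = q.
Proof. exact: reprK. Qed.

Fact quotmod_piD (u v : V) : quotmod_pi (u + v) = quotmod_pi u + quotmod_pi v.
Proof. by rewrite /quotmod_pi; exact: (raddfD (\pi_(Quotient.quot quot_closed))). Qed.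

Definition quotmod_scale (a : R) (q : quotmod) : quotmod := quotmod_pi (a *: repr q).

Fact quotmod_piZ a v : quotmod_pi (a *: v) = quotmod_scale a (quotmod_pi v).
Proof.
apply/eqP; rewrite quotmod_pi_eq -scalerBr rpredZ //.
by rewrite -quotmod_pi_eq quotmod_repr.
Qed.

Fact quotmod_scaleA a b q :
  quotmod_scale a (quotmod_scale b q) = quotmod_scale (a * b) q.
Proof. by rewrite -(quotmod_repr q) -!quotmod_piZ scalerA. Qed.
Fact quotmod_scale1 : left_id 1 quotmod_scale.
Proof. by move=> q; rewrite -(quotmod_repr q) -!quotmod_piZ scale1r. Qed.
Fact quotmod_scaleDr : right_distributive quotmod_scale +%R.
Proof.
move=> a p q; rewrite -(quotmod_repr p) -(quotmod_repr q) -quotmod_piD.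
by rewrite -!quotmod_piZ -quotmod_piD scalerDr.
Qed.
Fact quotmod_scaleDl q : {morph quotmod_scale^~ q : a b / a + b}.
Proof.
by move=> a b; rewrite -(quotmod_repr q) -!quotmod_piZ -quotmod_piD scalerDl.
Qed.
HB.instance Definition _ := GRing.Zmodule_isLmodule.Build R quotmod
  quotmod_scaleA quotmod_scale1 quotmod_scaleDr quotmod_scaleDl.

Fact quotmod_pi_linear : linear quotmod_pi.
Proof. by move=> a u v; rewrite quotmod_piD quotmod_piZ. Qed.
HB.instance Definition _ := GRing.isLinear.Build R V quotmod _ quotmod_pi quotmod_pi_linear.

End SubQuotient.

Section InducedMaps.
Context (R : comNzRingType) (U V : lmodType R) (f : {linear U -> V}).
Context (S : submodClosed U) (T : submodClosed V).
Definition maps_to : Prop := forall u, u \in S -> f u \in T.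
Definition quotmod_map_def (_ : maps_to) (q : quotmod S) : quotmod T :=
  quotmod_pi T (f (repr q)).
Hypothesis fST : maps_to.

Definition submod_map (u : submod S) : submod T := Submod (fST (submod_valP u)).

Fact submod_map_linear : linear submod_map.
Proof. by move=> a u v; apply/val_inj; rewrite /= !linearP. Qed.
HB.instance Definition _ :=
  GRing.isLinear.Build R (submod S) (submod T) _ submod_map submod_map_linear.

Definition quotmod_map := quotmod_map_def fST.

Lemma quotmod_mapE u : quotmod_map (quotmod_pi S u) = quotmod_pi T (f u).
Proof.
apply/eqP; rewrite /quotmod_map /quotmod_map_def quotmod_pi_eq -linearB fST //.
by rewrite -quotmod_pi_eq quotmod_repr.
Qed.

Fact quotmod_map_linear : linear quotmod_map.
Proof.
move=> a p q; rewrite -(quotmod_repr p) -(quotmod_repr q).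
by rewrite -linearP !quotmod_mapE !linearP.
Qed.
HB.instance Definition _ :=
  GRing.isLinear.Build R (quotmod S) (quotmod T) _ quotmod_map quotmod_map_linear.

End InducedMaps.

Section Submodules.
Context (R : comNzRingType).
Implicit Types (U V : lmodType R).

Definition ker_pred U V (f : {linear U -> V}) (u : U) : bool := f u == 0.
Definition top_pred V (_ : V) : bool := true.
Definition span_pred V (A : V -> Prop) (v : V) : bool :=
  `[< forall S : submodClosed V, (forall w, A w -> w \in S) -> v \in S >].
Definition add_pred V (S T : submodClosed V) (v : V) : bool :=
  `[< exists s t, [/\ s \in S, t \in T & v = s + t] >].
(* 0 :_V A *)
Definition colon0_pred V (A : {pred R}) (v : V) : bool :=
  `[< forall c, c \in A -> c *: v = 0 >].
Definition ann_pred V (c : R^o) : bool := `[< forall v : V, (c : R) *: v = 0 >].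

Fact ker_pred_closed U V (f : {linear U -> V}) : submod_closed (ker_pred f).
Proof.
split=> [|a u v]; rewrite !unfold_in /ker_pred ?linear0 ?eqxx //.
by move=> /eqP fu /eqP fv; rewrite linearP fu fv scaler0 addr0.
Qed.
HB.instance Definition _ U V f :=
  GRing.isSubmodClosed.Build R U (@ker_pred U V f) (ker_pred_closed f).

Fact top_pred_closed V : submod_closed (@top_pred V).
Proof. by []. Qed.
HB.instance Definition _ V :=
  GRing.isSubmodClosed.Build R V (@top_pred V) (top_pred_closed V).

Fact span_pred_closed V (A : V -> Prop) : submod_closed (span_pred A).
Proof.
split=> [|a u v]; first by apply/asboolP => S _; exact: rpred0.
move=> /asboolP uA /asboolP vA; apply/asboolP => S AS.
by rewrite rpredD ?rpredZ ?uA ?vA.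
Qed.
HB.instance Definition _ V A :=
  GRing.isSubmodClosed.Build R V (@span_pred V A) (span_pred_closed A).

Fact add_pred_closed V (S T : submodClosed V) : submod_closed (add_pred S T).
Proof.
split=> [|a u v]; first by apply/asboolP; exists 0, 0; rewrite !rpred0 addr0.
move=> /asboolP[s [t [sS tT ->]]] /asboolP[s' [t' [sS' tT' ->]]].
apply/asboolP; exists (a *: s + s'), (a *: t + t').
by rewrite !rpredD ?rpredZ // scalerDr addrACA.
Qed.
HB.instance Definition _ V S T :=
  GRing.isSubmodClosed.Build R V (@add_pred V S T) (add_pred_closed S T).

Fact colon0_pred_closed V (A : {pred R}) : submod_closed (@colon0_pred V A).
Proof.
split=> [|a u v]; first by apply/asboolP => c _; rewrite scaler0.
move=> /asboolP uA /asboolP vA; apply/asboolP => c cA.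
by rewrite scalerDr scalerA mulrC -scalerA uA // vA // scaler0 addr0.
Qed.
HB.instance Definition _ V A :=
  GRing.isSubmodClosed.Build R V (@colon0_pred V A) (colon0_pred_closed V A).

Fact ann_pred_closed V : submod_closed (@ann_pred V).
Proof.
split=> [|a u v]; first by apply/asboolP => w; rewrite scale0r.
move=> /asboolP uA /asboolP vA; apply/asboolP => w.
by rewrite scalerDl -scalerA uA vA scaler0 addr0.
Qed.
HB.instance Definition _ V :=
  GRing.isSubmodClosed.Build R R^o (@ann_pred V) (ann_pred_closed V).

Definition kernel U V (f : {linear U -> V}) : submodClosed U :=
  @GRing.SubmodClosed.clone R U (ker_pred f) _.
Definition top V : submodClosed V := @GRing.SubmodClosed.clone R V (@top_pred V) _.
Definition span V (A : V -> Prop) : submodClosed V :=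
  @GRing.SubmodClosed.clone R V (span_pred A) _.

(* Ideals are submodules of R over itself; the unit ideal is allowed, unlike
   in the library's [idealr]. *)
Definition ideal := submodClosed R^o.

Definition ideal_gen (s : seq R) : ideal := @span R^o (fun c => c \in s).
Definition ideal_add (I J : ideal) : ideal :=
  @GRing.SubmodClosed.clone R R^o (@add_pred R^o I J) _.
Definition Ann V : ideal := @GRing.SubmodClosed.clone R R^o (@ann_pred V) _.
Definition ideal_mul V (I : ideal) (N : submodClosed V) : submodClosed V :=
  span (fun v => exists c w, [/\ c \in I, w \in N & v = (c : R) *: w]).
Fixpoint ideal_pow (I : ideal) (k : nat) : ideal :=
  if k is k'.+1 then ideal_mul I (ideal_pow I k') else top R^o.

Definition colon0 V (A : {pred R}) : lmodType R :=
  submod (@GRing.SubmodClosed.clone R V (@colon0_pred V A) _).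
Definition mod_ideal V (I : ideal) : lmodType R := quotmod (ideal_mul I (top V)).

Definition finitely_generated V : Prop :=
  exists s : seq V, forall v : V, v \in span (fun w => w \in s).
Definition noetherian : Prop :=
  forall I : ideal, exists s : seq R, I =i ideal_gen s.

Definition torsion (b : ideal) V : Prop :=
  forall v : V, exists k, forall c, c \in ideal_pow b k -> (c : R) *: v = 0.

Definition short_exact (U V W : lmodType R) (f : {linear U -> V}) (g : {linear V -> W}) :=
  [/\ injective f, (forall v, g v = 0 <-> exists u, f u = v) & (forall w, exists v, g v = w)].

(* Closure under isomorphism is the case W = 0. *)
Definition serre (C : lmodType R -> Prop) : Prop :=
  (exists V, C V) /\
  forall (U V W : lmodType R) (f : {linear U -> V}) (g : {linear V -> W}),
    short_exact f g -> (C V <-> C U /\ C W).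

Definition melkersson (C : lmodType R -> Prop) (b : ideal) : Prop :=
  serre C /\
  forall Y : lmodType R, torsion b Y -> C (colon0 Y (mem b)) -> C Y.

Definition regular_seq (C : lmodType R -> Prop) V (y : seq R) : Prop :=
  forall j, (j < size y)%N ->
    C (colon0 (mod_ideal V (ideal_gen (take j y))) (pred1 y`_j)).

End Submodules.

Section Cohomology.
Context (R : comNzRingType).

Record cochain := Cochain {
  cobj :> nat -> lmodType R;
  cdiff : forall i, {linear cobj i -> cobj i.+1};
  cdiffK : forall i u, cdiff i.+1 (cdiff i u) = 0 }.

Definition cocycle (K : cochain) i : lmodType R := submod (kernel (cdiff K i)).

Definition cobound_pred (K : cochain) i : cocycle K i -> bool :=
  match i return cocycle K i -> bool with
  | 0 => fun z => z == 0
  | j.+1 => fun z => `[< exists u, cdiff K j u = val z >]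
  end.

Fact cobound_pred_closed K i : submod_closed (@cobound_pred K i).
Proof.
case: i => [|i]; split=> [|a u v]; rewrite ?unfold_in //=.
- by move=> /eqP-> /eqP->; rewrite scaler0 addr0.
- by apply/asboolP; exists 0; rewrite !linear0.
- move=> /asboolP[u' fu] /asboolP[v' fv]; apply/asboolP.
  by exists (a *: u' + v'); rewrite !linearP fu fv.
Qed.
HB.instance Definition _ K i :=
  GRing.isSubmodClosed.Build R (cocycle K i) (@cobound_pred K i) (cobound_pred_closed K i).

Definition coboundary (K : cochain) i : submodClosed (cocycle K i) :=
  @GRing.SubmodClosed.clone R (cocycle K i) (@cobound_pred K i) _.
Definition cohomology (K : cochain) i : lmodType R := quotmod (coboundary K i).

Section Map.
Context (K L : cochain) (phi : forall i, {linear K i -> L i}).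
Hypothesis phid : forall i u, phi i.+1 (cdiff K i u) = cdiff L i (phi i u).

Fact cocycle_map_subproof i : maps_to (phi i) (kernel (cdiff K i)) (kernel (cdiff L i)).
Proof. move=> u; by rewrite !unfold_in /ker_pred -phid => /eqP->; rewrite linear0. Qed.
Definition cocycle_map i : {linear cocycle K i -> cocycle L i} :=
  submod_map (@cocycle_map_subproof i).

Fact cohomology_map_subproof i :
  maps_to (cocycle_map i) (coboundary K i) (coboundary L i).
Proof.
case: i => [|i] z; rewrite !unfold_in /=; first by move=> /eqP->; rewrite linear0.
by move=> /asboolP[u fu]; apply/asboolP; exists (phi i u); rewrite -phid fu.
Qed.
Definition cohomology_map i : {linear cohomology K i -> cohomology L i} :=
  quotmod_map (@cohomology_map_subproof i).
End Map.

End Cohomology.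

Section Hom.
Context (R : comNzRingType) (U V : lmodType R).

Definition hom : Type := {linear U -> V}.
HB.instance Definition _ := gen_eqMixin hom.
HB.instance Definition _ := gen_choiceMixin hom.

Lemma hom_eq (f g : {linear U -> V}) : f =1 g -> f = g :> hom.
Proof.
case: f => f [[fA] [fB]] /=; case: g => g [[gA] [gB]] /= /funext fg.
case: _ / fg gA gB => gA gB.
by rewrite (Prop_irrelevance fA gA) (Prop_irrelevance fB gB).
Qed.

Local Notation lin h := (GRing.Linear.clone R U V _ h _).
Definition hom_zero : hom := lin (\0 : U -> V).
Definition hom_opp (f : hom) : hom := lin (\- (f : {linear U -> V})).
Definition hom_add (f g : hom) : hom :=
  lin ((f : {linear U -> V}) \+ (g : {linear U -> V})).
Definition hom_scale (a : R) (f : hom) : hom := lin (a \*: (f : {linear U -> V})).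

Fact hom_addA : associative hom_add.
Proof. by move=> f g h; apply: hom_eq => u /=; rewrite addrA. Qed.
Fact hom_addC : commutative hom_add.
Proof. by move=> f g; apply: hom_eq => u /=; rewrite addrC. Qed.
Fact hom_add0 : left_id hom_zero hom_add.
Proof. by move=> f; apply: hom_eq => u /=; rewrite add0r. Qed.
Fact hom_addN : left_inverse hom_zero hom_opp hom_add.
Proof. by move=> f; apply: hom_eq => u /=; rewrite addNr. Qed.
HB.instance Definition _ :=
  GRing.isZmodule.Build hom hom_addA hom_addC hom_add0 hom_addN.

Fact hom_scaleA a b f : hom_scale a (hom_scale b f) = hom_scale (a * b) f.
Proof. by apply: hom_eq => u /=; rewrite scalerA. Qed.
Fact hom_scale1 : left_id 1 hom_scale.
Proof. by move=> f; apply: hom_eq => u /=; rewrite scale1r. Qed.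
Fact hom_scaleDr : right_distributive hom_scale +%R.
Proof. by move=> a f g; apply: hom_eq => u /=; rewrite scalerDr. Qed.
Fact hom_scaleDl f : {morph hom_scale^~ f : a b / a + b}.
Proof. by move=> a b; apply: hom_eq => u /=; rewrite scalerDl. Qed.
HB.instance Definition _ := GRing.Zmodule_isLmodule.Build R hom
  hom_scaleA hom_scale1 hom_scaleDr hom_scaleDl.

End Hom.

Section HomPrecomp.
Context (R : comNzRingType) (U U' V : lmodType R) (f : {linear U -> U'}).

Definition hom_precomp (h : hom U' V) : hom U V :=
  GRing.Linear.clone R U V _ ((h : {linear U' -> V}) \o f) _.

Fact hom_precomp_linear : linear hom_precomp.
Proof. by move=> a g h; apply: hom_eq. Qed.
HB.instance Definition _ :=
  GRing.isLinear.Build R (hom U' V) (hom U V) _ hom_precomp hom_precomp_linear.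
End HomPrecomp.

(* Ext is computed from the free resolution
     ... -> free (syz N 1) -> free (syz N 0) -> N -> 0,
   where free V is the free module on the underlying set of V and syz N i.+1 is
   the kernel of free (syz N i) -> syz N i. It is functorial in N, so that the
   maps between Ext modules are given by explicit maps of complexes. *)
Section FreeModule.
Context (R : comNzRingType).

Definition free (N : lmodType R) : lmodType R := {freeg N / R}.

Definition free_lift (N V : lmodType R) (f : N -> V) (D : free N) : V := fglift f D.

Fact free_lift_zmod_morphism (N V : lmodType R) (f : N -> V) : zmod_morphism (free_lift f).
Proof. exact: lift_is_additive. Qed.
HB.instance Definition _ (N V : lmodType R) (f : N -> V) :=
  GRing.isZmodMorphism.Build (free N) V (@free_lift N V f) (free_lift_zmod_morphism f).

Fact free_lift_scalable (N V : lmodType R) (f : N -> V) : scalable (free_lift f).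
Proof.
move=> a D; have -> : a *: D = fgscale a D by [].
have {2}-> : D = \sum_(z <- dom D) << coeff z D *g z >> by rewrite freeg_sumE.
rewrite /fgscale !raddf_sum.
by apply: eq_bigr => x _; rewrite /= /free_lift !liftU scalerA.
Qed.
HB.instance Definition _ (N V : lmodType R) (f : N -> V) :=
  GRing.isScalable.Build R (free N) V _ (@free_lift N V f) (free_lift_scalable f).

Definition free_var (N : lmodType R) (x : N) : free N := << x >>.

Lemma free_lift_var (N V : lmodType R) (f : N -> V) x : free_lift f (free_var x) = f x.
Proof. by rewrite /free_lift /free_var liftU scale1r. Qed.

Lemma free_ext (N V : lmodType R) (f g : {linear free N -> V}) :
  (forall x, f (free_var x) = g (free_var x)) -> f =1 g.
Proof.
move=> fg D; rewrite -[D]freeg_sumE !linear_sum; apply: eq_bigr => x _.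
suff -> : << coeff x D *g x >> = coeff x D *: free_var x by rewrite !linearZ fg.
by apply/eqP/freeg_eqP => y; rewrite /free_var coeffZ !coeffU mul1r.
Qed.

Definition augment N : {linear free N -> N} := free_lift id.
Definition free_map (N N' : lmodType R) (f : N -> N') : {linear free N -> free N'} :=
  free_lift (fun x => free_var (f x)).

Lemma augment_nat (N N' : lmodType R) (f : {linear N -> N'}) D :
  augment N' (free_map f D) = f (augment N D).
Proof. 
have := @free_ext N N' (augment N' \o free_map f) (f \o augment N).
by apply=> x /=; rewrite !free_lift_var.
Qed.

Fixpoint syz (N : lmodType R) (i : nat) : lmodType R :=
  if i is j.+1 then submod (kernel (augment (syz N j))) else N.

End FreeModule.

Section Resolution.
Context (R : comNzRingType).

Definition res_diff (N : lmodType R) i : {linear free (syz N i.+1) -> free (syz N i)} :=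
  GRing.Linear.clone R _ _ _
    ((val : syz N i.+1 -> free (syz N i)) \o augment (syz N i.+1)) _.

Lemma augment_surj (N : lmodType R) (x : N) : exists D, augment N D = x.
Proof. by exists (free_var x); exact: free_lift_var. Qed.

Lemma res_exact0 (N : lmodType R) (D : free N) :
  augment N D = 0 <-> exists E, res_diff N 0 E = D.
Proof.
split=> [D0|[E <-]]; last by apply/eqP; exact: (valP (augment (syz N 1) E)).
have DP : D \in kernel (augment N) by apply/eqP.
have [E EE] := augment_surj (Submod DP : syz N 1).
by exists E; rewrite /= EE.
Qed.

Lemma res_exact (N : lmodType R) i (D : free (syz N i.+1)) :
  res_diff N i D = 0 <-> exists E, res_diff N i.+1 E = D.
Proof.
rewrite -(res_exact0 (N := syz N i.+1)); split=> D0.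
  by apply: val_inj; exact: D0.
by have := congr1 val D0.
Qed.

Fact syz_map_subproof (N N' : lmodType R) (f : {linear N -> N'}) :
  maps_to (free_map f) (kernel (augment N)) (kernel (augment N')).
Proof. by move=> D /eqP D0; apply/eqP; rewrite augment_nat D0 linear0. Qed.

Fixpoint syz_map (N N' : lmodType R) (f : {linear N -> N'}) i :
    {linear syz N i -> syz N' i} :=
  match i return {linear syz N i -> syz N' i} with
  | 0 => f
  | j.+1 => submod_map (syz_map_subproof (syz_map f j))
  end.

Definition res_map (N N' : lmodType R) (f : {linear N -> N'}) i :
  {linear free (syz N i) -> free (syz N' i)} := free_map (syz_map f i).

Lemma res_mapP (N N' : lmodType R) (f : {linear N -> N'}) i D :
  res_map f i (res_diff N i D) = res_diff N' i (res_map f i.+1 D).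
Proof. by rewrite /= augment_nat. Qed.

Fact res_diffK (N : lmodType R) i D : res_diff N i (res_diff N i.+1 D) = 0.
Proof. by apply/res_exact; exists D. Qed.

Context (X : lmodType R).

Fact ext_complex_subproof (N : lmodType R) i (h : hom (free (syz N i)) X) :
  hom_precomp (res_diff N i.+1) (hom_precomp (res_diff N i) h) = 0.
Proof.
apply: hom_eq => D; rewrite [LHS]/=.
by have /= -> := res_diffK D; rewrite linear0.
Qed.

Definition ext_complex (N : lmodType R) : cochain R :=
  Cochain (cobj := fun i => hom (free (syz N i)) X)
    (cdiff := fun i => hom_precomp (res_diff N i)) (@ext_complex_subproof N).

Definition ext_complex_map (N N' : lmodType R) (f : {linear N -> N'}) i :
  {linear ext_complex N' i -> ext_complex N i} := hom_precomp (res_map f i).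

Fact Ext_map_subproof (N N' : lmodType R) (f : {linear N -> N'}) i
    (h : ext_complex N' i) :
  ext_complex_map f i.+1 (cdiff (ext_complex N') i h) =
  cdiff (ext_complex N) i (ext_complex_map f i h).
Proof. by apply: hom_eq => D /=; rewrite augment_nat. Qed.

End Resolution.

Definition Ext (R : comNzRingType) (i : nat) (N X : lmodType R) : lmodType R :=
  cohomology (ext_complex X N) i.

Definition Ext_map (R : comNzRingType) (i : nat) (N N' X : lmodType R)
    (f : {linear N -> N'}) : {linear Ext i N' X -> Ext i N X} :=
  cohomology_map (Ext_map_subproof (X := X) f) i.

Section DirectLimit.
Context (R : comNzRingType) (E : nat -> lmodType R).

Definition dprod : Type := forall k, E k.
HB.instance Definition _ := gen_eqMixin dprod.
HB.instance Definition _ := gen_choiceMixin dprod.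

Definition dprod_zero : dprod := fun=> 0.
Definition dprod_opp (u : dprod) : dprod := fun k => - u k.
Definition dprod_add (u v : dprod) : dprod := fun k => u k + v k.
Definition dprod_scale (a : R) (u : dprod) : dprod := fun k => a *: u k.

Fact dprod_addA : associative dprod_add.
Proof. by move=> u v w; apply: functional_extensionality_dep => k; exact: addrA. Qed.
Fact dprod_addC : commutative dprod_add.
Proof. by move=> u v; apply: functional_extensionality_dep => k; exact: addrC. Qed.
Fact dprod_add0 : left_id dprod_zero dprod_add.
Proof. by move=> u; apply: functional_extensionality_dep => k; exact: add0r. Qed.
Fact dprod_addN : left_inverse dprod_zero dprod_opp dprod_add.
Proof. by move=> u; apply: functional_extensionality_dep => k; exact: addNr. Qed.
HB.instance Definition _ :=
  GRing.isZmodule.Build dprod dprod_addA dprod_addC dprod_add0 dprod_addN.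

Fact dprod_scaleA a b u : dprod_scale a (dprod_scale b u) = dprod_scale (a * b) u.
Proof. by apply: functional_extensionality_dep => k; exact: scalerA. Qed.
Fact dprod_scale1 : left_id 1 dprod_scale.
Proof. by move=> u; apply: functional_extensionality_dep => k; exact: scale1r. Qed.
Fact dprod_scaleDr : right_distributive dprod_scale +%R.
Proof. by move=> a u v; apply: functional_extensionality_dep => k; exact: scalerDr. Qed.
Fact dprod_scaleDl u : {morph dprod_scale^~ u : a b / a + b}.
Proof. by move=> a b; apply: functional_extensionality_dep => k; exact: scalerDl. Qed.
HB.instance Definition _ := GRing.Zmodule_isLmodule.Build R dprod
  dprod_scaleA dprod_scale1 dprod_scaleDr dprod_scaleDl.

Definition dsum_pred (u : dprod) : bool :=
  `[< exists m, forall k, (m <= k)%N -> u k = 0 >].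
Fact dsum_pred_closed : submod_closed dsum_pred.
Proof.
split=> [|a u v]; first by apply/asboolP; exists 0.
move=> /asboolP[m um] /asboolP[p vp]; apply/asboolP; exists (maxn m p) => k.
by rewrite geq_max => /andP[mk pk]; rewrite /= [LHS](_ : _ = a *: u k + v k) // um // vp // scaler0 addr0.
Qed.
HB.instance Definition _ := GRing.isSubmodClosed.Build R dprod dsum_pred dsum_pred_closed.

Definition dsum : lmodType R := submod (@GRing.SubmodClosed.clone R dprod dsum_pred _).

Fact dsum_in_subproof k (e : E k) : dsum_pred (dfwith (0 : dprod) e).
Proof.
apply/asboolP; exists k.+1 => j kj; rewrite dfwith_out //.
by apply: contraTneq kj => ->; rewrite ltnn.
Qed.
Definition dsum_in k (e : E k) : dsum := Submod (dsum_in_subproof e).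

Context (t : forall k, {linear E k -> E k.+1}).

Definition dirlim_rel : submodClosed dsum :=
  span (fun w : dsum => exists k (e : E k), w = dsum_in e - dsum_in (t k e)).

Definition dirlim : lmodType R := quotmod dirlim_rel.

Definition dirlim_in k (e : E k) : dirlim := quotmod_pi dirlim_rel (dsum_in e).

Fact dsum_in_linear k : linear (@dsum_in k).
Proof.
move=> a u v; apply/val_inj; apply: functional_extensionality_dep => j.
rewrite [RHS](_ : _ = a *: dfwith (0 : dprod) u j + dfwith (0 : dprod) v j) //.
rewrite [LHS](_ : _ = dfwith (0 : dprod) (a *: u + v) j) //.
have [<-|kj] := eqVneq k j; first by rewrite !dfwith_in.
by rewrite !dfwith_out // [RHS](_ : _ = a *: 0 + 0) // scaler0 addr0.
Qed.
HB.instance Definition _ k :=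
  GRing.isLinear.Build R (E k) dsum _ (@dsum_in k) (@dsum_in_linear k).
Fact dirlim_in_linear k : linear (@dirlim_in k).
Proof. by move=> a u v; rewrite /dirlim_in !linearP. Qed.
HB.instance Definition _ k :=
  GRing.isLinear.Build R (E k) dirlim _ (@dirlim_in k) (@dirlim_in_linear k).

Lemma dirlim_in_trans k (e : E k) : dirlim_in (t k e) = dirlim_in e.
Proof.
apply/esym/eqP; rewrite quotmod_pi_eq; apply/asboolP => S; apply.
by exists k, e.
Qed.

Fixpoint trans k m : E k -> E (m + k) :=
  match m return E k -> E (m + k) with
  | 0 => id
  | p.+1 => fun e => t (p + k) (trans p e)
  end.

Lemma dirlim_in_transn k m (e : E k) : dirlim_in (trans m e) = dirlim_in e.
Proof. by elim: m => //= m IHm; rewrite dirlim_in_trans. Qed.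

Lemma dirlim_in_surj (q : dirlim) : exists k (e : E k), dirlim_in e = q.
Proof.
rewrite -(quotmod_repr q); case: (repr q) => u uP.
have /asboolP[m um] := uP.
elim: m => [|m IHm] in u uP um *.
  exists 0, 0; rewrite linear0; apply/esym/eqP.
  rewrite -(linear0 (quotmod_pi dirlim_rel)) quotmod_pi_eq subr0.
  suff -> : Submod uP = 0 by exact: rpred0.
  by apply/val_inj/functional_extensionality_dep => k; exact: um.
pose w : dsum := Submod uP - dsum_in (u m).
have wm k : (m <= k)%N -> val w k = 0.
  rewrite [X in X = _](_ : _ = u k - dfwith (0 : dprod) (u m) k) //.
  rewrite leq_eqVlt => /predU1P[<-|mk]; first by rewrite dfwith_in subrr.
  by rewrite um // dfwith_out ?subr0 // ltn_eqF.
have [k [e ee]] := IHm _ (valP w) wm.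
exists (maxn k m), (ecast i (E i) (subnK (leq_maxl k m)) (trans (maxn k m - k) e)
  + ecast i (E i) (subnK (leq_maxr k m)) (trans (maxn k m - m) (u m))).
rewrite linearD /=.
have castE i j (ij : i = j) x : dirlim_in (ecast i (E i) ij x) = dirlim_in x.
  by case: _ / ij.
rewrite !castE !dirlim_in_transn ee /dirlim_in -linearD.
by congr quotmod_pi; apply/val_inj; exact: subrK.
Qed.

Fixpoint total (w : dprod) (m : nat) : E m :=
  match m return E m with
  | 0 => w 0
  | p.+1 => t p (total w p) + w p.+1
  end.

Lemma total_linear (a : R) (u v : dprod) m :
  total (a *: u + v) m = a *: total u m + total v m.
Proof. 
elim: m => //= m ->; rewrite linearP scalerDr addrACA; congr (_ + _).
Qed.

Definition total0_pred (w : dsum) : bool :=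
  `[< exists m, forall p, (m <= p)%N -> total (val w) p = 0 >].
Fact total0_pred_closed : submod_closed total0_pred.
Proof.
have tot0 p : total 0 p = 0.
  by have := total_linear (-1) 0 0 p; rewrite scaler0 addr0 scaleN1r addNr.
split=> [|a u v]; first by apply/asboolP; exists 0%N => p _; exact: tot0.
move=> /asboolP[m um] /asboolP[n vn]; apply/asboolP; exists (maxn m n) => p.
rewrite geq_max => /andP[mp np].
by rewrite linearP total_linear um // vn // scaler0 addr0.
Qed.
HB.instance Definition _ := GRing.isSubmodClosed.Build R dsum total0_pred total0_pred_closed.

Lemma total_in k m (e : E k) : total (dfwith (0 : dprod) e) (m + k) = trans m e.
Proof.
have tot0 p : (p < k)%N -> total (dfwith (0 : dprod) e) p = 0.
  elim: p => [|p IHp] pk /=; first by rewrite dfwith_out // gtn_eqF.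
  by rewrite IHp ?linear0 ?add0r ?dfwith_out ?gtn_eqF // ltnW.
elim: m => [|m IHm] /=.
  case: k e tot0 => [|k] e tot0 /=; first by rewrite dfwith_in.
  by rewrite tot0 // linear0 add0r dfwith_in.
by rewrite IHm dfwith_out ?[X in _ + X](_ : _ = 0) ?addr0 // ltn_eqF // ltnS leq_addl.
Qed.

Lemma dirlim_in_eq0 k (e : E k) : dirlim_in e = 0 <-> exists m, trans m e = 0.
Proof.
split=> [/eqP|[m e0]]; last by rewrite -(dirlim_in_transn m) e0 linear0.
rewrite -(linear0 (quotmod_pi dirlim_rel)) quotmod_pi_eq subr0 => /asboolP.
move=> /(_ (GRing.SubmodClosed.clone R dsum total0_pred _)) tot.
have /asboolP[m /(_ (m + k)%N (leq_addr _ _))] : dsum_in e \in total0_pred.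
  apply: tot => _ [j [e' ->]]; apply/asboolP; exists j.+1 => p jp.
  have -> : val (dsum_in e' - dsum_in (t j e')) =
    (-1) *: (dfwith (0 : dprod) (t j e') : dprod) + (dfwith (0 : dprod) e' : dprod).
    by rewrite scaleN1r addrC.
  rewrite total_linear -(subnK jp).
  suff -> : forall n, total (dfwith (0 : dprod) (t j e')) (n + j.+1)
    = total (dfwith (0 : dprod) e') (n + j.+1) by rewrite scaleN1r addNr.
  elim=> [|n IHn]; last first.
    have jn := leq_addl n j.+1.
    by rewrite /= IHn !dfwith_out // ltn_eqF // ltnS // ltnW.
  rewrite (total_in 0 (t j e')) /= (total_in 0 e') dfwith_out ?ltn_eqF //=.
  by rewrite [X in _ + X](_ : _ = 0) ?addr0.
by rewrite total_in => e0; exists m.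
Qed.

End DirectLimit.

Section LocalCohomology.
Context (R : comNzRingType) (a : ideal R) (M : lmodType R).

Fact mod_pow_subproof k :
  maps_to idfun (ideal_mul (ideal_pow a k.+1) (top M)) (ideal_mul (ideal_pow a k) (top M)).
Proof.
move=> u /asboolP; apply=> _ [c [w [ca _ ->]]].
apply/asboolP => S; apply; exists c, w; split=> //.
by move/asboolP: ca; apply=> _ [d [e [_ ea ->]]]; exact: rpredZ.
Qed.

Definition mod_pow_proj k :
    {linear mod_ideal M (ideal_pow a k.+1) -> mod_ideal M (ideal_pow a k)} :=
  quotmod_map (@mod_pow_subproof k).

Definition gen_local_cohomology i (X : lmodType R) : lmodType R :=
  dirlim (E := fun k => Ext i (mod_ideal M (ideal_pow a k)) X)
    (fun k => Ext_map i X (mod_pow_proj k)).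

End LocalCohomology.

Section Koszul.
Context (R : comNzRingType) (r : nat) (x : 'I_r -> R) (X : lmodType R).

(* A function f stands for the R-linear map from the exterior algebra of R^r
   to X sending e_{j_1} /\ ... /\ e_{j_p}, j_1 < ... < j_p, to f {j_1, ..., j_p}. *)
Local Notation kfun := {ffun {set 'I_r} -> X}.

Definition koszul_sign (S : {set 'I_r}) (j : 'I_r) : R :=
  (-1) ^+ #|[set k in S | (k < j)%N]|.

Definition koszul_fun (f : kfun) : kfun :=
  [ffun S : {set 'I_r} => \sum_(j in S) koszul_sign S j *: (x j *: f (S :\ j))].

Fact koszul_fun_linear : linear koszul_fun.
Proof.
move=> c f g; apply/ffunP => S; rewrite !ffunE scaler_sumr -big_split /=.
apply: eq_bigr => j _; rewrite !ffunE !scalerDr; congr (_ + _).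
by rewrite !scalerA; congr (_ *: _); rewrite mulrC [RHS]mulrA mulrA.
Qed.
HB.instance Definition _ := GRing.isLinear.Build R kfun kfun _ koszul_fun koszul_fun_linear.

Lemma koszul_fun_sq (f : kfun) : koszul_fun (koszul_fun f) = 0.
Proof.
apply/ffunP => S; rewrite !ffunE.
pose G j k := koszul_sign S j *: (x j *:
  (koszul_sign (S :\ j) k *: (x k *: f (S :\ j :\ k)))).
have sgn (j k : 'I_r) : j \in S -> (j < k)%N -> koszul_sign (S :\ j) k = - koszul_sign S k.
  move=> jS jk; rewrite /koszul_sign [in RHS](cardsD1 j) inE jS jk add1n exprS mulN1r opprK.
  by congr (_ ^+ #|pred_of_set _|); apply/setP => l; rewrite !inE andbA.
have sgn' (j k : 'I_r) : (k < j)%N -> koszul_sign (S :\ j) k = koszul_sign S k.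
  move=> kj; rewrite /koszul_sign; congr (_ ^+ #|pred_of_set _|).
  apply/setP => l; rewrite !inE; case: eqVneq => //= ->.
  by rewrite ltnNge (ltnW kj) andbF.
have GN (j k : 'I_r) : j \in S -> (j < k)%N -> G j k = - G k j.
  move=> jS jk; rewrite /G sgn // sgn' // scaleNr !scalerN; congr (- _).
  have -> : S :\ k :\ j = S :\ j :\ k by rewrite !setDDl setUC.
  by rewrite !scalerA; congr (_ *: _); ring.
transitivity (\sum_(j in S) \sum_(k in S | k != j) G j k).
  apply: eq_bigr => j _; rewrite ffunE !scaler_sumr.
  by apply: eq_big => k; rewrite ?inE 1?andbC.
transitivity (\sum_(j in S) \sum_(k in S | (j < k)%N) (G j k + G k j)); last first.
  apply: big1 => j jS; apply: big1 => k /andP[_ jk].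
  by rewrite GN // addNr.
under [RHS]eq_bigr do rewrite big_split /=.
rewrite big_split /= [X in _ = _ + X](exchange_big_dep (mem S)) /=; last by move=> ? ? _ /andP[].
rewrite -big_split /=; apply: eq_bigr => j jS.
rewrite (bigID (fun k : 'I_r => (j < k)%N)) /=; congr (_ + _); apply: eq_bigl => k.
  by rewrite -andbA; case: ltngtP => // jk; rewrite ?andbF // andbT -val_eqE gtn_eqF.
rewrite jS -leqNgt ltn_neqAle -val_eqE -andbA.
by case: (k \in S).
Qed.

Definition koszul_pred (p : nat) (f : kfun) : bool :=
  [forall S : {set 'I_r}, (#|S| != p) ==> (f S == 0)].

Fact koszul_pred_closed p : submod_closed (koszul_pred p).
Proof.
split=> [|c f g]; first by apply/forallP => S; rewrite ffunE eqxx implybT.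
move=> /forallP f0 /forallP g0; apply/forallP => S; apply/implyP => Sp.
have /eqP fS := implyP (f0 S) Sp; have /eqP gS := implyP (g0 S) Sp.
by rewrite !ffunE fS gS scaler0 addr0.
Qed.
HB.instance Definition _ p :=
  GRing.isSubmodClosed.Build R kfun (koszul_pred p) (koszul_pred_closed p).
Definition koszul_part p : submodClosed kfun :=
  @GRing.SubmodClosed.clone R kfun (koszul_pred p) _.

Fact koszul_diff_subproof p : maps_to koszul_fun (koszul_part p) (koszul_part p.+1).
Proof.
move=> f /forallP f0; apply/forallP => S; apply/implyP => Sp.
rewrite ffunE big1 // => j jS.
have /eqP -> : f (S :\ j) == 0; last by rewrite !scaler0.
by apply: (implyP (f0 _)); apply: contra Sp; rewrite (cardsD1 j S) jS.
Qed.

Definition koszul_diff p : {linear submod (koszul_part p) -> submod (koszul_part p.+1)} :=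
  submod_map (@koszul_diff_subproof p).

Fact koszul_complex_subproof p u : koszul_diff p.+1 (koszul_diff p u) = 0.
Proof. by apply/val_inj; exact: koszul_fun_sq. Qed.

Definition koszul_complex : cochain R := Cochain koszul_complex_subproof.

Definition koszul_cohomology (i : nat) : lmodType R := cohomology koszul_complex i.

End Koszul.

(* Main.v *)
Require Import Defs.
From HB Require Import structures.
From mathcomp Require Import all_boot all_algebra.
From mathcomp Require Import boolp ring.
Import Defs.

(** Write b for a + Ann M, an ideal generated by the entries of x. The conditions
    on local cohomology, on Ext and on Koszul cohomology in degrees at most n are
    each equivalent to one and the same condition, called Ext_nilpotent_in: the
    modules Ext^i(N, X), for i <= n and N finitely generated and killed by a power of
    b, belong to C. The rest of the argument is devissage on N, so that all it needs
    is the long exact sequence of Ext in its first variable, with natural connecting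
    maps, and the axioms of Serre classes.

    Long exact sequence. Cocycles of degree i are linear maps on the i-th syzygy, and
    Ext^(i+1)(N, X) is the cokernel of Ext^i(free N, X) -> Ext^i(syz N 1, X). A short
    exact sequence 0 -> N' -> N -> N'' -> 0 is determined by a map syz N'' 1 -> N', and
    rotates to 0 -> syz N'' 1 -> N' + free N'' -> N -> 0. Rotation and dimension
    shifting reduce every exactness statement to the left exactness of Hom.

    Devissage. Let N0 be finitely generated with a nonzero map to R/p for each prime p
    containing an ideal c. By noetherian induction on annihilators, a family of
    functors with long exact sequences has values in C at all finitely generated
    modules killed by a power of c as soon as it has them at N0 (devissage). Such maps
    exist when Ann N0 lies in p (nonzero_map_prime). This is applied to Ext with
    N0 = M/aM, to local cohomology with N0 = M, and to Ext with N0 = R/b.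

    Local cohomology. A weak Artin-Rees lemma, which says that the induced filtration
    of a submodule is cofinal with its own, turns H^i_a(-, X) into a cohomological
    functor of finitely generated modules; at modules killed by a power of a it
    coincides with Ext. To pass from modules killed by a power of b to M, each
    generator c of b in turn is made nilpotent: modulo its c-torsion a module N has c
    as a regular element, the elements of H^i_a(N, X) killed by c come from
    H^i_a(N/cN, X), and the Melkersson condition applies, as H^i_a(N, X) is b-torsion.

    Koszul cohomology. The Koszul chain complex P consists of finitely generated free
    modules and its homology is killed by b. Dimension shifting through the cokernels
    of its differentials compares Ext^i(R/b, X) with H^i(Hom(P, X)), up to modules
    Ext^j(H, X) with H a homology module and j <= i (coh_nilpotent_inP).

    Regular sequences are related to Koszul cohomology through its long exact sequence
    in the coefficients. If y lies in b, then y kills H^i(x; X), so that H^i(x; X) is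
    controlled by 0 :_X y and X/yX. Conversely, if H^0(x; X), hence 0 :_X b, is in C,
    the Melkersson condition puts the b-torsion of X in C, and by prime avoidance some
    y in b is regular modulo this torsion, which then contains 0 :_X y. *)

Set Implicit Arguments.
Unset Strict Implicit.
Unset Printing Implicit Defensive.

Import GRing.Theory.
Local Open Scope ring_scope.

(** * Submodules, linear relations and Serre classes *)

Section Builders.
Context (R : comNzRingType) (U V : lmodType R).

Definition linear_closed (P : V -> Prop) : Prop :=
  P 0 /\ forall (a : R) u v, P u -> P v -> P (a *: u + v).

Definition prop_pred (P : V -> Prop) (_ : linear_closed P) (v : V) : bool := `[< P v >].

Fact prop_pred_closed P (H : linear_closed P) : submod_closed (prop_pred H).
Proof.
case: (H) => P0 PD; split=> [|a u v]; first exact/asboolP.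
by move=> /asboolP Pu /asboolP Pv; apply/asboolP; exact: PD.
Qed.
HB.instance Definition _ P H :=
  GRing.isSubmodClosed.Build R V (@prop_pred P H) (prop_pred_closed H).

Definition sub_of P (H : linear_closed P) : submodClosed V :=
  @GRing.SubmodClosed.clone R V (prop_pred H) _.

Lemma sub_ofP P (H : linear_closed P) v : reflect (P v) (v \in sub_of H).
Proof. exact: asboolP. Qed.

Definition lin_fun (f : U -> V) (_ : linear f) : U -> V := f.
HB.instance Definition _ f (H : linear f) :=
  GRing.isLinear.Build R U V _ (@lin_fun f H) H.
Definition lin_of f (H : linear f) : {linear U -> V} := @lin_fun f H.

Fact lin_image_closed (f : {linear U -> V}) : linear_closed (fun v => exists u, f u = v).
Proof.
split=> [|a _ _ [u <-] [v <-]]; first by exists 0; rewrite linear0.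
by exists (a *: u + v); rewrite linearP.
Qed.
Definition lin_image f : submodClosed V := sub_of (lin_image_closed f).

Lemma lin_imageP (f : {linear U -> V}) v : reflect (exists u, f u = v) (v \in lin_image f).
Proof. exact: sub_ofP. Qed.

Lemma mem_lin_image (f : {linear U -> V}) u : f u \in lin_image f.
Proof. by apply/lin_imageP; exists u. Qed.

Lemma mem_kernel (f : {linear U -> V}) u : (u \in kernel f) = (f u == 0).
Proof. by []. Qed.

(** Linear relations replace maps that would otherwise be defined by choosing
    representatives, connecting maps above all. *)
Definition linear_rel (rho : U -> V -> Prop) : Prop :=
  rho 0 0 /\ forall (a : R) u u' v v', rho u v -> rho u' v' ->
    rho (a *: u + u') (a *: v + v').

Lemma linear_of_rel (rho : U -> V -> Prop) : linear_rel rho ->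
  (forall u, exists v, rho u v) -> (forall v, rho 0 v -> v = 0) ->
  exists f : {linear U -> V}, forall u, rho u (f u).
Proof.
move=> [rho0 rhoD] tot sv.
have uniq u v v' : rho u v -> rho u v' -> v = v'.
  move=> uv uv'; apply/eqP; rewrite -subr_eq0; apply/eqP/sv.
  by have := rhoD (-1) _ _ _ _ uv' uv; rewrite !scaleN1r addNr addrC.
have /choice [f fP] := tot.
have fL : linear f.
  by move=> a u v; apply: uniq (fP _) (rhoD _ _ _ _ _ (fP _) (fP _)).
by exists (lin_of fL).
Qed.

End Builders.

Section MapsBasics.
Context (R : comNzRingType).
Implicit Types (U V W : lmodType R).

Lemma factor_linear U V W (p : {linear U -> V}) (q : {linear U -> W}) :
  (forall v, exists u, p u = v) -> (forall u, p u = 0 -> q u = 0) ->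
  exists r : {linear V -> W}, forall u, r (p u) = q u.
Proof.
move=> psurj pq.
have [|v|w|r rP] := @linear_of_rel _ V W (fun v w => exists2 u, p u = v & q u = w).
- split=> [|a v v' w w' [u <- <-] [u' <- <-]]; first by exists 0; rewrite linear0.
  by exists (a *: u + u'); rewrite linearP.
- by have [u <-] := psurj v; exists (q u), u.
- by case=> u /pq ->.
exists r => u; have [u' pu' <-] := rP (p u).
by apply/eqP; rewrite -subr_eq0 -linearB pq ?eqxx // linearB pu' subrr.
Qed.

Lemma lift_injective U V W (f : {linear U -> V}) (g : {linear W -> V}) :
  injective f -> (forall w, exists u, f u = g w) ->
  exists h : {linear W -> U}, forall w, f (h w) = g w.
Proof.
move=> finj fg.
have [|w|u|h hP] := @linear_of_rel _ W U (fun w u => f u = g w); last by exists h.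
- by split=> [|a w w' u u' e e']; rewrite ?linear0 // !linearP e e'.
- exact: fg.
- by rewrite linear0 => fu; apply: finj; rewrite fu linear0.
Qed.

Lemma inj_linear U V (f : {linear U -> V}) :
  (forall u, f u = 0 -> u = 0) -> injective f.
Proof.
move=> f0 u v fuv; apply/eqP; rewrite -subr_eq0; apply/eqP/f0.
by rewrite linearB fuv subrr.
Qed.

Lemma submodN V (S : submodClosed V) v : v \in S -> - v \in S.
Proof. by rewrite -scaleN1r; exact: rpredZ. Qed.

Lemma submodB V (S : submodClosed V) u v : u \in S -> v \in S -> u - v \in S.
Proof. by move=> uS vS; rewrite rpredD ?submodN. Qed.

Definition scale_lin (a : R) V : {linear V -> V} := a \*: idfun.

Definition incl V (S : submodClosed V) : {linear submod S -> V} := val.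

Lemma quotmod_pi_eq0 V (S : submodClosed V) v : (quotmod_pi S v == 0) = (v \in S).
Proof. by rewrite -(linear0 (quotmod_pi S)) quotmod_pi_eq subr0. Qed.

Lemma quotmod_surj V (S : submodClosed V) (q : quotmod S) : exists v, quotmod_pi S v = q.
Proof. by exists (repr q); exact: quotmod_repr. Qed.

Lemma short_exact_sub V (S : submodClosed V) :
  short_exact (incl S) (quotmod_pi S : {linear V -> quotmod S}).
Proof.
split=> [|v|]; [exact: val_inj | | exact: quotmod_surj].
split=> [/eqP|[u <-]]; last by apply/eqP; rewrite quotmod_pi_eq0; exact: submod_valP.
by rewrite quotmod_pi_eq0 => vS; exists (Submod vS).
Qed.

Lemma short_exact_inj U V (f : {linear U -> V}) : injective f ->
  short_exact f (quotmod_pi (lin_image f) : {linear V -> quotmod (lin_image f)}).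
Proof.
move=> fi; split=> // [v|]; last exact: quotmod_surj.
split=> [/eqP|[u <-]]; first by rewrite quotmod_pi_eq0 => /lin_imageP.
by apply/eqP; rewrite quotmod_pi_eq0 mem_lin_image.
Qed.

Lemma short_exact_kernel U V (f : {linear U -> V}) :
  (forall v, exists u, f u = v) -> short_exact (incl (kernel f)) f.
Proof.
move=> fsurj; split=> [|u|//]; first exact: val_inj.
split=> [fu|[w <-]]; last by apply/eqP; rewrite -mem_kernel; exact: submod_valP.
have uP : u \in kernel f by rewrite mem_kernel fu.
by exists (Submod uP).
Qed.

Fact pair_linear U V W (f : {linear U -> V}) (g : {linear U -> W}) :
  linear (fun u => (f u, g u)).
Proof. by move=> a u v; rewrite !linearP. Qed.
Definition pair_lin U V W (f : {linear U -> V}) (g : {linear U -> W}) :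
  {linear U -> (V * W)%type} := lin_of (pair_linear f g).

Section Corestriction.
Context U V (f : {linear U -> V}) (S : submodClosed V) (fS : forall u, f u \in S).
Fact corestrict_linear : linear (fun u => Submod (fS u) : submod S).
Proof. by move=> a u v; apply: val_inj; exact: linearP. Qed.
Definition corestrict : {linear U -> submod S} := lin_of corestrict_linear.
End Corestriction.

Definition to_lin_image U V (f : {linear U -> V}) : {linear U -> submod (lin_image f)} :=
  corestrict (mem_lin_image f).

Lemma to_lin_image_surj U V (f : {linear U -> V}) w : exists u, to_lin_image f u = w.
Proof. by case: w => w wP; have /lin_imageP [u e] := wP; exists u; apply: val_inj. Qed.

Lemma short_exact_lin_image U V (f : {linear U -> V}) :
  short_exact (incl (kernel f)) (to_lin_image f).
Proof.
split=> [|u|]; [exact: val_inj | | exact: to_lin_image_surj].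
have [_ ke _] := @short_exact_kernel U _ (to_lin_image f) (@to_lin_image_surj _ _ f).
split=> [/(congr1 val) fu|[w <-]].
  have uP : u \in kernel f by rewrite mem_kernel; apply/eqP; exact: fu.
  by exists (Submod uP).
by apply: val_inj => /=; apply/eqP; rewrite -mem_kernel; exact: submod_valP.
Qed.

Lemma span_min V (A : V -> Prop) (S : submodClosed V) :
  (forall v, A v -> v \in S) -> {subset span A <= S}.
Proof. by move=> AS v /asboolP; apply. Qed.

Lemma mem_span V (A : V -> Prop) v : A v -> v \in span A.
Proof. by move=> Av; apply/asboolP => S; exact. Qed.

End MapsBasics.

Section Serre.
Context (R : comNzRingType) (C : lmodType R -> Prop).
Hypothesis CS : serre C.
Implicit Types (U V W : lmodType R).

Lemma serre_ses U V W (f : {linear U -> V}) (g : {linear V -> W}) :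
  short_exact f g -> C U -> C W -> C V.
Proof. by move=> ex CU CW; apply/(CS.2 _ _ _ _ _ ex). Qed.

Lemma serre_quot V W (g : {linear V -> W}) :
  (forall w, exists v, g v = w) -> C V -> C W.
Proof. by move=> gs; case/(CS.2 _ _ _ _ _ (short_exact_kernel gs)). Qed.

Lemma serre_sub U V (f : {linear U -> V}) : injective f -> C V -> C U.
Proof.
by move=> fi /(CS.2 _ _ _ _ _ (short_exact_inj fi)) [].
Qed.

Lemma serre_zero V : (forall v : V, v = 0) -> C V.
Proof.
move=> V0; have [W CW] := CS.1.
by apply: (serre_sub (f := (hom_zero V W : {linear V -> W}))) CW => u v _; rewrite (V0 u) (V0 v).
Qed.

Lemma serre_map V W (f : {linear V -> W}) : C (submod (kernel f)) -> C W -> C V.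
Proof.
move=> Ck CW; apply: (serre_ses (short_exact_lin_image f)) => //.
exact: (serre_sub (f := incl _) val_inj CW).
Qed.

(** The form in which exactness at V of U -> V -> W is used: the two maps may be
    linear relations, which spares the construction of connecting maps. *)
Lemma serre_exact U V W (rho : U -> V -> Prop) (sigma : V -> W -> Prop) :
  linear_rel rho -> linear_rel sigma ->
  (forall v, rho 0 v -> v = 0) -> (forall v, exists w, sigma v w) ->
  (forall v, sigma v 0 -> exists u, rho u v) ->
  C U -> C W -> C V.
Proof.
move=> [rho0 rhoD] [sigma0 sigmaD] rho_sv sigma_tot ex CU CW.
have S2P : linear_closed (fun p : V * W => sigma p.1 p.2).
  by split=> // a p q; exact: sigmaD.
have K1P : linear_closed (fun p : U * V => rho p.1 p.2 /\ sigma p.2 0).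
  split=> // a p q [p1 p2] [q1 q2]; split; first exact: rhoD.
  by have := sigmaD a _ _ _ _ p2 q2; rewrite scaler0 addr0.
pose G2 := submod (sub_of S2P); pose G1 := submod (sub_of K1P).
have pr1 : linear (fun p : G2 => (val p).1) by [].
have pr2 : linear (fun p : G2 => (val p).2) by [].
apply: (serre_quot (g := lin_of pr1)).
  by move=> v; have [w vw] := sigma_tot v;
    exists (Submod (introT (sub_ofP S2P (v, w)) vw)).
apply: (serre_map (f := lin_of pr2)) CW.
have qr1 : linear (fun p : G1 => (val p).1) by [].
have qP (p : G1) : ((val p).2, 0) \in sub_of S2P.
  by have /sub_ofP [_ ?] := valP p; apply/sub_ofP.
have q2 : linear (fun p : G1 => (val p).2) by [].
pose q : {linear G1 -> G2} :=
  corestrict (f := pair_lin (lin_of q2) (hom_zero G1 W : {linear G1 -> W})) qP.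
have qK p : q p \in kernel (lin_of pr2) by rewrite mem_kernel.
have CG1 : C G1.
  apply: (serre_sub (f := lin_of qr1)) CU; apply: inj_linear => -[[u v] p] u0.
  apply: val_inj => /=; have {}u0 : u = 0 := u0.
  by have /sub_ofP /= [+ _] := p; rewrite u0 => /rho_sv ->.
apply: (serre_quot (g := corestrict qK)) CG1 => -[[[v w] wP] /= wK].
have w0 : w = 0 by apply/eqP; exact: wK.
move: wP wK; rewrite {}w0 => wP wK.
have /sub_ofP /= s0 := wP; have [u uv] := ex _ s0.
exists (Submod (introT (sub_ofP K1P (u, v)) (conj uv s0))).
by do 2!apply: val_inj.
Qed.

Lemma serre_bij V W (f : {linear V -> W}) :
  injective f -> (forall w, exists v, f v = w) -> C V <-> C W.
Proof. by move=> fi fs; split; [exact: (serre_quot fs) | exact: (serre_sub fi)]. Qed.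

Lemma serre_family (I : eqType) (s : seq I) V W (f : I -> {linear V -> W}) :
  C W -> (forall v, (forall i, i \in s -> f i v = 0) -> v = 0) -> C V.
Proof.
move=> CW; elim: s V f => [|i s IHs] V f f0; first by apply: serre_zero => v; exact: f0.
apply: (serre_map (f := f i)) CW.
apply: (IHs _ (fun j => f j \o incl (kernel (f i)) : {linear _ -> _})) => v fv.
apply: val_inj; apply: f0 => j; rewrite inE => /predU1P [->|/fv //].
by apply/eqP; rewrite -mem_kernel; exact: submod_valP.
Qed.

Lemma colon0P V (A : {pred R}) v :
  reflect (forall c, c \in A -> c *: v = 0)
    (v \in @GRing.SubmodClosed.clone R V (@colon0_pred R V A) _).
Proof. exact: asboolP. Qed.

End Serre.

(** * Noetherian modules and powers of ideals *)

Section Generation.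
Context (R : comNzRingType).
Implicit Types (U V W : lmodType R).

Notation span_seq s := (span (fun w => w \in s)).

Fact lin_preimage_closed U V (f : {linear U -> V}) (T : submodClosed V) :
  linear_closed (fun u => f u \in T).
Proof. by split=> [|a u v fu fv]; rewrite ?linear0 ?rpred0 // linearP rpredD ?rpredZ. Qed.
Definition lin_preimage U V (f : {linear U -> V}) (T : submodClosed V) : submodClosed U :=
  sub_of (lin_preimage_closed f T).

Lemma lin_preimageP U V (f : {linear U -> V}) (T : submodClosed V) u :
  (u \in lin_preimage f T) = (f u \in T).
Proof. by apply/sub_ofP/idP. Qed.

Lemma span_ind V (A P : V -> Prop) : linear_closed P -> (forall v, A v -> P v) ->
  forall v, v \in span A -> P v.
Proof.
move=> H AP v vA; suff: v \in sub_of H by move=> /sub_ofP.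
apply: (span_min _ vA) => w /AP ?; exact/(sub_ofP H).
Qed.

Fact zero_closed V : linear_closed (fun v : V => v = 0).
Proof. by split=> // a _ _ -> ->; rewrite scaler0 addr0. Qed.

Lemma span_nil V (v : V) : v \in span_seq [::] -> v = 0.
Proof. exact: (span_ind (zero_closed V)). Qed.

Fact span_cons_closed V (x : V) (S : submodClosed V) :
  linear_closed (fun v => exists c w, w \in S /\ v = c *: x + w).
Proof.
split=> [|a _ _ [c [w [wS ->]]] [c' [w' [wS' ->]]]].
  by exists 0, 0; rewrite rpred0 scale0r addr0.
exists (a * c + c'), (a *: w + w'); split; first by rewrite rpredD ?rpredZ.
by rewrite scalerDr scalerDl scalerA addrACA.
Qed.

Lemma span_consP V (x : V) (s : seq V) v : v \in span_seq (x :: s) ->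
  exists c w, w \in span_seq s /\ v = c *: x + w.
Proof.
apply: (span_ind (span_cons_closed x (span_seq s))) => w; rewrite inE => /predU1P [->|ws].
  by exists 1, 0; rewrite rpred0 scale1r addr0.
by exists 0, w; rewrite scale0r add0r mem_span.
Qed.

Lemma span_catl V (s t : seq V) : {subset span_seq s <= span_seq (s ++ t)}.
Proof. by apply: span_min => v vs; apply: mem_span; rewrite mem_cat vs. Qed.

Lemma span_catr V (s t : seq V) : {subset span_seq t <= span_seq (s ++ t)}.
Proof. by apply: span_min => v vs; apply: mem_span; rewrite mem_cat vs orbT. Qed.

Lemma fg_of_span V (S : submodClosed V) (s : seq V) : S =i span_seq s ->
  finitely_generated (submod S).
Proof.
move=> Ss; pose t : seq (submod S) := pmap insub s.
exists t => v.
have KP : linear_closed (fun u => exists2 w : submod S, val w = u & w \in span_seq t).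
  split=> [|a _ _ [w <- wt] [w' <- wt']]; first by exists 0; rewrite ?rpred0.
  by exists (a *: w + w') => //; rewrite rpredD ?rpredZ.
have : val v \in span_seq s by rewrite -Ss; exact: submod_valP.
move=> /(span_ind KP) [u us|w /val_inj -> //].
have uS : u \in S by rewrite Ss mem_span.
exists (Submod uS) => //; apply: mem_span.
by rewrite mem_pmap; apply/mapP; exists u => //; rewrite insubT.
Qed.

Lemma fg_surj V W (g : {linear V -> W}) :
  (forall w, exists v, g v = w) -> finitely_generated V -> finitely_generated W.
Proof.
move=> gs [s sV]; exists (map g s) => w; have [v <-] := gs w.
rewrite -lin_preimageP; suff: {subset span_seq s <= lin_preimage g (span_seq (map g s))} by apply.
by apply: span_min => u us; rewrite lin_preimageP mem_span // map_f.
Qed.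

Lemma fg_quot V (S : submodClosed V) : finitely_generated V -> finitely_generated (quotmod S).
Proof. exact: fg_surj (@quotmod_surj _ _ S). Qed.

Hypothesis noethR : noetherian R.

(** Induction on a list of generators of V: the coefficients on the first generator
    of the elements of S form an ideal, and what remains of S lies in the span of the
    other generators. *)
Lemma noetherian_sub V (S : submodClosed V) :
  finitely_generated V -> exists s : seq V, S =i span_seq s.
Proof.
case=> s sV.
suff [t tP] : exists t : seq V, {subset t <= S} /\ {subset [predI S & span_seq s] <= span_seq t}.
  exists t => v; apply/idP/idP => [vS|]; first by apply: tP.2; rewrite inE vS sV.
  by apply: span_min => w; exact: tP.1.
elim: s {sV} => [|x s [t [tS St]]].
  exists [::]; split=> // v /andP [_ /span_nil ->]; exact: rpred0.
have IP : linear_closed (fun c : R^o => exists w, w \in span_seq s /\ (c : R) *: x + w \in S).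
  split=> [|a c c' [w [ws wS]] [w' [ws' wS']]].
    by exists 0; rewrite rpred0 scale0r addr0 rpred0.
  exists (a *: w + w'); rewrite rpredD ?rpredZ //; split=> //.
  by rewrite scalerDl -scalerA addrACA -scalerDr rpredD ?rpredZ.
have [cs csP] := noethR (sub_of IP).
have /choice [f fP] : forall c : R, exists w, c \in cs -> w \in span_seq s /\ c *: x + w \in S.
  move=> c; case: (boolP (c \in cs)) => [ccs|]; last by exists 0.
  have /sub_ofP [w wP] : (c : R^o) \in sub_of IP by rewrite csP mem_span.
  by exists w.
(* for each generator c of the ideal, an element of S with first coefficient c *)
pose u := [seq c *: x + f c | c <- cs].
exists (u ++ t); split=> [v|v /andP [vS]].
  by rewrite mem_cat => /orP [/mapP [c /fP [_ ?] ->]|/tS].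
move=> /span_consP [c [w [ws vE]]].
have KP : linear_closed (fun c : R^o => exists w, w \in span_seq s /\ (c : R) *: x + w \in span_seq u).
  split=> [|a d d' [w1 [ws1 wS1]] [w' [ws' wS']]].
    by exists 0; rewrite rpred0 scale0r addr0 rpred0.
  exists (a *: w1 + w'); rewrite rpredD ?rpredZ //; split=> //.
  by rewrite scalerDl -scalerA addrACA -scalerDr rpredD ?rpredZ.
have : (c : R^o) \in sub_of KP.
  suff: {subset (sub_of IP : {pred R^o}) <= sub_of KP}.
    by apply; apply/sub_ofP; exists w; rewrite -vE.
  move=> d; rewrite csP; apply: span_min => e ecs; apply/sub_ofP.
  exists (f e); split; first exact: (fP _ ecs).1.
  by apply: mem_span; apply: map_f.
move=> /sub_ofP [w' [ws' wu]].
have uS : {subset span_seq u <= S}.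
  by apply: span_min => y /mapP [d /fP [_ ?] ->].
have vE' : v = (c *: x + w') + (w - w') by rewrite vE -addrA; congr (_ + _); rewrite addrC subrK.
have wwS : w - w' \in S.
  suff -> : w - w' = v - (c *: x + w') by rewrite submodB // uS.
  by rewrite vE opprD addrACA subrr add0r.
rewrite {}vE' rpredD //; first exact: span_catl.
by apply: span_catr; apply: St; apply/andP; split=> //; exact: submodB.
Qed.

Lemma fg_sub V (S : submodClosed V) :
  finitely_generated V -> finitely_generated (submod S).
Proof. by move=> /(noetherian_sub S) [s] /fg_of_span. Qed.

(** Otherwise P fails along a strictly increasing sequence of submodules. Its union
    is finitely generated, hence equal to one of them. *)
Lemma noetherian_ind V (P : submodClosed V -> Prop) : finitely_generated V ->
  (forall S : submodClosed V, (forall S' : submodClosed V, {subset S <= S'} -> (exists2 v, v \in S' & v \notin S) -> P S') ->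
     P S) ->
  forall S, P S.
Proof.
move=> fgV IH S; apply: contrapT => nPS.
have next (Q : submodClosed V) : exists S' : submodClosed V, ~ P Q ->
    [/\ ~ P S', {subset Q <= S'} & exists2 v, v \in S' & v \notin Q].
  have [PQ|nP] := pselect (P Q); first by exists Q.
  apply: contrapT => no; apply: nP; apply: IH => S' SS' lt; apply: contrapT => nPS'.
  by apply: no; exists S'.
have /choice [nx nxP] := next.
pose T k := iter k nx S.
have nT k : ~ P (T k) by elim: k => //= k /nxP [].
have Tmono k l : (k <= l)%N -> {subset T k <= T l}.
  elim: l => [|l IHl]; first by rewrite leqn0 => /eqP ->.
  rewrite leq_eqVlt => /predU1P [-> //|/IHl kl] v /kl vl.
  by have [_ + _] := nxP _ (nT l); apply.
have UP : linear_closed (fun v => exists k, v \in T k).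
  split=> [|a u v [k uk] [l vl]]; first by exists 0; exact: rpred0.
  exists (maxn k l); rewrite rpredD ?rpredZ //.
    exact: (Tmono _ _ (leq_maxl _ _)).
  exact: (Tmono _ _ (leq_maxr _ _)).
have [s sP] := noetherian_sub (sub_of UP) fgV.
have [k kP] : exists k, forall v, v \in s -> v \in T k.
  have : forall v, v \in s -> exists k, v \in T k.
    by move=> v vs; apply/(sub_ofP UP); rewrite sP mem_span.
  elim: (s) => [|x s' IHs] sT; first by exists 0%N.
  have [k xk] := sT x (mem_head _ _).
  have [v vs'|l lP] := IHs; first by apply: sT; rewrite inE vs' orbT.
  exists (maxn k l) => v; rewrite inE => /predU1P [->|/lP].
    exact: (Tmono _ _ (leq_maxl _ _)).
  exact: (Tmono _ _ (leq_maxr _ _)).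
have [_ _ [v vk nvk]] := nxP _ (nT k).
case/negP: nvk; have : v \in sub_of UP by apply/sub_ofP; exists k.+1.
by rewrite sP; apply: span_min.
Qed.

End Generation.

Section IdealPowers.
Context (R : comNzRingType).
Implicit Types (I J K : ideal R) (U V W N : lmodType R).

Lemma ideal_mul_min V I (N S : submodClosed V) :
  (forall c w, c \in I -> w \in N -> (c : R) *: w \in S) ->
  {subset ideal_mul I N <= S}.
Proof. by move=> H; apply: span_min => _ [c [w [cI wN ->]]]; exact: H. Qed.

Lemma mem_ideal_mul V I (N : submodClosed V) (c : R^o) w :
  c \in I -> w \in N -> (c : R) *: w \in ideal_mul I N.
Proof. by move=> cI wN; apply: mem_span; exists c, w. Qed.

Lemma ideal_pow_decr I k : {subset ideal_pow I k.+1 <= ideal_pow I k}.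
Proof. by apply: ideal_mul_min => c w _; exact: rpredZ. Qed.

Lemma ideal_pow_le I k l : (k <= l)%N -> {subset ideal_pow I l <= ideal_pow I k}.
Proof.
elim: l => [|l IHl]; first by rewrite leqn0 => /eqP ->.
by rewrite leq_eqVlt => /predU1P [-> //|/IHl kl] c /ideal_pow_decr /kl.
Qed.

Lemma ideal_pow_sub I J k : {subset I <= J} -> {subset ideal_pow I k <= ideal_pow J k}.
Proof.
move=> IJ; elim: k => //= k IHk; apply: ideal_mul_min => c w cI wI.
by apply: mem_ideal_mul; [exact: IJ | exact: IHk].
Qed.

Lemma ideal_mulC (I : ideal R) (c d : R^o) : c \in I -> (c : R) * d \in I.
Proof. by move=> cI; rewrite mulrC; exact: (rpredZ (d : R)). Qed.

Lemma ideal_pow1 I : ideal_pow I 1 =i I.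
Proof.
move=> c; apply/idP/idP; last first.
  move=> cI; rewrite -[c](mulr1 (c : R)).
  exact: (@mem_ideal_mul R^o I (top R^o) c 1).
by apply: (@ideal_mul_min R^o) => d w dI _; exact: ideal_mulC.
Qed.

Lemma expr_ideal_pow I (c : R) k : (c : R^o) \in I -> (c ^+ k : R^o) \in ideal_pow I k.
Proof. by move=> cI; elim: k => // k IHk; rewrite exprS; exact: mem_ideal_mul. Qed.

Lemma ideal_addP I J c : reflect (exists s t, [/\ s \in I, t \in J & c = s + t])
  (c \in ideal_add I J).
Proof. exact: asboolP. Qed.

(** Induction on k + l. In a product of a factor d + e, with d in I and e in J, by an
    element of the power n, the summand d raises the exponent of I, and e that of J. *)
Lemma ideal_pow_add I J k l :
  {subset ideal_pow (ideal_add I J) (k + l) <= ideal_add (ideal_pow I k) (ideal_pow J l)}.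
Proof.
move: {2}(k + l)%N (erefl (k + l)%N) => n.
elim: n k l => [|n IHn] [|k] [|l] //= kln c cI; apply/ideal_addP;
  try by exists c, 0; rewrite rpred0 addr0.
- by exists 0, c; rewrite rpred0 add0r.
apply/(ideal_addP (ideal_pow I k.+1) (ideal_pow J l.+1)).
move: c cI; apply: (@ideal_mul_min R^o _ _ (ideal_add (ideal_pow I k.+1) (ideal_pow J l.+1))).
move=> c w /ideal_addP [d [e [dI eJ ->]]] wK; rewrite scalerDl rpredD //.
  have /ideal_addP [s [t [sI tJ ->]]] : w \in ideal_add (ideal_pow I k) (ideal_pow J l.+1).
    by apply: IHn; [move: kln => [] | ].
  rewrite scalerDr; apply/ideal_addP; exists ((d : R) *: s), ((d : R) *: t).
  by split=> //; [exact: mem_ideal_mul | exact: rpredZ].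
have /ideal_addP [s [t [sI tJ ->]]] : w \in ideal_add (ideal_pow I k.+1) (ideal_pow J l).
  by apply: IHn; [move: kln => []; rewrite addnS | move: wK; rewrite addnS].
rewrite scalerDr; apply/ideal_addP; exists ((e : R) *: s), ((e : R) *: t).
by split=> //; [exact: rpredZ | exact: mem_ideal_mul].
Qed.

Lemma ideal_pow_principal (c : R) k (I : ideal R) : (c ^+ k : R^o) \in I ->
  {subset ideal_pow (ideal_gen [:: c]) k <= I}.
Proof.
move=> ckI d dP; suff [e ->] : exists e : R, d = e * c ^+ k by exact: (rpredZ (e : R)).
elim: k {I ckI} d dP => [|k IHk] d; first by exists d; rewrite mulr1.
have H : linear_closed (fun d : R^o => exists e : R, d = e * c ^+ k.+1).
  split=> [|a _ _ [u ->] [v ->]]; first by exists 0; rewrite mul0r.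
  by exists (a * u + v); rewrite mulrDl -mulrA.
apply: (span_ind H) => _ [u [w [uc /IHk [e ->] ->]]].
have [u' [w' [/span_nil -> ->]]] := span_consP uc.
by exists (u' * e); rewrite addr0 exprS /GRing.scale /= -!mulrA; congr (_ * _); rewrite mulrCA.
Qed.

(** One generator c at a time, as (Rc + J)^(m + k) lies in (Rc)^m + J^k. This reduces
    the nilpotence of an ideal on a module to that of its generators. *)
Lemma ideal_pow_gen (s : seq R) (I : ideal R) :
  (forall c, c \in s -> exists m, (c ^+ m : R^o) \in I) ->
  exists k, {subset ideal_pow (ideal_gen s) k <= I}.
Proof.
elim: s => [|c s IHs] sI.
  exists 1%N; apply: ideal_mul_min => d w /span_nil -> _.
  by rewrite scale0r rpred0.
have [|k kI] := IHs; first by move=> d ds; apply: sI; rewrite inE ds orbT.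
have [m /ideal_pow_principal mI] := sI c (mem_head _ _).
exists (m + k)%N => d dP.
have /ideal_addP [u [v [/mI uI /kI vI ->]]] :
    d \in ideal_add (ideal_pow (ideal_gen [:: c]) m) (ideal_pow (ideal_gen s) k).
  apply: ideal_pow_add; apply: ideal_pow_sub dP => e ecs; apply/ideal_addP.
  have [u [w [ws ->]]] := span_consP ecs.
  by exists ((u : R) *: (c : R^o)), w; split=> //; apply/rpredZ/mem_span; rewrite mem_head.
exact: rpredD.
Qed.

Definition nilpotent_on I V : Prop := exists k, {subset ideal_pow I k <= Ann V}.

Lemma AnnP V (c : R^o) : reflect (forall v : V, (c : R) *: v = 0) (c \in Ann V).
Proof. exact: asboolP. Qed.

Lemma Ann_inj U V (f : {linear U -> V}) : injective f -> {subset Ann V <= Ann U}.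
Proof.
move=> fi c /AnnP cV; apply/AnnP => u; apply: fi.
by rewrite linearZ /= cV linear0.
Qed.

Lemma Ann_surj V W (g : {linear V -> W}) : (forall w, exists v, g v = w) ->
  {subset Ann V <= Ann W}.
Proof.
move=> gs c /AnnP cV; apply/AnnP => w; have [v <-] := gs w.
by rewrite -linearZ /= cV linear0.
Qed.

Lemma nilpotent_inj I U V (f : {linear U -> V}) :
  injective f -> nilpotent_on I V -> nilpotent_on I U.
Proof. by move=> fi [k kP]; exists k => c /kP; exact: (Ann_inj fi). Qed.

Lemma nilpotent_surj I V W (g : {linear V -> W}) :
  (forall w, exists v, g v = w) -> nilpotent_on I V -> nilpotent_on I W.
Proof. by move=> gs [k kP]; exists k => c /kP; exact: (Ann_surj gs). Qed.

Lemma nilpotent_gen I (s : seq R) V : I =i ideal_gen s ->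
  (forall c, c \in s -> exists m, forall v : V, c ^+ m *: v = 0) -> nilpotent_on I V.
Proof.
move=> Is sV; have [|k kP] := @ideal_pow_gen s (Ann V).
  by move=> c /sV [m mV]; exists m; apply/AnnP.
by exists k => c cI; apply: kP; apply: ideal_pow_sub cI => d; rewrite Is.
Qed.

Hypothesis noethR : noetherian R.

(** A weak form of the Artin-Rees lemma. Take W maximal among the submodules of N
    that meet N' in a^k N'. Every c in a is nilpotent on N / W: once the
    submodules (W : c^m) are stationary, W + c^m N meets N' in a^k N' as well. *)
Lemma artin_rees (N' N : lmodType R) (f : {linear N' -> N}) (a : ideal R) k :
  injective f -> finitely_generated N -> exists l, forall n',
    f n' \in ideal_mul (ideal_pow a l) (top N) -> n' \in ideal_mul (ideal_pow a k) (top N').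
Proof.
move=> fi fgN; set D := ideal_mul _ (top N').
pose good (W : submodClosed N) := forall n', f n' \in W <-> n' \in D.
have [W [gW Wmax]] : exists W : submodClosed N, good W /\
    forall W' : submodClosed N, good W' -> {subset W <= W'} -> {subset W' <= W}.
  have W0P : linear_closed (fun v => exists2 d, d \in D & f d = v).
    split=> [|c _ _ [d dD <-] [e eD <-]]; first by exists 0; rewrite ?rpred0 ?linear0.
    by exists (c *: d + e); rewrite ?linearP // rpredD ?rpredZ.
  suff H : forall W : submodClosed N, good W -> exists W' : submodClosed N, good W' /\
      forall W'' : submodClosed N, good W'' -> {subset W' <= W''} -> {subset W'' <= W'}.
    apply: (H (sub_of W0P)) => n'; split=> [/sub_ofP [d dD /fi <- //]|n'D].
    by apply/sub_ofP; exists n'.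
  apply: (noetherian_ind noethR fgN) => W IH gW; apply: contrapT => no.
  apply: (no); exists W; split=> // W' gW' WW' v vW'; apply: contrapT => /negP nvW.
  by apply: no; apply: (IH W') => //; exists v.
have [s sP] := noethR a.
have cW (c : R) : (c : R^o) \in a -> exists m, forall n, c ^+ m *: n \in W.
  move=> ca.
  have [m mP] : exists m, forall n, c ^+ (m + k) *: n \in W -> c ^+ m *: n \in W.
    pose T m : {linear N -> N} := lin_of (fun a u v => linearP (GRing.scale (c ^+ m)) a u v).
    have TE m n : T m n = c ^+ m *: n by [].
    suff H : forall S : submodClosed N, forall m, S =i lin_preimage (T m) W ->
        exists m, forall n, c ^+ (m + k) *: n \in W -> c ^+ m *: n \in W.
      exact: (H _ 0%N (fun=> erefl)).
    apply: (noetherian_ind noethR fgN) => S IH m Sm; apply: contrapT => no.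
    apply: (no); exists m => n nP; apply: contrapT => /negP nn.
    apply: no; apply: (IH (lin_preimage (T (m + k)%N) W) _ _ (m + k)%N) => // [v|].
      by rewrite Sm !lin_preimageP !TE addnC exprD -scalerA => ?; exact: rpredZ.
    by exists n; rewrite ?Sm lin_preimageP.
  exists m => n.
  have W'P : linear_closed (fun v => exists2 w, w \in W & exists q, v = w + c ^+ m *: q).
    split=> [|d _ _ [w wW [q ->]] [w' wW' [q' ->]]].
      by exists 0; rewrite ?rpred0 //; exists 0; rewrite scaler0 addr0.
    exists (d *: w + w'); first by rewrite rpredD ?rpredZ.
    by exists (d *: q + q'); rewrite !scalerDr addrACA !scalerA [d * _]mulrC.
  apply: (Wmax (sub_of W'P)).
  - move=> n'; split=> [/sub_ofP [w wW [q e]]|/gW fW]; last first.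
      by apply/sub_ofP; exists (f n') => //; exists 0; rewrite scaler0 addr0.
    apply/gW; rewrite e rpredD // mP // addnC exprD -scalerA.
    have -> : c ^+ m *: q = f n' - w by rewrite e addrC addKr.
    rewrite scalerBr; apply: submodB; last exact: rpredZ.
    have -> : c ^+ k *: f n' = f (c ^+ k *: n') by rewrite linearZ.
    apply/gW.
    by apply: mem_ideal_mul; first exact: expr_ideal_pow.
  - by move=> w wW; apply/sub_ofP; exists w => //; exists 0; rewrite scaler0 addr0.
  by apply/sub_ofP; exists 0; rewrite ?rpred0 //; exists n; rewrite add0r.
have IP : linear_closed (fun c : R^o => forall n, (c : R) *: n \in W).
  split=> [n|d u v uW vW n]; first by rewrite scale0r rpred0.
  by rewrite scalerDl -scalerA rpredD ?vW // rpredZ ?uW.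
have [|l lP] := @ideal_pow_gen s (sub_of IP).
  move=> c cs; have [|m mP] := cW c; first by rewrite sP mem_span.
  by exists m; apply/(sub_ofP IP).
exists l => n' n'P; apply/gW; apply: ideal_mul_min n'P => c w ca _.
have /sub_ofP : c \in sub_of IP by apply: lP; apply: ideal_pow_sub ca => d; rewrite sP.
exact.
Qed.

End IdealPowers.

(** * Ext as a cohomological functor of its first argument *)

Section SyzygyMaps.
Context (R : comNzRingType).
Implicit Types (N V F : lmodType R).

Lemma augment_var N (x : N) : augment N (free_var x) = x.
Proof. exact: free_lift_var. Qed.

Lemma syz_map_id N i (y : syz N i) : syz_map (idfun : {linear N -> N}) i y = y.
Proof.
elim: i y => //= i IHi y; apply: val_inj => /=.
have := @free_ext R (syz N i) _ (free_map (syz_map (idfun : {linear N -> N}) i)) idfun.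
by apply=> x; rewrite /= free_lift_var IHi.
Qed.

Lemma free_map_comp N N' N'' (f : N -> N') (g : N' -> N'') (h : N -> N'') :
  (forall x, g (f x) = h x) -> forall D, free_map g (free_map f D) = free_map h D.
Proof.
move=> fgh; apply: (@free_ext _ _ _ (free_map g \o free_map f) (free_map h)) => x /=.
by rewrite !free_lift_var fgh.
Qed.

Lemma syz_map_comp N N' N'' (f : {linear N -> N'}) (g : {linear N' -> N''})
    (h : {linear N -> N''}) i : (forall x, g (f x) = h x) ->
  forall y, syz_map g i (syz_map f i y) = syz_map h i y.
Proof.
move=> fgh; elim: i => //= i IHi y; apply: val_inj => /=.
exact: free_map_comp.
Qed.

Lemma eq_syz_map N N' (f g : {linear N -> N'}) i : f =1 g -> syz_map f i =1 syz_map g i.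
Proof.
by move=> fg y; rewrite -[in RHS](syz_map_id y); apply/esym/syz_map_comp => x; rewrite fg.
Qed.

(** The recursion of syz adds the new syzygy on the outside, so that syz N i.+1 and
    syz (syz N 1) i are isomorphic without being convertible. *)
Fixpoint syz_shift N i : {linear syz N i.+1 -> syz (syz N 1) i} :=
  match i with
  | 0 => idfun
  | j.+1 => syz_map (syz_shift N j) 1
  end.

Fixpoint syz_unshift N i : {linear syz (syz N 1) i -> syz N i.+1} :=
  match i with
  | 0 => idfun
  | j.+1 => syz_map (syz_unshift N j) 1
  end.

Lemma syz_shiftK N i y : syz_unshift N i (syz_shift N i y) = y.
Proof.
elim: i y => // i IHi y; rewrite -[RHS](@syz_map_id (syz N i.+1) 1 y).
exact: (@syz_map_comp _ _ _ (syz_shift N i) (syz_unshift N i) _ 1).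
Qed.

Lemma syz_unshiftK N i y : syz_shift N i (syz_unshift N i y) = y.
Proof.
elim: i y => // i IHi y; rewrite -[RHS](@syz_map_id (syz (syz N 1) i) 1 y).
exact: (@syz_map_comp _ _ _ (syz_unshift N i) (syz_shift N i) _ 1).
Qed.

Lemma syz_shift_nat N N' (f : {linear N -> N'}) i y :
  syz_shift N' i (syz_map f i.+1 y) = syz_map (syz_map f 1) i (syz_shift N i y).
Proof.
elim: i y => // i IHi y.
rewrite [LHS](@syz_map_comp _ _ _ (syz_map f i.+1) (syz_shift N' i)
  (syz_shift N' i \o syz_map f i.+1 : {linear _ -> _}) 1) //.
by apply/esym/(@syz_map_comp _ _ _ (syz_shift N i) (syz_map (syz_map f 1) i) _ 1) => x; rewrite -IHi.
Qed.

(** Projectivity of N, in the form of a splitting of its canonical free cover. *)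
Definition split_cover N : Prop :=
  exists s : {linear N -> free N}, forall x, augment N (s x) = x.

Lemma split_cover_free N : split_cover (free N).
Proof.
exists (free_map (@free_var R N)) => D.
have := @free_ext R N _ (augment (free N) \o free_map (@free_var R N)) idfun.
by apply=> x /=; rewrite /augment !free_lift_var.
Qed.

Lemma split_cover_retract N : split_cover N ->
  exists r : {linear free N -> syz N 1}, forall y, r (val y) = y.
Proof.
move=> [s sK].
pose r0 : {linear free N -> free N} := idfun \- (s \o augment N).
have rP D : r0 D \in kernel (augment N) by rewrite mem_kernel linearB /= sK subrr.
exists (corestrict rP) => y; apply: val_inj.
have /eqP y0 : augment N (val y) == 0 by rewrite -mem_kernel; exact: submod_valP.
by rewrite [LHS](_ : _ = val y - s (augment N (val y))) // y0 linear0 subr0.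
Qed.

Lemma split_cover_syz N i : split_cover N -> split_cover (syz N i).
Proof.
move=> sN; elim: i => //= i /split_cover_retract [r rK].
exists (free_map (fun x => r (free_var x)) \o incl _ : {linear _ -> _}) => y.
rewrite -[RHS]rK /=.
have := @free_ext R (syz N i) _ (augment (syz N i.+1) \o free_map (fun x => r (free_var x))) r.
by apply=> x /=; rewrite !free_lift_var.
Qed.

End SyzygyMaps.

Section ExtFunctor.
Context (R : comNzRingType) (X : lmodType R).
Implicit Types (N V F : lmodType R).

Local Notation T i N := (Ext i N X).
Local Notation Tm i f := (Ext_map i X f).

Fact ext_class_subproof N i (phi : hom (syz N i) X) :
  hom_precomp (augment (syz N i)) phi \in kernel (cdiff (ext_complex X N) i).
Proof.
rewrite mem_kernel; apply/eqP/hom_eq => D /=.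
set w := augment _ D; have /eqP -> : augment (syz N i) (val w) == 0.
  by rewrite -mem_kernel; exact: submod_valP.
by rewrite linear0.
Qed.

(** A cocycle of Hom(free (syz N i), X) vanishes on the kernel of the cover of
    syz N i, hence is a linear map on syz N i. It is a coboundary when that map extends
    to free (syz N i.-1), or vanishes if i = 0. *)
Definition ext_class N i : {linear hom (syz N i) X -> T i N} :=
  quotmod_pi (coboundary (ext_complex X N) i) \o corestrict (@ext_class_subproof N i).

Lemma ext_class_surj N i (xi : T i N) : exists phi, ext_class N i phi = xi.
Proof.
have [z <-] := quotmod_surj xi.
have zK (D : free (syz N i)) : augment _ D = 0 -> (val z : {linear _ -> _}) D = 0.
  move=> D0; have DP : D \in kernel (augment (syz N i)) by rewrite mem_kernel D0.
  have /eqP := submod_valP z; rewrite -/(ext_complex X N) => zd.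
  have := congr1 (fun h : hom _ _ => (h : {linear _ -> _}) (free_var (Submod DP : syz N i.+1))) zd.
  by rewrite /= /augment free_lift_var.
have [phi phiP] := factor_linear (@augment_surj R (syz N i)) zK.
exists phi; congr (quotmod_pi _ _); apply: val_inj; apply: hom_eq => D.
exact: phiP.
Qed.

Definition ext_trivial N i : hom (syz N i) X -> Prop :=
  match i return hom (syz N i) X -> Prop with
  | 0 => fun phi => phi = 0
  | j.+1 => fun phi => exists u : {linear free (syz N j) -> X},
      forall y : syz N j.+1, u (val y) = (phi : {linear _ -> _}) y
  end.

Lemma ext_class_eq0 N i (phi : hom (syz N i) X) :
  ext_class N i phi = 0 <-> ext_trivial phi.
Proof.
rewrite (rwP eqP) quotmod_pi_eq0; case: i phi => [|i] phi /=.
  split=> [/eqP/(congr1 val) phi0|->].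
    apply: hom_eq => x; have := congr1 (fun h : hom _ _ => (h : {linear _ -> _}) (free_var x)) phi0.
    by rewrite /= /augment free_lift_var.
  by apply/eqP; rewrite linear0.
split=> [/asboolP [u uP]|[u uP]].
  exists u => y; have := congr1 (fun h : hom _ _ => (h : {linear _ -> _}) (free_var y)) uP.
  by rewrite /= /augment !free_lift_var.
apply/asboolP; exists u; apply: hom_eq => D /=; exact: uP.
Qed.

Lemma Ext_map_class N N' (f : {linear N -> N'}) i (phi : hom (syz N' i) X) :
  Tm i f (ext_class N' i phi) = ext_class N i (hom_precomp (syz_map f i) phi).
Proof.
rewrite /= [LHS]quotmod_mapE; congr (quotmod_pi _ _); apply: val_inj.
by apply: hom_eq => D /=; rewrite augment_nat.
Qed.

Lemma Ext_map_comp N N' N'' (f : {linear N -> N'}) (g : {linear N' -> N''})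
    (h : {linear N -> N''}) i xi : (forall x, g (f x) = h x) ->
  Tm i f (Tm i g xi) = Tm i h xi.
Proof.
move=> fgh; have [phi <-] := ext_class_surj xi; rewrite !Ext_map_class.
by congr (ext_class _ _ _); apply: hom_eq => y /=; rewrite (syz_map_comp fgh).
Qed.

Lemma Ext_map_id N (f : {linear N -> N}) i xi : f =1 id -> Tm i f xi = xi.
Proof.
move=> fid; have [phi <-] := ext_class_surj xi; rewrite !Ext_map_class.
congr (ext_class _ _ _); apply: hom_eq => y /=.
by rewrite (@eq_syz_map _ _ _ f idfun) // syz_map_id.
Qed.

Lemma Ext_split_cover N i (xi : T i.+1 N) : split_cover N -> xi = 0.
Proof.
move=> /(split_cover_syz i)/split_cover_retract [r rK].
have [phi <-] := ext_class_surj xi; apply/ext_class_eq0.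
by exists ((phi : {linear _ -> _}) \o r : {linear _ -> _}) => y /=; rewrite rK.
Qed.

(** Dimension shifting. With the properties of this map proved next, the sequence
    Ext^i(free N, X) -> Ext^i(syz N 1, X) -> Ext^(i+1)(N, X) -> 0 is exact for all i,
    including i = 0, which allows uniform inductions on the degree. *)
Lemma Ext_shift_exists N i : exists sh : {linear T i (syz N 1) -> T i.+1 N},
  forall phi, sh (ext_class _ i phi) = ext_class N i.+1 (hom_precomp (syz_shift N i) phi).
Proof.
apply: (factor_linear (p := ext_class (syz N 1) i)
  (q := ext_class N i.+1 \o hom_precomp (syz_shift N i) : {linear _ -> _})).
  exact: ext_class_surj.
move=> phi /ext_class_eq0 phi0; apply/ext_class_eq0.
case: i phi phi0 => [|i] phi /=; first by move=> ->; exists (hom_zero _ _).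
move=> [u uP]; exists (u \o free_map (syz_shift N i) : {linear _ -> _}) => y /=.
by rewrite -uP.
Qed.

Definition Ext_shift N i := sval (cid (Ext_shift_exists N i)).

Lemma Ext_shift_class N i phi :
  Ext_shift N i (ext_class _ i phi) = ext_class N i.+1 (hom_precomp (syz_shift N i) phi).
Proof. exact: svalP (cid (Ext_shift_exists N i)) phi. Qed.

Lemma Ext_shift_nat N N' (f : {linear N -> N'}) i xi :
  Tm i.+1 f (Ext_shift N' i xi) = Ext_shift N i (Tm i (syz_map f 1) xi).
Proof.
have [phi <-] := ext_class_surj xi.
rewrite Ext_map_class !Ext_shift_class Ext_map_class.
by congr (ext_class _ _ _); apply: hom_eq => y; rewrite [LHS]/= syz_shift_nat.
Qed.

Lemma Ext_shift_surj N i xi : exists eta, Ext_shift N i eta = xi.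
Proof.
have [phi <-] := ext_class_surj xi.
exists (ext_class _ i (hom_precomp (syz_unshift N i) phi)); rewrite Ext_shift_class.
by congr (ext_class _ _ _); apply: hom_eq => y; rewrite [LHS]/= syz_shiftK.
Qed.

Lemma Ext_shift_eq0 N i eta : Ext_shift N i eta = 0 ->
  exists zeta, eta = Tm i (incl (kernel (augment N))) zeta.
Proof.
have [phi <-] := ext_class_surj eta; rewrite Ext_shift_class => /ext_class_eq0 [u uP].
case: i phi eta u uP => [|i] phi eta u uP /=.
  exists (ext_class _ 0 (u : hom _ _)); rewrite Ext_map_class.
  by congr (ext_class _ _ _); apply: hom_eq => y; rewrite [RHS]uP.
exists 0; rewrite linear0; apply/ext_class_eq0.
exists (u \o free_map (syz_unshift N i) : {linear _ -> _}) => y.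
rewrite -[in RHS](@syz_unshiftK _ N i.+1 y); exact: uP (syz_unshift N i.+1 y).
Qed.

Lemma Ext_shift_incl N i zeta :
  Ext_shift N i (Tm i (incl (kernel (augment N))) zeta) = 0.
Proof.
case: i zeta => [|i] zeta; last by rewrite (Ext_split_cover zeta (split_cover_free N)) !linear0.
have [u <-] := ext_class_surj zeta; rewrite Ext_map_class Ext_shift_class.
by apply/ext_class_eq0; exists u.
Qed.

(** Although free_map is not additive, free_map h - (a free_map f + free_map g) takes
    its values in syz N' 1. Its restriction to syz N 1 therefore factors through
    free N, and dimension shifting kills what it induces. *)
Lemma Ext_map_linear N N' (a : R) (f g h : {linear N -> N'}) i xi :
  (forall x, h x = a *: f x + g x) -> Tm i h xi = a *: Tm i f xi + Tm i g xi.
Proof.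
elim: i N N' a f g h xi => [|i IHi] N N' a f g h xi hP.
  have [phi <-] := ext_class_surj xi; rewrite !Ext_map_class -linearP.
  by congr (ext_class _ _ _); apply: hom_eq => y; rewrite /= hP linearP.
have [eta <-] := Ext_shift_surj xi; rewrite !Ext_shift_nat -linearP.
pose m0 : {linear free N -> free N'} := free_lift (fun x =>
  free_var (h x) - (a *: free_var (f x) + free_var (g x))).
have m0v x : m0 (free_var x) = free_var (h x) - (a *: free_var (f x) + free_var (g x)).
  exact: free_lift_var.
have m0E D : m0 D = free_map h D - (a *: free_map f D + free_map g D).
  have := @free_ext R N _ m0 (free_map h \- (a \*: free_map f \+ free_map g)).
  by apply=> x /=; rewrite !free_lift_var.
have mP D : m0 D \in kernel (augment N').
  rewrite mem_kernel; apply/eqP.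
  apply: (@free_ext R N _ (augment N' \o m0) (hom_zero (free N) N' : {linear _ -> _})) => x.
  by rewrite [LHS](_ : _ = augment N' (m0 (free_var x))) // m0v linearB linearP !augment_var hP subrr.
pose m := corestrict mP.
pose p : {linear syz N 1 -> syz N' 1} := a \*: syz_map f 1 \+ syz_map g 1.
rewrite (@IHi _ _ 1 (m \o incl _ : {linear _ -> _}) p (syz_map h 1)); last first.
  by move=> x; apply: val_inj; rewrite scale1r /= m0E subrK.
rewrite scale1r -(@Ext_map_comp _ _ _ (incl _) m) // linearD Ext_shift_incl add0r.
by congr (Ext_shift _ _ _); exact: IHi.
Qed.

End ExtFunctor.

(* Only the equations above are used; unfolding makes conversion intractable. *)
#[local] Opaque Ext_map Ext_shift ext_class.

#[local] Opaque Ext_map Ext_shift ext_class.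

Section LongExact.
Context (R : comNzRingType) (X : lmodType R).
Implicit Types (N V F : lmodType R).

Local Notation T i N := (Ext i N X).
Local Notation Tm i f := (Ext_map i X f).

Lemma Ext_mapD N N' (f g h : {linear N -> N'}) i xi :
  (forall x, h x = f x + g x) -> Tm i h xi = Tm i f xi + Tm i g xi.
Proof.
move=> hP; rewrite (@Ext_map_linear _ X _ _ 1 f g h) ?scale1r // => x.
by rewrite scale1r hP.
Qed.

Lemma Ext_map0 N N' (h : {linear N -> N'}) i xi : (forall x, h x = 0) -> Tm i h xi = 0.
Proof.
move=> h0; have e : Tm i h xi = Tm i h xi + Tm i h xi.
  by apply: Ext_mapD => x; rewrite h0 addr0.
by apply: (addIr (Tm i h xi)); rewrite add0r -e.
Qed.

Lemma Ext_mapZ N N' (a : R) (f h : {linear N -> N'}) i xi :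
  (forall x, h x = a *: f x) -> Tm i h xi = a *: Tm i f xi.
Proof.
move=> hP; have z0 : forall x, (hom_zero N N' : {linear N -> N'}) x = 0 by [].
rewrite (@Ext_map_linear _ X _ _ a f (hom_zero N N') h) ?(Ext_map0 _ z0) ?addr0 // => x.
by rewrite hP /= addr0.
Qed.

Lemma Ext_mapN N N' (f h : {linear N -> N'}) i xi :
  (forall x, h x = - f x) -> Tm i h xi = - Tm i f xi.
Proof. by move=> hP; rewrite (@Ext_mapZ _ _ (-1) f h) ?scaleN1r // => x; rewrite hP scaleN1r. Qed.

Definition inl_lin N N' : {linear N -> (N * N')%type} :=
  pair_lin idfun (hom_zero N N' : {linear N -> N'}).
Definition inr_lin N N' : {linear N' -> (N * N')%type} :=
  pair_lin (hom_zero N' N : {linear N' -> N}) idfun.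

Lemma Ext_pair N N' i (theta : T i (N * N')%type) :
  theta = Tm i (fst : {linear (N * N')%type -> N}) (Tm i (inl_lin N N') theta)
    + Tm i (snd : {linear (N * N')%type -> N'}) (Tm i (inr_lin N N') theta).
Proof.
rewrite (@Ext_map_comp _ X _ _ _ fst (inl_lin N N') (inl_lin N N' \o fst)) //.
rewrite (@Ext_map_comp _ X _ _ _ snd (inr_lin N N') (inr_lin N N' \o snd)) //.
rewrite -(@Ext_mapD _ _ _ _ idfun) ?Ext_map_id // => -[x y].
by congr (_, _); rewrite /= ?addr0 ?add0r.
Qed.

Definition lifts_cover N N'' (g : {linear N -> N''}) (lam : {linear free N'' -> N}) : Prop :=
  forall D, g (lam D) = augment N'' D.

(** The connecting map of 0 -> N' -> N -> N'' -> 0 is dimension shifting after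
    pulling back along a map w from the first syzygy of N'' to N', which compares
    the free presentation of N'' with the given sequence. *)
Definition classifies N' N N'' (f : {linear N' -> N}) (g : {linear N -> N''})
    (w : {linear syz N'' 1 -> N'}) : Prop :=
  exists2 lam : {linear free N'' -> N}, lifts_cover g lam &
    forall y, f (w y) = lam (val y).

Lemma augment_syz N (y : syz N 1) : augment N (val y) = 0.
Proof. by apply/eqP; exact: (submod_valP y). Qed.

Lemma classifies_exists N' N N'' (f : {linear N' -> N}) (g : {linear N -> N''}) :
  short_exact f g -> exists w, classifies f g w.
Proof.
case=> fi fg /choice [s sP].
pose lam : {linear free N'' -> N} := free_lift s.
have lamP : lifts_cover g lam.
  apply: (@free_ext _ _ _ (g \o lam) (augment N'')) => x.
  by rewrite augment_var -[RHS]sP; congr (g _); exact: free_lift_var.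
have [|w wP] := @lift_injective _ _ _ _ f (lam \o incl (kernel (augment N''))) fi.
  by move=> y; apply/fg; rewrite /= lamP augment_syz.
by exists w, lam.
Qed.

Definition Ext_delta N' N'' (w : {linear syz N'' 1 -> N'}) i : {linear T i N' -> T i.+1 N''} :=
  Ext_shift X N'' i \o Tm i w.

Lemma Ext_deltaE N' N'' (w : {linear syz N'' 1 -> N'}) i xi :
  Ext_delta w i xi = Ext_shift X N'' i (Tm i w xi).
Proof. by []. Qed.

(** The two liftings of free N1'' to N2 differ by a map to N2', which is killed by
    dimension shifting because it is defined on all of free N1''. *)
Lemma Ext_delta_nat N1' N1 N1'' N2' N2 N2''
    (f1 : {linear N1' -> N1}) (g1 : {linear N1 -> N1''})
    (f2 : {linear N2' -> N2}) (g2 : {linear N2 -> N2''})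
    (h' : {linear N1' -> N2'}) (h : {linear N1 -> N2}) (h'' : {linear N1'' -> N2''})
    w1 w2 i xi :
  short_exact f2 g2 ->
  (forall x, h (f1 x) = f2 (h' x)) -> (forall x, h'' (g1 x) = g2 (h x)) ->
  classifies f1 g1 w1 -> classifies f2 g2 w2 ->
  Ext_delta w1 i (Tm i h' xi) = Tm i.+1 h'' (Ext_delta w2 i xi).
Proof.
move=> [f2i f2g _] hf hg [l1 l1P w1P] [l2 l2P w2P].
rewrite !Ext_deltaE Ext_shift_nat.
have [|m mP] := @lift_injective _ _ _ _ f2 ((h \o l1) \- (l2 \o free_map h'')) f2i.
  move=> D; apply/f2g; rewrite /= linearB -hg l1P l2P.
  by rewrite augment_nat subrr.
rewrite (@Ext_map_comp _ X _ _ _ w1 h' (h' \o w1)) //.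
rewrite (@Ext_map_comp _ X _ _ _ (syz_map h'' 1) w2 (w2 \o syz_map h'' 1)) //.
rewrite (@Ext_mapD _ _ (m \o incl _) (w2 \o syz_map h'' 1) (h' \o w1)); last first.
  move=> y; apply: f2i; rewrite linearD /= -hf w1P w2P mP.
  by rewrite /= subrK.
by rewrite -(@Ext_map_comp _ X _ _ _ (incl _) m) // linearD Ext_shift_incl add0r.
Qed.

(** The rotated sequence 0 -> syz N'' 1 -> N' + free N'' -> N -> 0, in which the
    syzygy map of g plays, up to sign, the role of w. *)
Lemma rotate N' N N'' (f : {linear N' -> N}) (g : {linear N -> N''})
    (w : {linear syz N'' 1 -> N'}) :
  short_exact f g -> classifies f g w ->
  exists (j : {linear syz N'' 1 -> (N' * free N'')%type})
         (p : {linear (N' * free N'')%type -> N}),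
    [/\ short_exact j p, classifies j p (\- syz_map g 1),
        forall y, j y = (w y, - val y) & forall x, p (x, 0) = f x].
Proof.
case=> fi fg gs [lam lamP wP].
pose j : {linear syz N'' 1 -> (N' * free N'')%type} := pair_lin w (\- incl _).
pose p : {linear (N' * free N'')%type -> N} := (f \o fst) \+ (lam \o snd).
have pE x D : p (x, D) = f x + lam D by [].
exists j, p; split=> // [||x]; last by rewrite pE linear0 addr0.
- split=> [|[x D]|n].
  + by apply: inj_linear => y [_ /eqP]; rewrite oppr_eq0 => /eqP y0; apply: val_inj.
  + rewrite pE; split=> [e|[y [<- <-]]]; last by rewrite linearN wP subrr.
    have DP : - D \in kernel (augment N'').
      rewrite mem_kernel linearN oppr_eq0 -lamP; apply/eqP.
      have -> : lam D = - f x by apply/eqP; rewrite -subr_eq0 opprK addrC e.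
      by rewrite linearN (fg _).2 ?oppr0 //; exists x.
    exists (Submod DP); congr (_, _); last exact: opprK.
    apply: fi; rewrite wP [LHS](_ : _ = lam (- D)) // linearN.
    by apply/eqP; rewrite eq_sym -subr_eq0 opprK e.
  have [x xP] : exists x, f x = n - lam (free_var (g n)).
    by apply/fg; rewrite linearB lamP augment_var subrr.
  by exists (x, free_var (g n)); rewrite pE xP subrK.
have [|e eP] := @lift_injective _ _ _ _ f (augment N \- (lam \o free_map g)) fi.
  by move=> D; apply/fg; rewrite /= linearB lamP augment_nat subrr.
exists (pair_lin e (free_map g)) => [D|y].
  by rewrite [LHS]pE eP /= subrK.
rewrite /j; congr (_, _); last exact: opprK.
apply: fi; rewrite eP wP /= augment_syz sub0r linearN.
by [].
Qed.

Lemma Ext_inj0 N N'' (g : {linear N -> N''}) : (forall x, exists n, g n = x) ->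
  injective (Tm 0 g).
Proof.
move=> gs; apply: inj_linear => xi; have [phi <-] := ext_class_surj xi.
rewrite Ext_map_class => /ext_class_eq0 /= phi0; apply/ext_class_eq0.
apply: hom_eq => x; have [n <-] := gs x.
exact: (congr1 (fun h : hom _ _ => (h : {linear _ -> _}) n) phi0).
Qed.

Definition Ext_exact_mid i : Prop :=
  forall N' N N'' (f : {linear N' -> N}) (g : {linear N -> N''}) xi,
    short_exact f g -> Tm i f xi = 0 -> exists theta, xi = Tm i g theta.

Definition Ext_exact_left i : Prop :=
  forall N' N N'' (f : {linear N' -> N}) (g : {linear N -> N''}) w xi,
    short_exact f g -> classifies f g w -> Ext_delta w i xi = 0 ->
    exists theta, xi = Tm i f theta.

Lemma Ext_exact_mid0 : Ext_exact_mid 0.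
Proof.
move=> N' N N'' f g xi [_ fg gs]; have [phi <-] := ext_class_surj xi.
rewrite Ext_map_class => /ext_class_eq0 /= phi0.
have [|r rP] := factor_linear (q := (phi : {linear N -> X})) gs.
  move=> n /fg [x <-].
  exact: (congr1 (fun h : hom _ _ => (h : {linear _ -> _}) x) phi0).
exists (ext_class X N'' 0 (r : hom _ _)); rewrite Ext_map_class.
by congr (ext_class _ _ _ _); apply: hom_eq => y; rewrite [RHS]rP.
Qed.

(** A class xi killed by the connecting map becomes, on syz N'' 1, the restriction of
    some zeta on free N''. The two together form a class on N' + free N'' that vanishes
    on syz N'' 1, embedded with opposite signs, and so comes from N by the rotated
    sequence. *)
Lemma Ext_exact_left_of_mid i : Ext_exact_mid i -> Ext_exact_left i.
Proof.
move=> mid N' N N'' f g w xi S wP /Ext_shift_eq0 [zeta zE].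
have [j [p [S1 cl1 jE pE]]] := rotate S wP.
pose tau := Tm i (fst : {linear (N' * free N'')%type -> _}) xi
  + Tm i (snd : {linear (N' * free N'')%type -> _}) zeta.
have [|theta tauE] := mid _ _ _ _ _ tau S1.
  rewrite linearD (Ext_map_comp (h := w)); last by move=> y; rewrite jE.
  rewrite (Ext_map_comp (h := \- incl _)); last by move=> y; rewrite jE.
  by rewrite zE (@Ext_mapN _ _ (incl _) (\- incl _)) // subrr.
exists theta; rewrite -(Ext_map_comp (f := inl_lin _ _) (g := p)) // -tauE linearD.
rewrite (Ext_map_comp (h := idfun)) // Ext_map_id //.
by rewrite (Ext_map_comp (h := hom_zero _ _)) // Ext_map0 // addr0.
Qed.

Lemma Ext_exact_mid_of_left i : Ext_exact_left i -> Ext_exact_mid i.+1.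
Proof.
move=> L N' N N'' f g xi S f0.
have [w wP] := classifies_exists S; have [j [p [S1 cl1 jE pE]]] := rotate S wP.
have [k [q [S2 cl2 kE qE]]] := rotate S1 cl1.
have [eta etaE] := Ext_shift_surj xi.
have [|theta etaT] := L _ _ _ _ _ _ eta S2 cl2.
  rewrite Ext_deltaE (@Ext_mapN _ _ (syz_map p 1)) // linearN -Ext_shift_nat etaE.
  rewrite (Ext_pair (Tm i.+1 p xi)) (Ext_map_comp (h := f)) // f0 linear0 add0r.
  by rewrite [Tm _ (inr_lin _ _) _](Ext_split_cover _ (split_cover_free _)) linear0 oppr0.
exists (- Ext_shift X _ _ (Tm i (inl_lin _ _) theta)).
rewrite linearN Ext_shift_nat -etaE etaT [in LHS](Ext_pair theta) linearD.
rewrite (Ext_map_comp (h := \- syz_map g 1)); last by move=> y; rewrite kE.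
rewrite (Ext_map_comp (f := k) (h := \- incl _)); last by move=> y; rewrite kE.
rewrite (@Ext_mapN _ _ (syz_map g 1) (\- syz_map g 1)) //.
rewrite (@Ext_mapN _ _ (incl _) (\- incl _)) // linearD !linearN.
by rewrite Ext_shift_incl oppr0 addr0.
Qed.

(** Simultaneous induction on the degree: rotating once reduces exactness at
    Ext^i(N', X) to exactness in the middle in the same degree, and rotating twice
    reduces exactness in the middle in degree i + 1 to exactness at Ext^i(N', X). *)
Lemma Ext_exact_middle i : Ext_exact_mid i.
Proof.
elim: i => [|i /Ext_exact_left_of_mid]; first exact: Ext_exact_mid0.
exact: Ext_exact_mid_of_left.
Qed.

Lemma Ext_exact_delta_ker i : Ext_exact_left i.
Proof. exact/Ext_exact_left_of_mid/Ext_exact_middle. Qed.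

Lemma Ext_exact_delta_im N' N N'' (f : {linear N' -> N}) (g : {linear N -> N''}) w i xi :
  short_exact f g -> classifies f g w -> Tm i.+1 g xi = 0 ->
  exists eta, xi = Ext_delta w i eta.
Proof.
move=> S wP g0; have [j [p [S1 cl1 jE pE]]] := rotate S wP.
have [eta etaE] := Ext_shift_surj xi.
have [|tau tauE] := Ext_exact_delta_ker (i := i) (xi := eta) S1 cl1.
  by rewrite Ext_deltaE (@Ext_mapN _ _ (syz_map g 1)) // linearN -Ext_shift_nat etaE g0 oppr0.
exists (Tm i (inl_lin _ _) tau).
rewrite Ext_deltaE -etaE tauE [in LHS](Ext_pair tau) linearD.
rewrite (Ext_map_comp (h := w)); last by move=> y; rewrite jE.
rewrite (Ext_map_comp (f := j) (h := \- incl _)); last by move=> y; rewrite jE.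
by rewrite (@Ext_mapN _ _ (incl _) (\- incl _)) // linearD linearN Ext_shift_incl subr0.
Qed.

End LongExact.

(** * Devissage of finitely generated modules *)

Section Cyclic.
Context (R : comNzRingType).
Implicit Types (V N : lmodType R) (I : ideal R).

Notation span_seq s := (span (fun w => w \in s)).

Definition generated_by V (v : V) I : Prop :=
  (forall w, exists d : R, w = d *: v) /\ (forall d : R, d *: v = 0 <-> (d : R^o) \in I).

Definition prime_ideal I : Prop :=
  (1 : R^o) \notin I /\
  forall d e : R, (d * e : R^o) \in I -> (d : R^o) \in I \/ (e : R^o) \in I.

Lemma prime_exp I (d : R) k : prime_ideal I -> (d ^+ k : R^o) \in I -> (d : R^o) \in I.
Proof.
move=> [I1 Iprime]; elim: k => [|k IHk]; first by rewrite expr0 (negPf I1).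
by rewrite exprS => /Iprime [|/IHk].
Qed.

Fact ann_elt_closed V (v : V) : linear_closed (fun d : R^o => (d : R) *: v = 0).
Proof.
split=> [|a d e d0 e0]; first by rewrite scale0r.
by rewrite scalerDl -scalerA d0 e0 scaler0 addr0.
Qed.
Definition ann_elt V (v : V) : ideal R := sub_of (ann_elt_closed v).

Lemma ann_eltP V (v : V) (d : R^o) : reflect ((d : R) *: v = 0) (d \in ann_elt v).
Proof. exact: sub_ofP. Qed.

Lemma generated_by_ann V (v : V) : (forall w, exists d : R, w = d *: v) ->
  generated_by v (ann_elt v).
Proof. by move=> gv; split=> // d; apply: rwP; exact: ann_eltP. Qed.

Fact elt_linear V (v : V) : linear (fun d : R^o => (d : R) *: v).
Proof. by move=> a d e; rewrite scalerDl scalerA. Qed.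
Definition elt_lin V (v : V) : {linear R^o -> V} := lin_of (elt_linear v).

Lemma fg_generated_by V (v : V) I : generated_by v I -> finitely_generated V.
Proof.
move=> [gv _]; exists [:: v] => w; have [d ->] := gv w.
by apply/rpredZ/mem_span; rewrite mem_head.
Qed.

Lemma fg_ring : @finitely_generated R R^o.
Proof.
exists [:: 1] => d; rewrite -[d](mulr1 (d : R)).
by apply: (rpredZ (d : R)); apply: mem_span; rewrite mem_head.
Qed.

Lemma generated_by_quot V (v : V) I (S : submodClosed V) :
  generated_by v I -> generated_by (quotmod_pi S v) (ann_elt (quotmod_pi S v)).
Proof.
move=> [gv _]; apply: generated_by_ann => w; have [u <-] := quotmod_surj w.
by have [d ->] := gv u; exists d; rewrite linearZ.
Qed.

Section SpanStep.
Context (N : lmodType R) (x : N) (s : seq N).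

Fact span_step_subproof (y : submod (span_seq s)) : val y \in span_seq (x :: s).
Proof. by apply: span_min (submod_valP y) => v vs; apply: mem_span; rewrite inE vs orbT. Qed.
Definition span_step : {linear submod (span_seq s) -> submod (span_seq (x :: s))} :=
  corestrict (f := incl _) span_step_subproof.

Lemma span_step_inj : injective span_step.
Proof. by move=> y z e; apply: val_inj; exact: (congr1 val e). Qed.

Definition span_head : submod (span_seq (x :: s)) := Submod (mem_span (mem_head x s)).

Lemma span_step_gen (w : quotmod (lin_image span_step)) :
  exists d : R, w = d *: quotmod_pi _ span_head.
Proof.
have [[y yP] <-] := quotmod_surj w.
have [d [z [zs yE]]] := span_consP yP; exists d.
rewrite -linearZ; apply/eqP; rewrite quotmod_pi_eq; apply/lin_imageP.
by exists (Submod zs); apply: val_inj; rewrite /= yE addrC addKr.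
Qed.

End SpanStep.

(** The generators are added one at a time. If the annihilator of the new generator
    modulo the others lies in p, the quotient by the others maps onto R/p. If not,
    some e outside p multiplies the module into the span of the others, and a nonzero
    map on that span can be composed with e. *)
Lemma nonzero_map_prime N V (v : V) I : prime_ideal I -> generated_by v I ->
  finitely_generated N -> {subset Ann N <= I} ->
  exists (theta : {linear N -> V}) x, theta x <> 0.
Proof.
move=> [I1 Iprime] [gv vI] [s sN] NI.
suff H : forall s : seq N, {subset Ann (submod (span_seq s)) <= I} ->
    exists (theta : {linear submod (span_seq s) -> V}) x, theta x <> 0.
  pose h := corestrict (f := idfun) sN.
  have [|theta [x thx]] := H s.
    move=> d; have hi : injective h by move=> y z /(congr1 val).
    by move=> /(Ann_inj hi)/NI.
  exists (theta \o h), (val x); rewrite /= (_ : h (val x) = x) //.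
  exact: val_inj.
elim=> {s sN NI} [|x s IHs] sI.
  case/negP: I1; apply: sI; apply/AnnP => y; apply: val_inj.
  by rewrite scale1r; exact: (span_nil (submod_valP y)).
pose pi : {linear submod (span_seq (x :: s)) -> quotmod (lin_image (span_step x s))} :=
  quotmod_pi (lin_image (span_step x s)).
have gpi := @span_step_gen _ x s.
have [annI|/existsNP [e /not_implyP [/ann_eltP e0 /negP eI]]] :=
    pselect (forall d, d \in ann_elt (pi (span_head x s)) -> d \in I).
  have [||q qP] := @factor_linear _ _ _ _ (elt_lin (pi (span_head x s))) (elt_lin v).
  - by move=> w; have [d ->] := gpi w; exists d.
  - by move=> d d0; apply/vI/annI/ann_eltP.
  exists (q \o pi), (span_head x s) => /= e; case/negP: I1; apply/vI.
  by rewrite -[LHS](qP 1) /= -[elt_lin _ _]/(1 *: _) scale1r.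
have eA (y : submod (span_seq (x :: s))) : exists z, span_step x s z = scale_lin (e : R) _ y.
  apply/lin_imageP; rewrite -quotmod_pi_eq0 -[quotmod_pi _ _]/(pi ((e : R) *: y)) linearZ /=.
  by have [d ->] := gpi (pi y); rewrite scalerA mulrC -scalerA e0 scaler0.
have [m mP] := lift_injective (@span_step_inj _ x s) eA.
have [|theta [z thz]] := IHs.
  move=> d /AnnP dA; have : (d * e : R^o) \in I.
    apply: sI; apply/AnnP => y; rewrite -scalerA -[(e : R) *: y]/(scale_lin (e : R) _ y) -mP.
    by rewrite -linearZ /= dA linear0.
  by case/Iprime => // /(negP eI).
exists (theta \o m), (span_step x s z) => /=.
have -> : m (span_step x s z) = (e : R) *: z.
  by apply: (@span_step_inj _ x s); rewrite mP linearZ.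
rewrite linearZ /=; have [d dE] := gv (theta z); rewrite dE scalerA => /vI.
case/Iprime => [/(negP eI) //|dI]; apply: thz; rewrite dE.
exact/vI.
Qed.

End Cyclic.

Section Devissage.
Context (R : comNzRingType) (C : lmodType R -> Prop) (H : nat -> lmodType R -> lmodType R).
Implicit Types (V N : lmodType R).

Notation span_seq s := (span (fun w => w \in s)).

(** All that is retained of the long exact sequences of a contravariant
    cohomological functor, and of a Serre class C of values. *)
Definition half_exact : Prop :=
  forall i (N' N N'' : lmodType R) (f : {linear N' -> N}) (g : {linear N -> N''}),
    short_exact f g -> finitely_generated N -> C (H i N'') -> C (H i N') -> C (H i N).

Definition delta_exact : Prop :=
  forall i (N' N N'' : lmodType R) (f : {linear N' -> N}) (g : {linear N -> N''}),
    short_exact f g -> finitely_generated N -> C (H i N) ->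
    (forall j, i = j.+1 -> C (H j N')) -> C (H i N'').

Hypotheses (noethR : noetherian R) (half : half_exact) (delta : delta_exact).

(** N is filtered by cyclic modules R/I, which are treated by noetherian induction on
    I. If I is not prime, R/I is an extension of cyclic modules with larger
    annihilators. If I = p is prime, the image L of a nonzero map N0 -> R/p is a
    quotient of N0 whose kernel matters in lower degrees only, and (R/p)/L is cyclic
    with a larger annihilator. *)
Lemma devissage (c : ideal R) (N0 : lmodType R) n :
  finitely_generated N0 -> nilpotent_on c N0 ->
  (forall (V : lmodType R) v p, prime_ideal p -> {subset c <= p} ->
     @generated_by R V v p -> exists (theta : {linear N0 -> V}) x, theta x <> 0) ->
  (forall i, (i <= n)%N -> C (H i N0)) ->
  forall i, (i <= n)%N -> forall N : lmodType R,
    finitely_generated N -> nilpotent_on c N -> C (H i N).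
Proof.
move=> fg0 nil0 prime0 CN0; elim/ltn_ind => i IHi le_in N fgN nilN.
have lower j V : i = j.+1 -> finitely_generated V -> nilpotent_on c V -> C (H j V).
  by move=> e fgV nilV; apply: IHi => //; rewrite ?e // ltnW // -e.
have Czero V : (forall v : V, v = 0) -> C (H i V).
  move=> V0; have z1 : short_exact (idfun : {linear N0 -> N0}) (hom_zero N0 V : {linear N0 -> V}).
    split=> // [v|w]; first by split=> // _; exists v.
    by exists 0; rewrite [w]V0 [LHS]V0.
  by apply: (delta z1) => // [|j e]; [exact: CN0 | exact: lower].
have cyclic k (I : ideal R) : {subset ideal_pow c k <= I} -> forall V v, @generated_by R V v I -> C (H i V).
  apply: (noetherian_ind (V := R^o) noethR (@fg_ring R) (P := fun I : ideal R => {subset ideal_pow c k <= I} ->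
    forall V v, @generated_by R V v I -> C (H i V))) => {}I IHI cI V v vI.
  have larger (W : lmodType R) (w : W) : {subset I <= ann_elt w} -> (exists2 d, d \in ann_elt w & d \notin I) ->
      (forall u, exists d : R, u = d *: w) -> C (H i W).
    move=> Iw lt gw; apply: (IHI (ann_elt w) Iw lt _ W w); last exact: generated_by_ann.
    by move=> d /cI/Iw.
  have fgV := fg_generated_by vI; have [gv annv] := vI.
  have [/annv I1|/annv/negP I1] := pselect (1 *: v = 0).
    apply: Czero => w; have [d ->] := gv w.
    by rewrite -[d]mulr1 -scalerA (annv 1).2 // scaler0.
  have [primeI|] := pselect (prime_ideal I); last first.
    move/not_andP => [//|/existsNP [d /existsNP [e /not_implyP [deI /not_orP [/negP dI /negP eI]]]]].
    pose f := scale_lin d V; pose g := quotmod_pi (lin_image f).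
    have gw (w : submod (lin_image f)) : exists b : R, w = b *: to_lin_image f v.
      have [u <-] := to_lin_image_surj w; have [b ->] := gv u.
      by exists b; rewrite linearZ.
    apply: (half (short_exact_sub (lin_image f))) => //.
    - apply: (larger _ (g v)); last exact: (generated_by_quot (lin_image f) vI).1.
        by move=> b /annv b0; apply/ann_eltP; rewrite -linearZ /= b0 linear0.
      by exists d => //; apply/ann_eltP; rewrite -linearZ; apply/eqP;
        rewrite quotmod_pi_eq0; exact: (mem_lin_image f v).
    apply: (larger _ (to_lin_image f v)) => //.
      by move=> b /annv b0; apply/ann_eltP; rewrite -linearZ /= b0 linear0.
    exists e => //; apply/ann_eltP; apply: val_inj; rewrite /= scalerA mulrC.
    exact/annv.
  have cp : {subset c <= I}.
    move=> d dc; apply: (prime_exp (k := k) primeI); apply: cI; exact: expr_ideal_pow.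
  have [theta [x thx]] := prime0 V v I primeI cp vI.
  have CL : C (H i (submod (lin_image theta))).
    apply: (delta (short_exact_lin_image theta)) => // [|j e]; first exact: CN0.
    apply: lower => //; first exact: fg_sub.
    exact: (nilpotent_inj (f := incl _) val_inj nil0).
  apply: (half (short_exact_sub (lin_image theta))) => //.
  pose g := quotmod_pi (lin_image theta).
  apply: (larger _ (g v)); last exact: (generated_by_quot (lin_image theta) vI).1.
    by move=> b /annv b0; apply/ann_eltP; rewrite -linearZ /= b0 linear0.
  have [d dE] := gv (theta x); exists d.
    apply/ann_eltP; rewrite -linearZ; apply/eqP; rewrite quotmod_pi_eq0 /= -dE.
    exact: mem_lin_image.
  by apply/negP => /annv; rewrite -dE.
have [s sN] := fgN; have [k kN] := nilN.
suff Hs (t : seq N) : C (H i (submod (span_seq t))).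
  have e : short_exact (incl (span_seq s)) (hom_zero N (submod (span_seq ([::] : seq N))) : {linear _ -> _}).
    split=> [|v|w]; first exact: val_inj.
      by split=> // _; exists (Submod (sN v)).
    by exists 0; apply: val_inj; apply: esym; exact: (span_nil (submod_valP w)).
  apply: (@half i _ _ _ _ _ e fgN _ (Hs s)); apply: Czero => w.
  by apply: val_inj; exact: (span_nil (submod_valP w)).
elim: t => [|x t IHt]; first by apply: Czero => w; apply: val_inj; exact: (span_nil (submod_valP w)).
have S := short_exact_inj (@span_step_inj _ _ x t).
apply: (half S) => //; first exact: fg_sub.
apply: (cyclic k (ann_elt (quotmod_pi (lin_image (span_step x t)) (span_head x t)))); last first.
  exact/generated_by_ann/span_step_gen.
move=> d /kN dN; apply/ann_eltP; rewrite -linearZ /= (_ : _ *: _ = 0) ?linear0 //.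
by move/AnnP: dN => dN; apply: val_inj; exact: dN.
Qed.

End Devissage.

#[local] Opaque Ext_delta.

Section ExtDevissage.
Context (R : comNzRingType) (X : lmodType R) (C : lmodType R -> Prop).
Hypothesis CS : serre C.

Lemma graph_rel (U V : lmodType R) (f : {linear U -> V}) : linear_rel (fun u v => f u = v).
Proof. by split=> [|a u u' v v' <- <-]; rewrite ?linear0 // linearP. Qed.

Lemma Ext_half_exact : half_exact C (fun i N => Ext i N X).
Proof.
move=> i N' N N'' f g S _; apply: (serre_exact CS (graph_rel _) (graph_rel (Ext_map i X f))).
- by move=> v <-; exact: (linear0 (Ext_map i X g)).
- by move=> v; exists (Ext_map i X f v).
by move=> v /(Ext_exact_middle S) [u ->]; exists u.
Qed.

Lemma Ext_delta_exact : delta_exact C (fun i N => Ext i N X).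
Proof.
move=> i N' N N'' f g S _ CN; case: i CN => [|i] CN CN'.
  by apply: (serre_sub CS (f := Ext_map 0 X g)) CN; apply: Ext_inj0; case: S.
have [w wP] := classifies_exists S.
apply: (serre_exact CS (graph_rel (Ext_delta X w i)) (graph_rel (Ext_map i.+1 X g))) (CN' i erefl) CN.
- by move=> v <-; exact: linear0.
- by move=> v; exists (Ext_map i.+1 X g v).
by move=> v /(Ext_exact_delta_im S wP) [u ->]; exists u.
Qed.

Lemma Ext_ann (N : lmodType R) i (c : R^o) : c \in Ann N -> c \in Ann (Ext i N X).
Proof.
move=> /AnnP cN; apply/AnnP => xi.
have <- : Ext_map i X (scale_lin (c : R) N) xi = (c : R) *: xi.
  rewrite -[in RHS](Ext_map_id (f := idfun) xi) //.
  exact: (@Ext_mapZ _ X _ _ c idfun (scale_lin (c : R) N)).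
by apply: Ext_map0 => x; exact: cN.
Qed.

(** The common form of the conditions on local cohomology, Ext and Koszul cohomology. *)
Definition Ext_nilpotent_in (b : ideal R) n : Prop :=
  forall i, (i <= n)%N -> forall N : lmodType R,
    finitely_generated N -> nilpotent_on b N -> C (Ext i N X).

Hypothesis noethR : noetherian R.

(** Devissage from M/aM. A prime p containing b contains Ann M, so that M has a nonzero
    map to R/p, which factors through M/aM because a kills R/p. *)
Lemma Ext_nilpotent_inP (a : ideal R) (M : lmodType R) n : finitely_generated M ->
  (forall i, (i <= n)%N -> C (Ext i (mod_ideal M a) X)) <->
  Ext_nilpotent_in (ideal_add a (Ann M)) n.
Proof.
move=> fgM; set b := ideal_add a (Ann M).
have fg0 : finitely_generated (mod_ideal M a) by exact: fg_quot.
have nil0 : nilpotent_on b (mod_ideal M a).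
  exists 1%N => c; rewrite ideal_pow1 => /ideal_addP [s [t [sa /AnnP tM ->]]].
  apply/AnnP => w; have [v <-] := quotmod_surj w.
  rewrite -linearZ; apply/eqP; rewrite quotmod_pi_eq0 scalerDl tM addr0.
  exact: mem_ideal_mul.
split=> [CM|Cn i le_in]; last exact: Cn.
apply: (devissage noethR Ext_half_exact Ext_delta_exact fg0 nil0) => // V v p prp bp vp.
have [|theta [x thx]] := nonzero_map_prime prp vp fgM.
  by move=> c cM; apply: bp; apply/ideal_addP; exists 0, c; rewrite rpred0 add0r.
have [||q qP] := @factor_linear _ _ _ _ (quotmod_pi (ideal_mul a (top M))) theta.
- exact: quotmod_surj.
- move=> u /eqP; rewrite quotmod_pi_eq0 => uP; apply/eqP; rewrite -mem_kernel.
  apply: ideal_mul_min uP => c w ca _; rewrite mem_kernel linearZ /=; apply/eqP.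
  have [d ->] := vp.1 (theta w); rewrite scalerA mulrC -scalerA.
  rewrite (vp.2 c).2 ?scaler0 //; apply: bp; apply/ideal_addP.
  by exists c, 0; rewrite rpred0 addr0.
by exists q, (quotmod_pi _ x); rewrite qP.
Qed.

End ExtDevissage.

(** * Generalized local cohomology *)

Section QuotientMaps.
Context (R : comNzRingType).
Implicit Types (N V : lmodType R).

Lemma short_exact_quot N' N N'' (f : {linear N' -> N}) (g : {linear N -> N''})
    (A : submodClosed N') (B : submodClosed N) (B'' : submodClosed N'')
    (fAB : maps_to f A B) (gB : maps_to g B B'') :
  short_exact f g -> (forall x, f x \in B -> x \in A) ->
  (forall z, z \in B'' -> exists2 y, y \in B & g y = z) ->
  short_exact (quotmod_map fAB) (quotmod_map gB).
Proof.
move=> [fi fg gs] fA gB''; split=> [|w|w].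
- apply: inj_linear => w; have [x <-] := quotmod_surj w.
  by rewrite /= quotmod_mapE => /eqP; rewrite quotmod_pi_eq0 => /fA xA; apply/eqP; rewrite quotmod_pi_eq0.
- have [y <-] := quotmod_surj w; rewrite /= quotmod_mapE; split.
    move=> /eqP; rewrite quotmod_pi_eq0 => /gB'' [y' y'B gy].
    have [x xP] : exists x, f x = y - y' by apply/fg; rewrite linearB gy subrr.
    exists (quotmod_pi _ x); rewrite quotmod_mapE xP; apply/eqP.
    by rewrite quotmod_pi_eq addrAC subrr sub0r submodN.
  move=> [u]; have [x <-] := quotmod_surj u; rewrite quotmod_mapE => /eqP.
  rewrite quotmod_pi_eq => xyB; apply/eqP; rewrite quotmod_pi_eq0.
  have /gB : y - f x \in B by rewrite -opprB submodN.
  by rewrite linearB (fg (f x)).2 ?subr0 //; exists x.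
have [z <-] := quotmod_surj w; have [y <-] := gs z.
by exists (quotmod_pi _ y); rewrite /= quotmod_mapE.
Qed.

Context (a : ideal R).
Local Notation pw N k := (ideal_mul (ideal_pow a k) (top N)).

Lemma mod_pow_maps_to N N' (f : {linear N -> N'}) k l : (k <= l)%N ->
  maps_to f (pw N l) (pw N' k).
Proof.
move=> kl v vN; rewrite -lin_preimageP; apply: ideal_mul_min vN => c w ca _.
rewrite lin_preimageP linearZ; apply: mem_ideal_mul => //.
exact: ideal_pow_le ca.
Qed.

Lemma mod_pow_surj N N'' (g : {linear N -> N''}) k : (forall z, exists y, g y = z) ->
  forall z, z \in pw N'' k -> exists2 y, y \in pw N k & g y = z.
Proof.
move=> gs; have H : linear_closed (fun z => exists2 y, y \in pw N k & g y = z).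
  split=> [|c _ _ [y yN <-] [y' yN' <-]]; first by exists 0; rewrite ?rpred0 ?linear0.
  by exists (c *: y + y'); rewrite ?linearP // rpredD ?rpredZ.
apply: (span_ind H) => _ [c [w [ca _ ->]]]; have [y <-] := gs w.
by exists ((c : R) *: y); rewrite ?linearZ // mem_ideal_mul.
Qed.

Definition mod_pow_map N N' (f : {linear N -> N'}) k l (kl : (k <= l)%N) :
    {linear mod_ideal N (ideal_pow a l) -> mod_ideal N' (ideal_pow a k)} :=
  quotmod_map (mod_pow_maps_to f kl).

Lemma mod_pow_mapE N N' (f : {linear N -> N'}) k l (kl : (k <= l)%N) v :
  mod_pow_map f kl (quotmod_pi _ v) = quotmod_pi _ (f v).
Proof. exact: quotmod_mapE. Qed.

Lemma mod_pow_projE N k v : mod_pow_proj a N k (quotmod_pi _ v) = quotmod_pi _ v.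
Proof. exact: quotmod_mapE. Qed.

End QuotientMaps.

Section LocalCohomologyExact.
Context (R : comNzRingType) (a : ideal R) (X : lmodType R).
Implicit Types (N V : lmodType R).

Local Notation pw N k := (ideal_mul (ideal_pow a k) (top N)).
Local Notation H i N := (gen_local_cohomology a N i X).
Local Notation E i N k := (Ext i (mod_ideal N (ideal_pow a k)) X).

Definition glc_in i N k : {linear E i N k -> H i N} :=
  lin_of (@dirlim_in_linear R (fun k => E i N k) (fun k => Ext_map i X (mod_pow_proj a N k)) k).

Lemma glc_in_surj i N (h : H i N) : exists k (e : E i N k), glc_in i N k e = h.
Proof. exact: dirlim_in_surj. Qed.

Local Notation pr N kl := (mod_pow_map a (idfun : {linear N -> N}) kl).
Local Notation lv f k := (mod_pow_map a f (leqnn k)).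

Lemma glc_in_le i N k l (kl : (k <= l)%N) (e : E i N k) :
  glc_in i N l (Ext_map i X (pr N kl) e) = glc_in i N k e.
Proof.
elim: l kl => [|l IHl] kl.
  case: k kl e => // kl e; congr (glc_in _ _ _ _); apply: Ext_map_id.
  by move=> w; have [v <-] := quotmod_surj w; rewrite mod_pow_mapE.
have [kl1|lk] := leqP k l; last first.
  have kl2 : k = l.+1 by apply/eqP; rewrite eqn_leq kl.
  subst k; congr (glc_in _ _ _ _); apply: Ext_map_id.
  by move=> w; have [v <-] := quotmod_surj w; rewrite mod_pow_mapE.
rewrite -(IHl kl1) -[RHS](dirlim_in_trans (fun k => Ext_map i X (mod_pow_proj a N k))).
congr (dirlim_in _ _); apply/esym/Ext_map_comp.
by move=> w; have [v <-] := quotmod_surj w; rewrite mod_pow_projE !mod_pow_mapE.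
Qed.

Lemma glc_in_eq0 i N k (e : E i N k) : glc_in i N k e = 0 ->
  exists l (kl : (k <= l)%N), Ext_map i X (pr N kl) e = 0.
Proof.
move=> /dirlim_in_eq0 [m m0]; exists (m + k)%N, (leq_addl m k); rewrite -[RHS]m0.
elim: m {m0} => [|m IHm].
  by apply: Ext_map_id => w; have [v <-] := quotmod_surj w; rewrite mod_pow_mapE.
rewrite [RHS]/= -IHm; apply/esym/Ext_map_comp.
by move=> w; have [v <-] := quotmod_surj w; rewrite mod_pow_projE !mod_pow_mapE.
Qed.

Lemma colimit_rel (D : nat -> lmodType R) (t : forall k, {linear D k -> D k.+1})
    (U V : lmodType R) (al : forall k, {linear D k -> U}) (be : forall k, {linear D k -> V}) :
  (forall k e, al k.+1 (t k e) = al k e) -> (forall k e, be k.+1 (t k e) = be k e) ->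
  linear_rel (fun u v => exists k (e : D k), al k e = u /\ be k e = v).
Proof.
move=> alt bet.
have up k l (e : D k) : (k <= l)%N -> exists e' : D l, al l e' = al k e /\ be l e' = be k e.
  elim: l => [|l IHl]; first by rewrite leqn0 => /eqP kl; case: _ / kl; exists e.
  rewrite leq_eqVlt => /predU1P [kl|/IHl [e' [<- <-]]]; first by case: _ / kl; exists e.
  by exists (t l e').
split=> [|c u u' v v' [k [e [<- <-]]] [k' [e' [<- <-]]]].
  by exists 0%N, 0; rewrite !linear0.
have [e1 [<- <-]] := up _ _ e (leq_maxl k k').
have [e2 [<- <-]] := up _ _ e' (leq_maxr k k').
by exists (maxn k k'), (c *: e1 + e2); rewrite !linearP.
Qed.

Lemma Ext_mod_pow_comp N N' N'' (f : {linear N -> N'}) (g : {linear N' -> N''})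
    (h : {linear N -> N''}) i k l m (kl : (k <= l)%N) (lm : (l <= m)%N) (km : (k <= m)%N)
    (e : E i N'' k) : (forall x, g (f x) = h x) ->
  Ext_map i X (mod_pow_map a f lm) (Ext_map i X (mod_pow_map a g kl) e) =
  Ext_map i X (mod_pow_map a h km) e.
Proof.
move=> fgh; apply: Ext_map_comp => w; have [v <-] := quotmod_surj w.
by rewrite !mod_pow_mapE fgh.
Qed.

Lemma Ext_mod_pow_nat N N' (f : {linear N -> N'}) i k l (kl : (k <= l)%N) (e : E i N' k) :
  Ext_map i X (lv f l) (Ext_map i X (pr N' kl) e) =
  Ext_map i X (pr N kl) (Ext_map i X (lv f k) e).
Proof. by rewrite !(Ext_mod_pow_comp (h := f) _ _ kl). Qed.

Lemma glc_map_exists N N' (f : {linear N -> N'}) i : exists phi : {linear H i N' -> H i N},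
  forall k e, phi (glc_in i N' k e) = glc_in i N k (Ext_map i X (lv f k) e).
Proof.
pose al k : {linear E i N' k -> H i N'} := glc_in i N' k.
pose be k : {linear E i N' k -> H i N} := glc_in i N k \o Ext_map i X (lv f k).
have beE k e : be k e = glc_in i N k (Ext_map i X (lv f k) e) by [].
have rel : linear_rel (fun u v => exists k e, al k e = u /\ be k e = v).
  apply: (colimit_rel (t := fun k => Ext_map i X (pr N' (leqnSn k)))) => k e.
    exact: glc_in_le.
  by rewrite !beE Ext_mod_pow_nat glc_in_le.
have sv v : (exists k e, al k e = 0 /\ be k e = v) -> v = 0.
  move=> [k [e [/glc_in_eq0 [l [kl e0]] <-]]].
  by rewrite beE -(glc_in_le kl) -Ext_mod_pow_nat e0 !linear0.
have [|phi phiP] := linear_of_rel rel _ sv.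
  by move=> u; have [k [e <-]] := glc_in_surj u; exists (be k e), k, e.
exists phi => k e; rewrite -beE; apply/eqP; rewrite -subr_eq0; apply/eqP.
have e0 : exists k' e', al k' e' = al k e /\ be k' e' = be k e by exists k, e.
have := rel.2 (-1) _ _ _ _ e0 (phiP (al k e)).
by rewrite !scaleN1r addNr addrC => /sv.
Qed.

Definition glc_map N N' (f : {linear N -> N'}) i : {linear H i N' -> H i N} :=
  sval (cid (glc_map_exists f i)).

Lemma glc_mapE N N' (f : {linear N -> N'}) i k e :
  glc_map f i (glc_in i N' k e) = glc_in i N k (Ext_map i X (lv f k) e).
Proof. exact: (svalP (cid (glc_map_exists f i))). Qed.

Lemma glc_mapZ N (c : R) i h : glc_map (scale_lin c N) i h = c *: h.
Proof.
have [k [e <-]] := glc_in_surj h; rewrite glc_mapE -linearZ; congr (glc_in _ _ _ _).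
by rewrite (Ext_mapZ (f := idfun) (a := c)) ?Ext_map_id.
Qed.

End LocalCohomologyExact.

#[local] Opaque glc_in glc_map mod_pow_map.

Section LocalCohomologyDevissage.
Context (R : comNzRingType) (a : ideal R) (X : lmodType R).
Implicit Types (N V : lmodType R).

Local Notation pw N k := (ideal_mul (ideal_pow a k) (top N)).
Local Notation H i N := (gen_local_cohomology a N i X).
Local Notation E i N k := (Ext i (mod_ideal N (ideal_pow a k)) X).
Local Notation pr N kl := (mod_pow_map a (idfun : {linear N -> N}) kl).
Local Notation lv f k := (mod_pow_map a f (leqnn k)).

Hypothesis noethR : noetherian R.

(** The filtration of N' induced by the submodules a^k N. By the Artin-Rees property
    it is cofinal with the filtration by the submodules a^k N'. *)
Definition induced_pow N' N (f : {linear N' -> N}) k : submodClosed N' := lin_preimage f (pw N k).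

Fact induced_pow_map_subproof N' N (f : {linear N' -> N}) k : maps_to f (induced_pow f k) (pw N k).
Proof. by move=> x; rewrite lin_preimageP. Qed.
Definition induced_pow_map N' N (f : {linear N' -> N}) k :
    {linear quotmod (induced_pow f k) -> mod_ideal N (ideal_pow a k)} :=
  quotmod_map (@induced_pow_map_subproof _ _ f k).

Lemma induced_pow_mapE N' N (f : {linear N' -> N}) k x :
  induced_pow_map f k (quotmod_pi _ x) = quotmod_pi _ (f x).
Proof. exact: quotmod_mapE. Qed.

Lemma induced_pow_exact N' N N'' (f : {linear N' -> N}) (g : {linear N -> N''}) k :
  short_exact f g -> short_exact (induced_pow_map f k) (lv g k).
Proof.
move=> S; apply: short_exact_quot => // [x|]; first by rewrite lin_preimageP.
by apply: mod_pow_surj; case: S.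
Qed.

Lemma induced_pow_artin_rees N' N (f : {linear N' -> N}) k :
  injective f -> finitely_generated N -> exists2 l, (k <= l)%N &
    {subset induced_pow f l <= pw N' k}.
Proof.
move=> fi fgN; have [l lP] := artin_rees noethR a k fi fgN.
exists (maxn k l); first exact: leq_maxl.
move=> x; rewrite lin_preimageP => fx; apply: lP; apply: ideal_mul_min fx => c w ca _.
by apply: mem_ideal_mul => //; apply: ideal_pow_le ca; exact: leq_maxr.
Qed.

(** A class at level k that vanishes on N'/a^k N'
    vanishes, for l large, on the submodule N'/(N' meet a^l N) of N/a^l N. *)
Lemma glc_exact_mid N' N N'' (f : {linear N' -> N}) (g : {linear N -> N''}) i h :
  short_exact f g -> finitely_generated N ->
  glc_map a X f i h = 0 -> exists h'', glc_map a X g i h'' = h.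
Proof.
move=> S fgN; have [k [e <-]] := glc_in_surj h; rewrite glc_mapE.
move=> /glc_in_eq0 [k1 [kk1]]; rewrite -Ext_mod_pow_nat -(glc_in_le kk1 e).
move: (Ext_map _ _ _ e) => {kk1 k}e; move: k1 e => k e e0.
have [fi _ _] := S; have [l kl lP] := induced_pow_artin_rees k fi fgN.
have [|e'' eE] := Ext_exact_middle (xi := Ext_map i X (pr N kl) e) (induced_pow_exact l S).
  have qP : maps_to (idfun : {linear N' -> N'}) (induced_pow f l) (pw N' k) by exact: lP.
  rewrite (Ext_map_comp (h := lv f k \o quotmod_map qP)); last first.
    move=> w; have [x <-] := quotmod_surj w.
    by rewrite [RHS](_ : _ = lv f k (quotmod_map qP (quotmod_pi _ x))) // quotmod_mapE
      induced_pow_mapE !mod_pow_mapE.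
  by rewrite -(Ext_map_comp (f := quotmod_map qP) (g := lv f k)) // e0 linear0.
by exists (glc_in a X i N'' l e''); rewrite glc_mapE -eE glc_in_le.
Qed.

Lemma glc_inj0 N N'' (g : {linear N -> N''}) : (forall z, exists y, g y = z) ->
  injective (glc_map a X g 0).
Proof.
move=> gs; apply: inj_linear => h; have [k [e <-]] := glc_in_surj h; rewrite glc_mapE.
move=> /glc_in_eq0 [l [kl]]; rewrite -Ext_mod_pow_nat -(glc_in_le kl e).
have gl w : exists v, lv g l v = w.
  have [z <-] := quotmod_surj w; have [y <-] := gs z.
  by exists (quotmod_pi _ y); rewrite mod_pow_mapE.
move=> e0; rewrite [Ext_map _ _ _ e](_ : _ = 0) ?linear0 //.
by apply: (Ext_inj0 gl); rewrite e0 linear0.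
Qed.

Context (C : lmodType R -> Prop).
Hypothesis CS : serre C.

Lemma glc_half_exact : half_exact C (fun i N => H i N).
Proof.
move=> i N' N N'' f g S fgN.
apply: (serre_exact CS (graph_rel (glc_map a X g i)) (graph_rel (glc_map a X f i))).
- by move=> v <-; exact: linear0.
- by move=> v; exists (glc_map a X f i v).
- by move=> v; exact: glc_exact_mid.
Qed.

(** The modules Ext^j(N'/A_k, X), for the filtration A_k of N' induced by N, form a
    direct system that maps to H^j(N') and, by naturality of the connecting maps, to
    H^(j+1)(N''). The two maps form the relation that stands for the connecting map;
    it is single valued because the filtrations are cofinal. *)
Lemma glc_delta_exact : delta_exact C (fun i N => H i N).
Proof.
move=> i N' N N'' f g S fgN CN; case: i CN => [|j] CN CN'.
  by apply: (serre_sub CS (f := glc_map a X g 0)) CN; apply: glc_inj0; case: S.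
have [fi fg gs] := S.
pose w k := sval (cid (classifies_exists (induced_pow_exact k S))).
have wP k : classifies (induced_pow_map f k) (lv g k) (w k).
  exact: (svalP (cid (classifies_exists (induced_pow_exact k S)))).
have qP k : maps_to (idfun : {linear N' -> N'}) (pw N' k) (induced_pow f k).
  by move=> x xN'; rewrite lin_preimageP; exact: (mod_pow_maps_to f (leqnn k)).
have [q qE] : exists q : forall k, {linear mod_ideal N' (ideal_pow a k) -> quotmod (induced_pow f k)},
    forall k x, q k (quotmod_pi _ x) = quotmod_pi _ x.
  by exists (fun k => quotmod_map (qP k)) => k x; exact: quotmod_mapE.
have tP k l : (k <= l)%N -> maps_to (idfun : {linear N' -> N'}) (induced_pow f l) (induced_pow f k).
  move=> kl x; rewrite !lin_preimageP => fx.
  exact: (mod_pow_maps_to (idfun : {linear N -> N}) kl).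
have [t tE] : exists t : forall k l, (k <= l)%N ->
      {linear quotmod (induced_pow f l) -> quotmod (induced_pow f k)},
    forall k l (kl : (k <= l)%N) x, t k l kl (quotmod_pi _ x) = quotmod_pi _ x.
  by exists (fun k l kl => quotmod_map (tP k l kl)) => k l kl x; exact: quotmod_mapE.
pose D k := Ext j (quotmod (induced_pow f k)) X.
have [al alE] : exists al : forall k, {linear D k -> H j N'},
    forall k e, al k e = glc_in a X j N' k (Ext_map j X (q k) e).
  by exists (fun k => glc_in a X j N' k \o Ext_map j X (q k)).
have [be beE] : exists be : forall k, {linear D k -> H j.+1 N''},
    forall k e, be k e = glc_in a X j.+1 N'' k (Ext_delta X (w k) j e).
  by exists (fun k => glc_in a X j.+1 N'' k \o Ext_delta X (w k) j).
have be_le k l (kl : (k <= l)%N) e : be l (Ext_map j X (t k l kl) e) = be k e.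
  rewrite !beE -[RHS](glc_in_le kl); congr (glc_in _ _ _ _ _ _).
  apply: (Ext_delta_nat (h := pr N kl) _ (induced_pow_exact k S) _ _ (wP l) (wP k)) => v.
    by have [x <-] := quotmod_surj v; rewrite tE !induced_pow_mapE mod_pow_mapE.
  by have [x <-] := quotmod_surj v; rewrite !mod_pow_mapE.
have qt k l (kl : (k <= l)%N) e :
    Ext_map j X (q l) (Ext_map j X (t k l kl) e) = Ext_map j X (pr N' kl) (Ext_map j X (q k) e).
  rewrite (Ext_map_comp (h := q k \o pr N' kl)); last first.
    move=> v; have [x <-] := quotmod_surj v; rewrite qE tE.
    by rewrite [RHS](_ : _ = q k (pr N' kl (quotmod_pi _ x))) // mod_pow_mapE qE.
  exact/esym/Ext_map_comp.
have rel : linear_rel (fun u v => exists k e, al k e = u /\ be k e = v).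
  apply: (colimit_rel (t := fun k => Ext_map j X (t k k.+1 (leqnSn k)))) => k e.
    by rewrite (alE k.+1) (qt k k.+1 (leqnSn k) e) (alE k); exact: glc_in_le.
  exact: be_le.
apply: (serre_exact CS rel (graph_rel (glc_map a X g j.+1))) (CN' j erefl) CN.
- move=> v [k [e [+ <-]]]; rewrite alE => /glc_in_eq0 [l [kl]]; rewrite -qt => e0.
  have [m lm mP] := induced_pow_artin_rees l fi fgN.
  have sP : maps_to (idfun : {linear N' -> N'}) (induced_pow f m) (pw N' l) by exact: mP.
  have [s sE] : exists s : {linear quotmod (induced_pow f m) -> mod_ideal N' (ideal_pow a l)},
      forall x, s (quotmod_pi _ x) = quotmod_pi _ x.
    by exists (quotmod_map sP) => x; exact: quotmod_mapE.
  have [tq tqE] : exists tq : {linear mod_ideal N' (ideal_pow a l) -> quotmod (induced_pow f k)},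
      forall x, t k l kl (q l x) = tq x by exists (t k l kl \o q l).
  rewrite -(be_le k m (leq_trans kl lm)) -(Ext_map_comp (f := s) (g := tq)); last first.
    by move=> u; have [x <-] := quotmod_surj u; rewrite sE tE -tqE qE tE.
  by rewrite -(Ext_map_comp (f := q l) (g := t k l kl) (h := tq)) // e0 !linear0.
- by move=> v; eexists; reflexivity.
move=> v; have [k [e <-]] := glc_in_surj v; rewrite glc_mapE.
move=> /glc_in_eq0 [l [kl]]; rewrite -Ext_mod_pow_nat -(glc_in_le kl e) => e0.
have [d dE] := Ext_exact_delta_im (induced_pow_exact l S) (wP l) e0.
by exists (al l d), l, d; split; [reflexivity | rewrite (beE l d) -dE; reflexivity].
Qed.

(** The long exact sequence of 0 -> N -> N -> N/cN -> 0, where the first map is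
    multiplication by c and induces multiplication by c on H^i(N). *)
Lemma glc_colon N (c : R) i : finitely_generated N -> injective (scale_lin c N) ->
  C (H i (quotmod (lin_image (scale_lin c N)))) -> C (colon0 (H i N) (pred1 c)).
Proof.
move=> fgN ci Cq; pose g := quotmod_pi (lin_image (scale_lin c N)).
have S := short_exact_inj ci; have Cq' := Cq.
apply: (serre_exact CS (U := H i (quotmod (lin_image (scale_lin c N)))) (W := H i (quotmod (lin_image (scale_lin c N))))
  (rho := fun u v => glc_map a X g i u = val v) (sigma := fun _ w => w = 0)) Cq Cq'.
- split=> [|b u u' v v' e e']; first exact: linear0.
  by rewrite linearP e e'.
- by split=> // b u u' v v' -> ->; rewrite scaler0 addr0.
- by move=> v; rewrite linear0 => v0; apply: val_inj; rewrite -v0.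
- by move=> v; exists 0.
move=> v _; apply: (glc_exact_mid S fgN); rewrite glc_mapZ.
by have /colon0P := submod_valP v; apply; rewrite inE.
Qed.

End LocalCohomologyDevissage.

Section LocalCohomologyExt.
Context (R : comNzRingType) (a : ideal R) (X : lmodType R) (C : lmodType R -> Prop).
Implicit Types (N V : lmodType R).

Local Notation pw N k := (ideal_mul (ideal_pow a k) (top N)).
Local Notation H i N := (gen_local_cohomology a N i X).
Local Notation E i N k := (Ext i (mod_ideal N (ideal_pow a k)) X).
Local Notation pr N kl := (mod_pow_map a (idfun : {linear N -> N}) kl).

Hypotheses (noethR : noetherian R) (CS : serre C).

Lemma pow_kills N m (v : N) : {subset ideal_pow a m <= Ann N} -> v \in pw N m -> v = 0.
Proof.
move=> aN; apply: (span_ind (zero_closed N)) => _ [c [w [/aN /AnnP cN _ ->]]]; exact: cN.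
Qed.

(** When a^m N = 0, the direct system defining H^i(N) is constant from m on. *)
Lemma glc_torsion N i m : {subset ideal_pow a m <= Ann N} ->
  C (Ext i (mod_ideal N (ideal_pow a m)) X) -> C (H i N).
Proof.
move=> aN; apply: (serre_quot CS (g := glc_in a X i N m)) => h.
have [k [e <-]] := glc_in_surj h.
pose l := maxn k m; have kl : (k <= l)%N := leq_maxl k m; have ml : (m <= l)%N := leq_maxr k m.
have [|v /eqP|s sE] := @factor_linear _ _ _ _ (quotmod_pi (pw N m)) (quotmod_pi (pw N l)).
- exact: quotmod_surj.
- by rewrite quotmod_pi_eq0 => /(pow_kills aN) ->; rewrite linear0.
exists (Ext_map i X s (Ext_map i X (pr N kl) e)).
rewrite -(glc_in_le ml) -[RHS](glc_in_le kl); congr (glc_in _ _ _ _ _ _).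
rewrite (Ext_map_comp (h := idfun)) ?Ext_map_id // => w.
by have [v <-] := quotmod_surj w; rewrite mod_pow_mapE sE.
Qed.

Lemma Ext_of_glc N i m : {subset ideal_pow a m <= Ann N} -> C (H i N) -> C (Ext i N X).
Proof.
move=> aN.
have [|v /eqP|s sE] := @factor_linear _ _ _ _ (quotmod_pi (pw N m)) (idfun : {linear N -> N}).
- exact: quotmod_surj.
- by rewrite quotmod_pi_eq0 => /(pow_kills aN) ->.
apply: (serre_sub CS (f := glc_in a X i N m \o Ext_map i X s)).
apply: inj_linear => xi; rewrite [LHS](_ : _ = glc_in a X i N m (Ext_map i X s xi)) //.
move=> /glc_in_eq0 [l [ml]]; pose p : {linear N -> _} := quotmod_pi (pw N l).
move=> /(congr1 (Ext_map i X p)); rewrite linear0 => <-.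
have [r rE] : exists r : {linear mod_ideal N (ideal_pow a l) -> N}, forall w,
    s (pr N ml w) = r w by exists (s \o pr N ml).
rewrite (Ext_map_comp (h := r)) // (Ext_map_comp (h := idfun)) ?Ext_map_id // => v.
by rewrite -rE mod_pow_mapE sE.
Qed.

Lemma fg_uniform_power N (c : R) : finitely_generated N ->
  (forall v : N, exists m, c ^+ m *: v = 0) -> exists m, forall v : N, c ^+ m *: v = 0.
Proof.
move=> [s sN] cN.
have [m mP] : exists m, forall v, v \in s -> c ^+ m *: v = 0.
  elim: s {sN} => [|x s [m mP]]; first by exists 0%N.
  have [m' m'P] := cN x; exists (m + m')%N => v; rewrite inE => /predU1P [->|/mP v0].
    by rewrite exprD -scalerA m'P scaler0.
  by rewrite addnC exprD -scalerA v0 scaler0.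
exists m => v; have K : linear_closed (fun v : N => c ^+ m *: v = 0).
  split=> [|d u w u0 w0]; first exact: scaler0.
  by rewrite scalerDr scalerA mulrC -scalerA u0 w0 scaler0 addr0.
exact: (span_ind K mP (sN v)).
Qed.

Fact power_torsion_closed N (c : R) : linear_closed (fun v : N => exists m, c ^+ m *: v = 0).
Proof.
split=> [|d u v [m u0] [m' v0]]; first by exists 0%N; rewrite scaler0.
exists (m + m')%N; rewrite scalerDr scalerA mulrC -scalerA.
rewrite {1}addnC !exprD -!scalerA u0 scaler0 scaler0 add0r v0 scaler0 //.
Qed.
Definition power_torsion N c : submodClosed N := sub_of (power_torsion_closed N c).

Lemma glc_torsionP N i (h : H i N) : exists k, forall c, c \in ideal_pow a k -> (c : R) *: h = 0.
Proof.
have [k [e <-]] := glc_in_surj h; exists k => c ca.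
have /(Ext_ann X i)/AnnP e0 : c \in Ann (mod_ideal N (ideal_pow a k)).
  apply/AnnP => w; have [v <-] := quotmod_surj w; rewrite -linearZ; apply/eqP.
  by rewrite quotmod_pi_eq0 mem_ideal_mul.
by rewrite -linearZ e0 linear0.
Qed.

Lemma glc_ann N i c : c \in Ann N -> c \in Ann (H i N).
Proof.
move=> /AnnP cN; apply/AnnP => h; have [k [e <-]] := glc_in_surj h.
have /(Ext_ann X i)/AnnP e0 : c \in Ann (mod_ideal N (ideal_pow a k)).
  by apply/AnnP => w; have [v <-] := quotmod_surj w; rewrite -linearZ /= cN linear0.
by rewrite -linearZ e0 linear0.
Qed.

Context (J : ideal R).
Local Notation b := (ideal_add a J).

Lemma glc_ideal_torsion N i : nilpotent_on J N -> torsion b (H i N).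
Proof.
move=> [l lN] h; have [k kh] := glc_torsionP h; exists (k + l)%N.
move=> c /ideal_pow_add /ideal_addP [s [t [/kh sh /lN /glc_ann /AnnP th ->]]].
by rewrite scalerDl sh th addr0.
Qed.

Hypothesis CM : melkersson C b.
Context (r : nat) (x : 'I_r -> R).
Hypothesis bx : b =i ideal_gen (codom x).

(** Induction on the list of generators of b that may fail to be nilpotent on N. The
    c-power torsion of N is a submodule on which c is nilpotent. Modulo it c is regular,
    and the Melkersson condition brings H^i(N/cN) back to H^i(N). When no generator is
    left, a power of b kills N and H^i(N) is Ext^i(N, X). *)
Lemma glc_of_Ext n i N : (i <= n)%N -> Ext_nilpotent_in X C b n ->
  finitely_generated N -> nilpotent_on J N -> C (H i N).
Proof.
move=> le_in Cn.
have sub_b : {subset a <= b} by move=> c ca; apply/ideal_addP; exists c, 0; rewrite rpred0 addr0.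
suff claim (s : seq R) : forall N, finitely_generated N -> nilpotent_on J N ->
    (forall c, c \in codom x -> c \in s \/ exists m, forall v : N, c ^+ m *: v = 0) -> C (H i N).
  by move=> fgN JN; apply: (claim (codom x)) => // c cx; left.
elim: s => [|c s IHs] {}N fgN JN sN.
  have [k bN] : nilpotent_on b N by apply: (nilpotent_gen bx) => c /sN [].
  have aN : {subset ideal_pow a k <= Ann N} by move=> c ca; apply: bN; exact: ideal_pow_sub ca.
  apply: (glc_torsion aN); apply: Cn => //; first exact: fg_quot.
  by apply: (nilpotent_surj (@quotmod_surj _ _ _)); exists k.
have [cx|ncx] := boolP (c \in codom x); last first.
  apply: IHs => // d dx; have [|dN] := sN d dx; last by right.
  by rewrite inE => /predU1P [dc|ds]; [rewrite -dc dx in ncx | left].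
have cb : (c : R^o) \in b by rewrite bx; apply: mem_span.
pose G := power_torsion N c.
have fgG : finitely_generated (submod G) by exact: fg_sub.
have fgQ : finitely_generated (quotmod G) by exact: fg_quot.
have JQ : nilpotent_on J (quotmod G) := nilpotent_surj (@quotmod_surj _ _ _) JN.
have sQ d : d \in codom x -> (d == c) || (d \in s) \/ exists m, forall v : quotmod G, d ^+ m *: v = 0.
  move=> /sN; rewrite inE => -[|[m mP]]; [by left | right; exists m => w].
  by have [v <-] := quotmod_surj w; rewrite -linearZ /= mP linear0.
apply: (glc_half_exact noethR CS (short_exact_sub G)) => //; last first.
  apply: IHs => //; first exact: (nilpotent_inj (f := incl G) val_inj JN).
  move=> d /sN; rewrite inE => -[/predU1P [->|ds]|[m mP]]; [right| by left |right].
    apply: fg_uniform_power => // -[v vG]; have /sub_ofP [m mv] := vG.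
    by exists m; apply: val_inj.
  by exists m => v; apply: val_inj; exact: mP.
have ci : injective (scale_lin c (quotmod G)).
  apply: inj_linear => w; have [v <-] := quotmod_surj w.
  have -> : scale_lin c (quotmod G) (quotmod_pi G v) = quotmod_pi G (c *: v) by rewrite linearZ.
  move=> /eqP; rewrite quotmod_pi_eq0 => /sub_ofP [m mv]; apply/eqP; rewrite quotmod_pi_eq0; apply/sub_ofP.
  by exists m.+1; rewrite exprSr -scalerA; exact: mv.
have : C (colon0 (H i (quotmod G)) (pred1 c)).
  apply: (glc_colon noethR CS fgQ ci); apply: IHs; first exact: fg_quot.
    exact: (nilpotent_surj (@quotmod_surj _ _ _) JQ).
  move=> d /sQ [/predU1P [->|ds]|[m mP]]; [right; exists 1%N => w| by left |right; exists m => w].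
    have [v <-] := quotmod_surj w; rewrite -linearZ; apply/eqP.
    by rewrite quotmod_pi_eq0 expr1; exact: (mem_lin_image (scale_lin c (quotmod G))).
  by have [v <-] := quotmod_surj w; rewrite -linearZ /= mP linear0.
move=> Cc; apply: CM.2; first exact: glc_ideal_torsion.
have sub (v : colon0 (H i (quotmod G)) (mem b)) :
    val v \in @GRing.SubmodClosed.clone R (H i (quotmod G)) (@colon0_pred R _ (pred1 c)) _.
  apply/colon0P => d; rewrite inE => /eqP ->.
  by have /colon0P := submod_valP v; apply.
apply: (serre_sub CS (f := corestrict (f := incl _) sub)) Cc.
by move=> u v e; apply: val_inj; exact: (congr1 val e).
Qed.

End LocalCohomologyExt.

(** From left to right, devissage from M, which has a nonzero map to R/p for each prime
    p containing Ann M, reaches the modules killed by a power of b, where H^i is Ext^i. *)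
Lemma glc_Ext_nilpotent_in (R : comNzRingType) (a : ideal R) (M : lmodType R)
    (r : nat) (x : 'I_r -> R) (C : lmodType R -> Prop) (X : lmodType R) n :
  noetherian R -> finitely_generated M ->
  ideal_add a (Ann M) =i ideal_gen (codom x) -> melkersson C (ideal_add a (Ann M)) ->
  (forall i, (i <= n)%N -> C (gen_local_cohomology a M i X)) <->
  Ext_nilpotent_in X C (ideal_add a (Ann M)) n.
Proof.
move=> noethR fgM bx CM; have CS := CM.1.
have nilM : nilpotent_on (Ann M) M by exists 1%N => c; rewrite ideal_pow1.
split=> [CH i le_in N fgN [k bN]|Cn i le_in]; last exact: (glc_of_Ext noethR CS CM bx le_in Cn).
have Jb : {subset Ann M <= ideal_add a (Ann M)}.
  by move=> c cM; apply/ideal_addP; exists 0, c; rewrite rpred0 add0r.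
have ab : {subset a <= ideal_add a (Ann M)}.
  by move=> c ca; apply/ideal_addP; exists c, 0; rewrite rpred0 addr0.
apply: (Ext_of_glc CS (m := k)); first by move=> c ca; apply: bN; exact: (ideal_pow_sub ab ca).
apply: (devissage noethR (glc_half_exact noethR CS) (glc_delta_exact noethR CS) fgM nilM _ CH) => //.
  by move=> V v p prp Mp vp; exact: nonzero_map_prime prp vp fgM Mp.
by exists k => c cM; apply: bN; exact: (ideal_pow_sub Jb cM).
Qed.

(** * Complexes of projectives with torsion homology *)

Lemma Ext_delta_map (R : comNzRingType) (X N' N N'' : lmodType R)
    (f : {linear N' -> N}) (g : {linear N -> N''}) w i zeta :
  classifies f g w -> Ext_delta X w i (Ext_map i X f zeta) = 0.
Proof.
move=> [lam _ wP]; rewrite Ext_deltaE.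
have [h hP] : exists h : {linear syz N'' 1 -> N}, forall y, f (w y) = h y by exists (f \o w).
rewrite (Ext_map_comp (h := h)) // -(Ext_map_comp (f := incl _) (g := lam)) ?Ext_shift_incl //.
by move=> y; rewrite -hP wP.
Qed.

Section TorsionComplex.
Context (R : comNzRingType) (X : lmodType R) (C : lmodType R -> Prop).
Hypotheses (noethR : noetherian R) (CS : serre C).
Context (P : nat -> lmodType R) (bd : forall p, {linear P p.+1 -> P p}) (b : ideal R).
Hypotheses (bdK : forall p z, bd p (bd p.+1 z) = 0)
  (fgP : forall p, finitely_generated (P p)) (splitP : forall p, split_cover (P p))
  (kill0 : forall c z, c \in b -> exists w, bd 0 w = (c : R) *: z)
  (killS : forall p c z, c \in b -> bd p z = 0 -> exists w, bd p.+1 w = (c : R) *: z).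

Definition coker_bd p : lmodType R := quotmod (lin_image (bd p)).
Definition bound_bd p : lmodType R := submod (lin_image (bd p)).

Hypothesis annW0 : {subset Ann (coker_bd 0) <= b}.

Local Notation W := coker_bd.
Local Notation B := bound_bd.
Local Notation pi p := (quotmod_pi (lin_image (bd p)) : {linear P p -> W p}).

Lemma coker_bound_exists p :
  exists d : {linear W p.+1 -> B p}, forall z, d (pi p.+1 z) = to_lin_image (bd p) z.
Proof.
apply: (factor_linear (p := pi p.+1)); first exact: quotmod_surj.
move=> z /eqP; rewrite quotmod_pi_eq0 => /lin_imageP [y <-]; apply: val_inj; exact: bdK.
Qed.

Definition coker_bound p : {linear W p.+1 -> B p} := sval (cid (coker_bound_exists p)).

Lemma coker_boundE p z : coker_bound p (pi p.+1 z) = to_lin_image (bd p) z.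
Proof. exact: (svalP (cid (coker_bound_exists p))). Qed.

Lemma coker_bound_surj p v : exists w, coker_bound p w = v.
Proof. by have [z <-] := to_lin_image_surj v; exists (pi p.+1 z); exact: coker_boundE. Qed.

Local Notation H p := (submod (kernel (coker_bound p))).

Lemma nilpotent_coker0 : nilpotent_on b (W 0).
Proof.
exists 1%N => c; rewrite ideal_pow1 => cb; apply/AnnP => w.
have [z <-] := quotmod_surj w; rewrite -linearZ; apply/eqP; rewrite quotmod_pi_eq0.
by have [y <-] := kill0 z cb; exact: mem_lin_image.
Qed.

Lemma nilpotent_homology p : nilpotent_on b (H p).
Proof.
exists 1%N => c; rewrite ideal_pow1 => cb; apply/AnnP => -[w wK]; apply: val_inj.
have [z zw] := quotmod_surj w; rewrite [LHS](_ : _ = (c : R) *: w) // -zw -linearZ.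
apply/eqP; rewrite quotmod_pi_eq0.
have z0 : bd p z = 0.
  by move: wK; rewrite mem_kernel -zw coker_boundE => /eqP/(congr1 val).
by have [y <-] := killS cb z0; exact: mem_lin_image.
Qed.

Lemma fg_homology p : finitely_generated (H p).
Proof. by apply: fg_sub => //; exact: fg_quot. Qed.

Lemma Ext_homology_in n p i : Ext_nilpotent_in X C b n -> (i <= n)%N -> C (Ext i (H p) X).
Proof. by move=> Cn le_in; apply: Cn => //; [exact: fg_homology | exact: nilpotent_homology]. Qed.

Lemma ses_coker p : short_exact (incl (lin_image (bd p))) (pi p).
Proof. exact: short_exact_sub. Qed.

Lemma ses_homology p : short_exact (incl (kernel (coker_bound p))) (coker_bound p).
Proof. by apply: short_exact_kernel; exact: coker_bound_surj. Qed.

Lemma Ext_bound_coker i p : C (Ext i.+2 (W p) X) <-> C (Ext i.+1 (B p) X).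
Proof.
have [w wP] := classifies_exists (ses_coker p).
apply: iff_sym; apply: (serre_bij CS (f := Ext_delta X w i.+1)).
  apply: inj_linear => xi /(Ext_exact_delta_ker (ses_coker p) wP) [theta ->].
  by rewrite (Ext_split_cover theta (@splitP p)) linear0.
move=> xi; have [|eta ->] := Ext_exact_delta_im (xi := xi) (ses_coker p) wP.
  by rewrite (Ext_split_cover (Ext_map _ _ _ _) (@splitP p)).
by exists eta.
Qed.

(* K is the complex Hom(P, X), up to the isomorphism iota *)
Context (K : cochain R) (iota : forall p, {linear hom (P p) X -> K p}).
Hypotheses (iota_inj : forall p, injective (iota p))
  (iota_surj : forall p f, exists phi, iota p phi = f)
  (iotaD : forall p phi, cdiff K p (iota p phi) = iota p.+1 (hom_precomp (bd p) phi)).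

Fact coh_class_subproof p (phi : hom (W p) X) :
  (iota p \o hom_precomp (pi p)) phi \in kernel (cdiff K p).
Proof.
rewrite mem_kernel /= iotaD; apply/eqP; rewrite [X in iota _ X](_ : _ = 0) ?linear0 //.
apply: hom_eq => z /=; rewrite [quotmod_pi _ _](_ : _ = 0) ?linear0 //.
by apply/eqP; rewrite quotmod_pi_eq0 mem_lin_image.
Qed.

Definition coh_class p : {linear hom (W p) X -> cohomology K p} :=
  quotmod_pi (coboundary K p) \o corestrict (@coh_class_subproof p).

Lemma coh_class_surj p h : exists phi, coh_class p phi = h.
Proof.
have [[f fK] <-] := quotmod_surj h; have [phi phif] := iota_surj f.
have phi0 z : (phi : {linear _ -> _}) (bd p z) = 0.
  move: fK; rewrite mem_kernel -phif iotaD -(linear0 (iota p.+1)) => /eqP/iota_inj e.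
  exact: (congr1 (fun h : hom _ _ => (h : {linear _ -> _}) z) e).
have [||q qP] := @factor_linear _ _ _ _ (pi p) (phi : {linear P p -> X}).
- exact: quotmod_surj.
- by move=> z /eqP; rewrite quotmod_pi_eq0 => /lin_imageP [y <-].
exists q; congr (quotmod_pi _ _); apply: val_inj; rewrite -[RHS]phif.
by congr (iota _ _); apply: hom_eq => z; exact: qP.
Qed.

Lemma coh_class0_eq0 phi : coh_class 0 phi = 0 -> phi = 0.
Proof.
move=> /eqP; rewrite quotmod_pi_eq0 => /eqP/(congr1 val) e.
have {}e : hom_precomp (pi 0) phi = 0 by apply: (@iota_inj 0); rewrite linear0; exact: e.
apply: hom_eq => w; have [z <-] := quotmod_surj w.
exact: (congr1 (fun h : hom _ _ => (h : {linear _ -> _}) z) e).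
Qed.

Lemma coh_classS_eq0 p (phi : {linear W p.+1 -> X}) : coh_class p.+1 phi = 0 <->
  exists theta : {linear P p -> X}, forall z, phi (pi p.+1 z) = theta (bd p z).
Proof.
rewrite (rwP eqP) quotmod_pi_eq0; split=> [/asboolP [f fE]|[theta thE]].
  have [theta thf] := iota_surj f; exists theta => z.
  move: fE; rewrite -thf iotaD => /iota_inj e.
  by have := congr1 (fun h : hom _ _ => (h : {linear _ -> _}) z) e.
apply/asboolP; exists (iota p (theta : hom _ _)); rewrite iotaD.
by congr (iota _ _); apply: hom_eq => z; rewrite [RHS]thE.
Qed.

Lemma coh0P : C (cohomology K 0) <-> C (Ext 0 (W 0) X).
Proof.
have e1 : C (hom (W 0) X) <-> C (cohomology K 0).
  apply: (serre_bij CS (f := coh_class 0)); last exact: coh_class_surj.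
  by apply: inj_linear; exact: coh_class0_eq0.
have e2 : C (hom (W 0) X) <-> C (Ext 0 (W 0) X).
  apply: (serre_bij CS (f := ext_class X (W 0) 0)); last exact: ext_class_surj.
  by apply: inj_linear => phi /ext_class_eq0.
by split=> [/e1/e2|/e2/e1].
Qed.

Lemma joint_image_rel (D U V : lmodType R) (al : {linear D -> U}) (be : {linear D -> V}) :
  linear_rel (fun u v => exists e, al e = u /\ be e = v).
Proof.
split=> [|c u u' v v' [e [<- <-]] [e' [<- <-]]]; first by exists 0; rewrite !linear0.
by exists (c *: e + e'); rewrite !linearP.
Qed.

Section FirstExt.
Variables (p : nat) (w : {linear syz (W p) 1 -> B p}).
Hypothesis wP : classifies (incl (lin_image (bd p))) (pi p) w.

Let delta_of : {linear hom (B p) X -> Ext 1 (W p) X} := Ext_delta X w 0 \o ext_class X (B p) 0.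
Let coh_of : {linear hom (B p) X -> cohomology K p.+1} :=
  coh_class p.+1 \o hom_precomp (coker_bound p).

Lemma delta_of_coh psi : delta_of psi = 0 <-> coh_of psi = 0.
Proof.
rewrite [delta_of psi](_ : _ = Ext_delta X w 0 (ext_class X (B p) 0 psi)) //.
rewrite [coh_of psi](_ : _ = coh_class p.+1 (hom_precomp (coker_bound p) psi)) //.
split=> [|/coh_classS_eq0 [theta thE]].
  move=> /(Ext_exact_delta_ker (ses_coker p) wP) [xi].
  have [theta <-] := ext_class_surj xi; rewrite Ext_map_class => /eqP.
  rewrite -subr_eq0 -linearB => /eqP/ext_class_eq0/eqP; rewrite subr_eq0 => /eqP psiE.
  apply/coh_classS_eq0; exists (theta : {linear _ -> _}) => z.
  rewrite [LHS](_ : _ = (psi : {linear _ -> _}) (coker_bound p (pi p.+1 z))) //.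
  by rewrite coker_boundE psiE.
suff -> : ext_class X (B p) 0 psi = Ext_map 0 X (incl (lin_image (bd p))) (ext_class X (P p) 0 theta).
  exact: Ext_delta_map wP.
rewrite Ext_map_class; congr (ext_class _ _ _ _); apply: hom_eq => v.
have [z <-] := to_lin_image_surj v; rewrite -[in LHS]coker_boundE; exact: thE.
Qed.

End FirstExt.

(** Cocycles of degree p + 1 are maps on W (p + 1). Those that vanish on the homology
    are maps on the boundaries in P p, which modulo restrictions from P p form
    Ext^1(W p, X). *)
Lemma coh_of_Ext p : C (Ext 1 (W p) X) -> C (Ext 0 (H p) X) -> C (cohomology K p.+1).
Proof.
have [w wP] := classifies_exists (ses_coker p).
apply: (serre_exact CS (joint_image_rel (Ext_delta X w 0 \o ext_class X (B p) 0)
    (coh_class p.+1 \o hom_precomp (coker_bound p)))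
  (joint_image_rel (coh_class p.+1)
    (ext_class X (H p) 0 \o hom_precomp (incl (kernel (coker_bound p)))))).
- by move=> v [psi [/(delta_of_coh wP) + <-]].
- by move=> v; have [phi <-] := coh_class_surj v; eexists; exists phi; split; reflexivity.
move=> v [phi [<- /ext_class_eq0 phi0]].
have [q qP] := factor_linear (@coker_bound_surj p) (q := (phi : {linear W p.+1 -> X}))
  (fun u u0 => congr1 (fun h : hom _ _ => (h : {linear _ -> _})
    (Submod (introT eqP u0 : u \in kernel (coker_bound p)))) phi0).
eexists; exists (q : hom _ _); split; first reflexivity.
by congr (coh_class p.+1 _); apply: hom_eq => y; exact: qP.
Qed.

Lemma Ext_of_coh p : C (cohomology K p.+1) -> C (Ext 1 (W p) X).
Proof.
have [w wP] := classifies_exists (ses_coker p) => CK; have CK' := CK.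
apply: (serre_exact CS (joint_image_rel (coh_class p.+1 \o hom_precomp (coker_bound p))
    (Ext_delta X w 0 \o ext_class X (B p) 0)) (W := cohomology K p.+1)
    (sigma := fun _ v => v = 0)) CK CK'.
- by split=> // c u u' v v' -> ->; rewrite scaler0 addr0.
- by move=> v [psi [/(delta_of_coh wP) + <-]].
- by move=> v; exists 0.
move=> v _; have [|xi ->] := Ext_exact_delta_im (xi := v) (ses_coker p) wP.
  exact: (Ext_split_cover (Ext_map _ _ _ _) (@splitP p)).
have [psi <-] := ext_class_surj xi.
by eexists; exists psi; split; reflexivity.
Qed.

(** Comparison of Ext with the cohomology of Hom(P, X), by dimension shifting
    through the cokernels W p = P p / im (bd p): up to the torsion homology of P,
    Ext^(i+1)(W p) is Ext^i(W (p+1)), and Ext^1(W p) is H^(p+1) of Hom(P, X). *)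
Lemma coh_nilpotent_inP n :
  (forall i, (i <= n)%N -> C (cohomology K i)) <-> Ext_nilpotent_in X C b n.
Proof.
have half := @Ext_half_exact R X C CS; have delta := @Ext_delta_exact R X C CS.
have fgW p : finitely_generated (W p) by exact: fg_quot.
have to_W0 m : (forall i, (i <= m)%N -> C (Ext i (W 0) X)) -> Ext_nilpotent_in X C b m.
  apply: (devissage noethR half delta (fgW 0) nilpotent_coker0) => // V v q prq bq vq.
  by apply: (nonzero_map_prime prq vq (fgW 0)) => c /annW0; exact: bq.
split=> [CK|Cn].
  apply: (to_W0); elim/ltn_ind => m IHm le_mn.
  have lower : (0 < m)%N -> Ext_nilpotent_in X C b m.-1.
    move=> m0; apply: (to_W0) => i; rewrite -ltnS prednK // => im.
    by apply: IHm => //; rewrite (leq_trans (ltnW im)).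
  case: m {IHm} le_mn lower => [|m] le_mn lower; first by apply/coh0P/CK.
  suff H i p : (i + p)%N = m -> C (Ext i.+1 (W p) X) by exact: (H m 0%N (addn0 m)).
  elim: i p => [|i IHi] p ipm; first by apply: Ext_of_coh; apply: CK; rewrite -ipm in le_mn.
  apply/Ext_bound_coker; apply: (delta _ _ _ _ _ _ (ses_homology p)) => //.
    by apply: IHi; rewrite addnS -ipm.
  move=> j [<-]; apply: (Ext_homology_in p (lower isT)) => //=.
  by rewrite -ipm addSn -addnS leq_addr.
have CW p i : (i.+1 + p <= n)%N -> C (Ext i.+1 (W p) X).
  elim: p i => [|p IHp] i ipn.
    by apply: Cn => //; [rewrite addn0 in ipn | exact: nilpotent_coker0].
  apply: (half _ _ _ _ _ _ (ses_homology p)) => //.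
    by apply/Ext_bound_coker; apply: IHp; rewrite addSnnS.
  by apply: (Ext_homology_in p Cn); exact: leq_trans (leq_addr _ _) ipn.
case=> [|i] le_in; first by apply/coh0P; apply: Cn => //; exact: nilpotent_coker0.
apply: coh_of_Ext; first by apply: CW; rewrite add1n.
exact: (Ext_homology_in i Cn).
Qed.

End TorsionComplex.

(** * The Koszul complex *)

Section KoszulChains.
Context (R : comNzRingType) (r : nat) (x : 'I_r -> R).
Implicit Types (S T : {set 'I_r}) (j k : 'I_r) (X : lmodType R).

Local Notation sgn := (@koszul_sign R r).
Local Notation chains := {ffun {set 'I_r} -> R^o}.

Lemma koszul_partP X p (f : {ffun {set 'I_r} -> X}) :
  reflect (forall S, #|S| != p -> f S = 0) (f \in koszul_part r X p).
Proof.
apply: (iffP forallP) => H S; first by move=> Sp; apply/eqP/(implyP (H S)).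
by apply/implyP => /H ->.
Qed.

Lemma koszul_sign_sq S j : sgn S j * sgn S j = 1.
Proof. by rewrite -expr2 -exprM mulnC exprM sqrrN expr1n expr1n. Qed.

Lemma koszul_signD1_le S j k : (k <= j)%N -> sgn (S :\ j) k = sgn S k.
Proof.
move=> kj; rewrite /koszul_sign; congr (_ ^+ #|pred_of_set _|).
apply/setP => l; rewrite !inE; case: eqVneq => //= ->.
by rewrite ltnNge kj andbF.
Qed.

Lemma koszul_signD1_lt S j k : j \in S -> (j < k)%N -> sgn (S :\ j) k = - sgn S k.
Proof.
move=> jS jk; rewrite /koszul_sign [in RHS](cardsD1 j) inE jS jk add1n exprS mulN1r opprK.
by congr (_ ^+ #|pred_of_set _|); apply/setP => l; rewrite !inE andbA.
Qed.

Lemma koszul_sign_anti S j k : j \in S -> k \in S -> j != k ->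
  sgn S k * sgn S j = - (sgn (S :\ k) j * sgn (S :\ j) k).
Proof.
move=> jS kS; rewrite -val_eqE neq_ltn => /orP [jk|kj].
  by rewrite (koszul_signD1_lt jS jk) (koszul_signD1_le _ (ltnW jk)) mulrN opprK mulrC.
by rewrite (koszul_signD1_lt kS kj) (koszul_signD1_le _ (ltnW kj)) mulNr opprK mulrC.
Qed.

(** The differential of the Koszul chain complex, e_S |-> \sum_(j in S) +/- x_j e_(S :\ j),
    in coordinates. *)
Definition koszul_bd_fun (g : chains) : chains :=
  [ffun T : {set 'I_r} => \sum_(j | j \notin T) sgn (j |: T) j * (x j * (g (j |: T) : R))].

Fact koszul_bd_fun_linear : linear koszul_bd_fun.
Proof.
move=> c f g; apply/ffunP => T; rewrite !ffunE /GRing.scale /= mulr_sumr -big_split /=.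
by apply: eq_bigr => j _; rewrite !ffunE /GRing.scale /=; ring.
Qed.

Definition koszul_bd_lin : {linear chains -> chains} := lin_of koszul_bd_fun_linear.

Local Notation P p := (submod (koszul_part r R^o p)).

Fact koszul_bd_subproof p : maps_to koszul_bd_lin (koszul_part r R^o p.+1) (koszul_part r R^o p).
Proof.
move=> g /koszul_partP gp; apply/koszul_partP => T Tp; rewrite ffunE big1 // => j jT.
by rewrite gp ?mulr0 // cardsU1 jT.
Qed.
Definition koszul_bd p : {linear P p.+1 -> P p} := submod_map (@koszul_bd_subproof p).

Lemma koszul_bdE p (g : P p.+1) : val (koszul_bd p g) = koszul_bd_fun (val g).
Proof. by []. Qed.

Definition koszul_wedge j (g : chains) : chains :=
  [ffun S : {set 'I_r} => if j \in S then sgn S j * (g (S :\ j) : R) else 0].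

(** Left multiplication by e_j is a homotopy from multiplication by x_j to 0. If j is
    in T, the terms indexed by k outside T cancel in pairs. *)
Lemma koszul_homotopy j g T :
  koszul_bd_fun (koszul_wedge j g) T + koszul_wedge j (koszul_bd_fun g) T = x j * (g T : R).
Proof.
rewrite !ffunE; case: ifPn => jT; last first.
  rewrite addr0 (bigD1 j) //= ffunE setU11 big1 ?addr0 => [|k /andP [kT kj]].
    by rewrite setU1K // mulrCA (mulrA (sgn _ _)) koszul_sign_sq mul1r.
  by rewrite ffunE !inE eq_sym (negPf kj) (negPf jT) !mulr0.
rewrite [X in _ + _ * X](bigD1 j) ?inE ?eqxx //= setD1K // mulrDr.
rewrite (mulrA (sgn T j) (sgn T j)) koszul_sign_sq mul1r addrCA -[RHS]addr0; congr (_ + _).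
rewrite mulr_sumr [X in _ + X](eq_bigl (fun k => k \notin T)); last first.
  move=> k; rewrite !inE negb_and negbK andb_orl andbN /=.
  by case: eqVneq => [->|_]; rewrite ?jT ?andbT ?andbF.
rewrite -big_split /= big1 // => k kT; rewrite ffunE !inE jT orbT.
have jk : j != k by apply: contraNneq kT => <-.
have -> : k |: T :\ j = (k |: T) :\ j.
  by apply/setP => l; rewrite !inE; case: eqVneq => [->|] //=; rewrite ?jk // eq_sym (negPf jk).
have := @koszul_sign_anti (k |: T) j k; rewrite !inE jT eqxx orbT jk => /(_ isT isT isT).
rewrite setU1K // => e.
transitivity ((sgn (k |: T) k * sgn (k |: T) j + sgn T j * sgn ((k |: T) :\ j) k)
  * (x k * (g ((k |: T) :\ j) : R))); first by ring.
by rewrite e addNr mul0r.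
Qed.

Fact koszul_wedge_subproof j p (g : P p) : koszul_wedge j (val g) \in koszul_part r R^o p.+1.
Proof.
apply/koszul_partP => S Sp; rewrite ffunE; case: ifP => // jS.
have /koszul_partP gp := submod_valP g; rewrite gp ?mulr0 //.
by apply: contra Sp; rewrite (cardsD1 j S) jS.
Qed.

Lemma koszul_kill p (z : P p) (c : R^o) : koszul_bd_fun (val z) = 0 ->
  c \in ideal_gen (codom x) -> exists w, koszul_bd p w = (c : R) *: z.
Proof.
move=> z0; have K : linear_closed (fun c : R^o => exists w, koszul_bd p w = (c : R) *: z).
  split=> [|a d e [w wE] [w' wE']]; first by exists 0; rewrite linear0 scale0r.
  by exists (a *: w + w'); rewrite linearP wE wE' scalerDl scalerA.
apply: (span_ind K) => _ /codomP [j ->].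
exists (Submod (koszul_wedge_subproof j z)); apply: val_inj; apply/ffunP => T.
rewrite [RHS]ffunE /= -[RHS](koszul_homotopy j (val z) T) z0.
rewrite [X in _ + X](_ : _ = 0) ?addr0 // ffunE; case: ifP => // _.
by rewrite ffunE mulr0.
Qed.

(** The value 0 when S does not have p elements lets sums range over all subsets. *)
Definition koszul_basis p S : P p := insubd 0 ([ffun T => (T == S)%:R] : chains).

Lemma koszul_basisE p S T : val (koszul_basis p S) T = ((#|S| == p) && (T == S))%:R.
Proof.
have [Sp|Sp] := eqVneq #|S| p.
  rewrite /koszul_basis /insubd insubT /=; last by rewrite ffunE.
  by apply/koszul_partP => U; rewrite ffunE; case: (eqVneq U S) => [->|//]; rewrite Sp eqxx.
rewrite /koszul_basis /insubd insubF ?ffunE //; apply/negP => /koszul_partP /(_ S Sp).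
by rewrite ffunE eqxx => /eqP; rewrite oner_eq0.
Qed.

Lemma koszul_basis_sum p (g : P p) : g = \sum_S (val g S : R) *: koszul_basis p S.
Proof.
apply: val_inj; rewrite -[RHS]/(incl _ _) linear_sum; apply/ffunP => T.
rewrite sum_ffunE (bigD1 T) //= big1 ?addr0 => [|S ST].
  rewrite !ffunE koszul_basisE eqxx andbT; case: eqVneq => [_|Tp]; rewrite /GRing.scale /= ?mulr1 //.
  by have /koszul_partP -> := submod_valP g; rewrite ?mul0r.
by rewrite !ffunE koszul_basisE [T == S]eq_sym (negPf ST) andbF scaler0.
Qed.

Lemma fg_koszul p : finitely_generated (P p).
Proof.
exists (codom (koszul_basis p)) => g; rewrite (koszul_basis_sum g).
apply: rpred_sum => S _; apply/rpredZ/mem_span; exact: codom_f.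
Qed.

Section FromBasis.
Context (p : nat) (V : lmodType R) (v : {set 'I_r} -> V).
Fact koszul_lift_linear : linear (fun g : P p => \sum_S (val g S : R) *: v S).
Proof.
move=> a g h; rewrite scaler_sumr -big_split; apply: eq_bigr => S _ /=.
by rewrite !ffunE scalerDl scalerA.
Qed.
Definition koszul_lift : {linear P p -> V} := lin_of koszul_lift_linear.

Lemma koszul_lift_basis S : #|S| == p -> koszul_lift (koszul_basis p S) = v S.
Proof.
move=> Sp; rewrite [LHS](bigD1 S) //= big1 ?addr0 => [|T TS].
  by rewrite koszul_basisE Sp eqxx scale1r.
by rewrite koszul_basisE (negPf TS) andbF scale0r.
Qed.
End FromBasis.

Lemma koszul_ext p X (f g : {linear P p -> X}) :
  (forall S, #|S| == p -> f (koszul_basis p S) = g (koszul_basis p S)) -> f =1 g.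
Proof.
move=> fg z; rewrite (koszul_basis_sum z) !linear_sum; apply: eq_bigr => S _.
rewrite !linearZ /=; have [Sp|Sp] := eqVneq #|S| p; first by rewrite fg ?Sp.
by have /koszul_partP -> := submod_valP z; rewrite ?scale0r.
Qed.

Lemma split_cover_koszul p : split_cover (P p).
Proof.
pose s := koszul_lift p (fun S => free_var (koszul_basis p S)).
exists s; apply: (koszul_ext (f := augment _ \o s) (g := idfun)) => S Sp.
by rewrite [LHS](_ : _ = augment _ (s (koszul_basis p S))) // /s koszul_lift_basis // augment_var.
Qed.

Lemma koszul_ann0 : {subset Ann (coker_bd (P := fun p => P p) koszul_bd 0) <= ideal_gen (codom x)}.
Proof.
move=> c /AnnP /(_ (quotmod_pi _ (koszul_basis 0 set0))); rewrite -linearZ => /eqP.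
rewrite quotmod_pi_eq0 => /lin_imageP [w /(congr1 (fun g : P 0 => val g set0))].
rewrite koszul_bdE [RHS]ffunE koszul_basisE cards0 !eqxx /GRing.scale /= mulr1 => <-.
rewrite ffunE; apply: (big_ind (fun c : R^o => c \in ideal_gen (codom x))) => [||j _].
- exact: rpred0.
- by move=> c1 c2; exact: rpredD.
have xj : (x j : R^o) \in ideal_gen (codom x) by apply: mem_span; exact: codom_f.
rewrite mulrCA mulrC; exact: (rpredZ (sgn (j |: set0) j * (val w (j |: set0) : R))).
Qed.

Section Cochains.
Context (X : lmodType R).
Local Notation K := (koszul_complex x X).

Fact koszul_dual_subproof p (phi : hom (P p) X) :
  [ffun S => (phi : {linear _ -> _}) (koszul_basis p S)] \in koszul_part r X p.
Proof.
apply/koszul_partP => S Sp; rewrite ffunE (_ : koszul_basis p S = 0) ?linear0 //.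
by apply: val_inj; apply/ffunP => T; rewrite koszul_basisE (negPf Sp) ffunE.
Qed.

Fact koszul_dual_linear p : linear (fun phi => Submod (koszul_dual_subproof phi) : K p).
Proof. by move=> a f g; apply: val_inj; apply/ffunP => S; rewrite !ffunE. Qed.
Definition koszul_dual p : {linear hom (P p) X -> K p} := lin_of (@koszul_dual_linear p).

Lemma koszul_dualE p (phi : {linear P p -> X}) S :
  val (koszul_dual p (phi : hom _ _)) S = phi (koszul_basis p S).
Proof. by rewrite /= ffunE. Qed.

Lemma koszul_dual_inj p : injective (koszul_dual p).
Proof.
move=> f g fg; apply: hom_eq; apply: koszul_ext => S _.
by rewrite -!koszul_dualE; congr (_ _); rewrite fg.
Qed.

Lemma koszul_dual_surj p f : exists phi, koszul_dual p phi = f.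
Proof.
exists (koszul_lift p (val f) : hom _ _); apply: val_inj; apply/ffunP => S.
rewrite koszul_dualE; have [Sp|Sp] := boolP (#|S| == p); first by rewrite koszul_lift_basis.
by have /koszul_partP -> // := submod_valP f; rewrite -koszul_dualE;
  have /koszul_partP -> := submod_valP (koszul_dual p (koszul_lift p (val f) : hom _ _)).
Qed.

Lemma koszul_bd_basis p S : #|S| == p.+1 ->
  koszul_bd p (koszul_basis p.+1 S) = \sum_(j in S) (sgn S j * x j) *: koszul_basis p (S :\ j).
Proof.
move=> Sp; apply: val_inj; rewrite -[RHS]/(incl _ _) linear_sum; apply/ffunP => T.
rewrite koszul_bdE sum_ffunE ffunE big_mkcond [RHS]big_mkcond; apply: eq_bigr => j _.
rewrite !ffunE koszul_basisE Sp /=.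
case: ifPn => jT; case: ifPn => jS.
- have cSj : #|S :\ j| == p by move: Sp; rewrite (cardsD1 j) jS.
  rewrite koszul_basisE cSj /=; have [TS|TS] := eqVneq T (S :\ j).
    by rewrite TS setD1K // eqxx /GRing.scale /= mulrA.
  rewrite scaler0; case: eqVneq => [e|_]; last by rewrite !mulr0.
  by case/eqP: TS; rewrite -e setU1K.
- case: eqVneq => [e|_]; last by rewrite !mulr0.
  by rewrite -e setU11 in jS.
- rewrite !koszul_basisE; case: (eqVneq T (S :\ j)) => [e|_]; last by rewrite andbF scaler0.
  by rewrite e !inE eqxx in jT.
by [].
Qed.

Lemma koszul_dualD p phi :
  cdiff K p (koszul_dual p phi) = koszul_dual p.+1 (hom_precomp (koszul_bd p) phi).
Proof.
apply: val_inj; apply/ffunP => S.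
have [Sp|Sp] := boolP (#|S| == p.+1); last first.
  have /koszul_partP -> // := submod_valP (cdiff K p (koszul_dual p phi)).
  by have /koszul_partP -> := submod_valP (koszul_dual p.+1 (hom_precomp (koszul_bd p) phi)).
rewrite koszul_dualE [RHS](_ : _ = (phi : {linear _ -> _}) (koszul_bd p (koszul_basis p.+1 S))) //.
rewrite koszul_bd_basis // linear_sum ffunE; apply: eq_bigr => j _.
transitivity ((sgn S j * x j) *: val (koszul_dual p phi) (S :\ j)).
  by rewrite scalerA.
by rewrite !koszul_dualE linearZ.
Qed.

End Cochains.

(** Obtained from the vanishing of d o d on the cochains with coefficients in P p,
    evaluated at the identity of P p. *)
Lemma koszul_bdK p z : koszul_bd p (koszul_bd p.+1 z) = 0.
Proof.
have e : hom_precomp (koszul_bd p.+1) (hom_precomp (koszul_bd p) (idfun : hom (P p) (P p))) = 0.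
  by apply: (@koszul_dual_inj _ p.+2); rewrite -!koszul_dualD linear0; exact: cdiffK.
exact: (congr1 (fun h : hom _ _ => (h : {linear _ -> _}) z) e).
Qed.

End KoszulChains.

Lemma koszul_nilpotent_inP (R : comNzRingType) (r : nat) (x : 'I_r -> R) (b : ideal R)
    (X : lmodType R) (C : lmodType R -> Prop) n :
  noetherian R -> serre C -> b =i ideal_gen (codom x) ->
  (forall i, (i <= n)%N -> C (koszul_cohomology x X i)) <-> Ext_nilpotent_in X C b n.
Proof.
move=> noethR CS bx.
have kill0 c (z : submod (koszul_part r R^o 0)) : c \in b ->
    exists w, koszul_bd x 0 w = (c : R) *: z.
  rewrite bx => cb; apply: koszul_kill cb; apply/ffunP => T; rewrite !ffunE.
  rewrite big1 // => j jT; have /koszul_partP -> := submod_valP z; first by rewrite !mulr0.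
  by rewrite cardsU1 jT.
have killS p c (z : submod (koszul_part r R^o p.+1)) : c \in b -> koszul_bd x p z = 0 ->
    exists w, koszul_bd x p.+1 w = (c : R) *: z.
  by rewrite bx => cb z0; apply: koszul_kill cb; rewrite -koszul_bdE z0.
have ann0 : {subset Ann (coker_bd (P := fun p => submod (koszul_part r R^o p)) (koszul_bd x) 0) <= b}.
  by move=> c; rewrite bx; exact: koszul_ann0.
exact: (@coh_nilpotent_inP R X C noethR CS (fun p => submod (koszul_part r R^o p)) (koszul_bd x) b
  (@koszul_bdK R r x) (@fg_koszul R r) (@split_cover_koszul R r) kill0 killS ann0
  (koszul_complex x X) (@koszul_dual R r x X) (@koszul_dual_inj R r x X)
  (@koszul_dual_surj R r x X) (@koszul_dualD R r x X)).
Qed.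

(** * Regular elements *)

Section RegularElement.
Context (R : comNzRingType) (V : lmodType R).
Implicit Types (u v w : V).

Notation span_seq s := (span (fun w => w \in s)).

Definition maximal_ann v : Prop := v <> 0 /\
  forall w, w <> 0 -> {subset ann_elt v <= ann_elt w} -> {subset ann_elt w <= ann_elt v}.

Lemma maximal_ann_prime v : maximal_ann v -> prime_ideal (ann_elt v).
Proof.
move=> [v0 vmax]; split; first by apply/negP => /ann_eltP; rewrite scale1r.
move=> d e /ann_eltP de0; have [/ann_eltP ev|ev] := pselect (e *: v = 0); first by right.
left; apply: (vmax _ ev); last by apply/ann_eltP; rewrite scalerA.
by move=> c /ann_eltP cv; apply/ann_eltP; rewrite scalerA mulrC -scalerA cv scaler0.
Qed.

Lemma common_annihilator (p : ideal R) (t : seq V) : prime_ideal p ->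
  (forall u, u \in t -> exists2 c : R^o, c \in ann_elt u & c \notin p) ->
  exists2 c : R^o, c \notin p & forall u, u \in t -> (c : R) *: u = 0.
Proof.
move=> [p1 pprime]; elim: t => [|u t IHt] tp; first by exists 1.
have [|c cp ct] := IHt; first by move=> w wt; apply: tp; rewrite inE wt orbT.
have [d /ann_eltP du dp] := tp u (mem_head _ _).
exists ((c : R) * d); first by apply/negP => /pprime [|]; apply/negP.
move=> w; rewrite inE => /predU1P [->|/ct cw]; first by rewrite -scalerA du scaler0.
by rewrite mulrC -scalerA cw scaler0.
Qed.

Lemma span_finite (A : V -> Prop) v : v \in span A ->
  exists2 t : seq V, (forall w, w \in t -> A w) & v \in span_seq t.
Proof.
have K : linear_closed (fun v => exists2 t : seq V, (forall w, w \in t -> A w) & v \in span_seq t).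
  split=> [|a u w [t tA ut] [t' tA' wt']]; first by exists [::]; rewrite ?rpred0.
  exists (t ++ t') => [y|]; first by rewrite mem_cat => /orP [/tA|/tA'].
  by rewrite rpredD ?rpredZ //; [exact: span_catl | exact: span_catr].
apply: (span_ind K) => w Aw; exists [:: w] => [y|]; first by rewrite inE => /eqP ->.
by apply: mem_span; rewrite mem_head.
Qed.

Hypotheses (noethR : noetherian R) (fgV : finitely_generated V).

Lemma maximal_ann_exists v : v <> 0 ->
  exists2 w, maximal_ann w & {subset ann_elt v <= ann_elt w}.
Proof.
suff H (I : ideal R) u : u <> 0 -> I =i ann_elt u ->
    exists2 w, maximal_ann w & {subset ann_elt u <= ann_elt w} by move=> v0; exact: (H (ann_elt v)).
move: I u => {v}; apply: (noetherian_ind (V := R^o) noethR (@fg_ring R)) => I IH v v0 Iv.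
apply: contrapT => no; apply: (no); exists v => //; split=> // w w0 vw d dw.
apply: contrapT => /negP ndv; apply: no.
have [||u umax wu] := IH (ann_elt w) _ _ w w0 (fun=> erefl).
- by move=> c; rewrite Iv; exact: vw.
- by exists d => //; rewrite Iv.
by exists u => // c /vw /wu.
Qed.

(** The elements with a maximal annihilator span a submodule that is already spanned
    by finitely many of them. The annihilator of any other one contains the
    intersection of theirs, hence one of them, being prime. *)
Lemma maximal_ann_finite : exists2 t : seq V, (forall u, u \in t -> maximal_ann u) &
  forall w, maximal_ann w -> exists2 u, u \in t & {subset ann_elt w <= ann_elt u}.
Proof.
have [s sP] := noetherian_sub noethR (span maximal_ann) fgV.
have [t tmax st] : exists2 t : seq V, (forall u, u \in t -> maximal_ann u) &
    forall v, v \in s -> v \in span_seq t.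
  have : forall v, v \in s -> v \in span maximal_ann by move=> v vs; rewrite sP mem_span.
  elim: (s) => [|v s' IHs] sA; first by exists [::].
  have [|t tmax tP] := IHs; first by move=> w ws; apply: sA; rewrite inE ws orbT.
  have [t' tmax' vt'] := span_finite (sA v (mem_head _ _)).
  exists (t' ++ t) => [u|u]; first by rewrite mem_cat => /orP [/tmax'|/tmax].
  by rewrite inE => /predU1P [->|/tP]; [exact: span_catl | exact: span_catr].
exists t => // w wmax; apply: contrapT => no.
have [|c /negP cw ct] := @common_annihilator (ann_elt w) t (maximal_ann_prime wmax).
  move=> u ut; apply: contrapT => nc; apply: no; exists u => //.
  apply: (tmax u ut).2; first exact: wmax.1.
  by move=> d du; apply: contrapT => /negP dw; apply: nc; exists d.
apply: cw; apply/ann_eltP; have ws : w \in span_seq t.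
  have : w \in span maximal_ann by exact: mem_span.
  by rewrite sP; apply: span_min.
have K : linear_closed (fun v : V => (c : R) *: v = 0).
  split=> [|d u v u0 v0]; first exact: scaler0.
  by rewrite scalerDr scalerA mulrC -scalerA u0 v0 scaler0 addr0.
exact: (span_ind K ct ws).
Qed.

(** Prime avoidance, applied to the finitely many maximal annihilators of nonzero
    elements of V, whose union is the set of zero divisors on V. *)
Lemma regular_element (b : ideal R) :
  (forall v, (forall c : R^o, c \in b -> (c : R) *: v = 0) -> v = 0) ->
  exists2 y : R^o, y \in b & forall v, (y : R) *: v = 0 -> v = 0.
Proof.
move=> b0; have [t tmax tP] := maximal_ann_finite.
suff [y yb yt] : exists2 y : R^o, y \in b & forall u, u \in t -> (y : R) *: u <> 0.
  exists y => // v yv; apply: contrapT => v0.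
  have [w wmax vw] := maximal_ann_exists v0; have [u ut wu] := tP w wmax.
  apply: (yt u ut); apply/ann_eltP/wu/vw; exact/ann_eltP.
elim: t tmax {tP} => [|u t IHt] tmax; first by exists 0; rewrite ?rpred0.
have [|y yb yt] := IHt; first by move=> w wt; apply: tmax; rewrite inE wt orbT.
have [yu|yu] := pselect ((y : R) *: u = 0); last first.
  by exists y => // w; rewrite inE => /predU1P [->|/yt].
have umax := tmax u (mem_head _ _); have [u1 uprime] := maximal_ann_prime umax.
have [c cb cu] : exists2 c : R^o, c \in b & (c : R) *: u <> 0.
  apply: contrapT => no; apply: umax.1; apply: b0 => c cb.
  by apply: contrapT => cu; apply: no; exists c.
have [|d /ann_eltP du dt] := @common_annihilator (ann_elt u) t (maximal_ann_prime umax).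
  move=> w wt; apply: contrapT => no; apply: (yt w wt).
  have wmax : maximal_ann w by apply: tmax; rewrite inE wt orbT.
  have wu : {subset ann_elt w <= ann_elt u}.
    by move=> d dw; apply: contrapT => /negP du; apply: no; exists d.
  by apply/ann_eltP; apply: (wmax.2 _ umax.1 wu); exact/ann_eltP.
(* d c is in b and in the annihilators of t, but not in that of u, which contains y *)
exists (y + (d : R) * c); first by rewrite rpredD //; exact: (rpredZ (d : R)).
move=> w; rewrite inE scalerDl => /predU1P [->|wt].
  rewrite yu add0r => dcu.
  by have /uprime [/ann_eltP|/ann_eltP] : (d : R) * c \in ann_elt u by apply/ann_eltP.
by rewrite mulrC -scalerA dt // scaler0 addr0; exact: yt.
Qed.

End RegularElement.

(** * Koszul cohomology as a functor of the coefficients *)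

Section KoszulCoefficients.
Context (R : comNzRingType) (r : nat) (x : 'I_r -> R).
Implicit Types (X : lmodType R).

Local Notation Z i X := (koszul_cohomology x X i).
Local Notation K X := (koszul_complex x X).

Section Map.
Context (X X' : lmodType R) (f : {linear X -> X'}).

Definition koszul_map_fun (u : {ffun {set 'I_r} -> X}) : {ffun {set 'I_r} -> X'} :=
  [ffun S : {set 'I_r} => f (u S)].

Fact koszul_map_fun_linear : linear koszul_map_fun.
Proof. by move=> a u v; apply/ffunP => S; rewrite !ffunE linearP. Qed.

Fact koszul_map_subproof p :
  maps_to (lin_of koszul_map_fun_linear) (koszul_part r X p) (koszul_part r X' p).
Proof.
by move=> u /koszul_partP up; apply/koszul_partP => S Sp; rewrite ffunE up // linear0.
Qed.

Definition koszul_map p : {linear K X p -> K X' p} := submod_map (@koszul_map_subproof p).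

Lemma koszul_mapE p u S : val (koszul_map p u) S = f (val u S).
Proof. by rewrite /= ffunE. Qed.

Lemma koszul_map_diff p u : koszul_map p.+1 (cdiff (K X) p u) = cdiff (K X') p (koszul_map p u).
Proof.
apply: val_inj; apply/ffunP => S; rewrite koszul_mapE /= !ffunE linear_sum.
have fZ (c : R) v : f (c *: v) = c *: f v by rewrite linearZ.
apply: eq_bigr => j _; rewrite !fZ.
by rewrite -[lin_fun _ _]/(koszul_map_fun (submod_val u)) ffunE.
Qed.

Lemma koszul_map_inj p : injective f -> injective (koszul_map p).
Proof.
move=> fi u v e; apply: val_inj; apply/ffunP => S; apply: fi.
by rewrite -!koszul_mapE e.
Qed.

Lemma koszul_map_lift p (w : K X' p) : injective f -> (forall S, exists v, f v = val w S) ->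
  exists u, koszul_map p u = w.
Proof.
move=> fi /choice [g gP].
have gp : [ffun S : {set 'I_r} => g S] \in koszul_part r X p.
  apply/koszul_partP => S Sp; rewrite ffunE; apply: fi; rewrite gP linear0.
  by have /koszul_partP -> := submod_valP w.
by exists (Submod gp); apply: val_inj; apply/ffunP => S; rewrite koszul_mapE /= ffunE gP.
Qed.

Lemma koszul_map_surj p (w : K X' p) : (forall v', exists v, f v = v') ->
  exists u, koszul_map p u = w.
Proof.
move=> /choice [g gP].
have gp : [ffun S : {set 'I_r} => if #|S| == p then g (val w S) else 0] \in koszul_part r X p.
  by apply/koszul_partP => S Sp; rewrite ffunE (negPf Sp).
exists (Submod gp); apply: val_inj; apply/ffunP => S; rewrite koszul_mapE /= ffunE.
case: eqVneq => [_|Sp]; first exact: gP.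
by rewrite linear0; have /koszul_partP -> := submod_valP w.
Qed.

Definition koszul_cohomology_map i : {linear Z i X -> Z i X'} := cohomology_map koszul_map_diff i.

End Map.

Section Classes.
Context (X : lmodType R).

Definition koszul_class i : {linear cocycle (K X) i -> Z i X} :=
  quotmod_pi (coboundary (K X) i).

Lemma koszul_class_surj i h : exists z, koszul_class i z = h.
Proof. exact: quotmod_surj. Qed.

Lemma koszul_class0_eq0 z : koszul_class 0 z = 0 -> z = 0.
Proof. by move=> /eqP; rewrite quotmod_pi_eq0 => /eqP. Qed.

Lemma koszul_classS_eq0 i z : koszul_class i.+1 z = 0 <-> exists t, cdiff (K X) i t = val z.
Proof.
split=> [/eqP|[t tz]]; first by rewrite quotmod_pi_eq0 => /asboolP.
by apply/eqP; rewrite quotmod_pi_eq0; apply/asboolP; exists t.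
Qed.

Lemma cocycleP i (z : cocycle (K X) i) : cdiff (K X) i (val z) = 0.
Proof. by apply/eqP; exact: (submod_valP z). Qed.

Fact koszul_wedge_linear p j : linear (fun g => Submod (koszul_wedge_subproof j g) :
  submod (koszul_part r R^o p.+1)).
Proof.
move=> a g h; apply: val_inj; apply/ffunP => S; rewrite !ffunE /GRing.scale /=.
by case: ifP => _; [ring | rewrite mulr0 addr0].
Qed.
Definition koszul_wedge_lin p j : {linear submod (koszul_part r R^o p) -> submod (koszul_part r R^o p.+1)} :=
  lin_of (@koszul_wedge_linear p j).

Lemma koszul_wedge_homotopy p j g :
  koszul_bd x p.+1 (koszul_wedge_lin p.+1 j g) + koszul_wedge_lin p j (koszul_bd x p g) = x j *: g.
Proof.
apply: val_inj; apply/ffunP => T; rewrite [LHS]ffunE [RHS]ffunE; exact: koszul_homotopy.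
Qed.

Lemma koszul_wedge_homotopy0 j g : koszul_bd x 0 (koszul_wedge_lin 0 j g) = x j *: g.
Proof.
apply: val_inj; apply/ffunP => T; rewrite [RHS]ffunE.
rewrite -[RHS](koszul_homotopy x j (val g) T) -[LHS]addr0; congr (_ + _).
rewrite ffunE; case: ifP => // jT; rewrite ffunE big1 ?mulr0 // => k kT.
by have /koszul_partP -> := submod_valP g; rewrite ?mulr0 // cardsU1 kT.
Qed.

Lemma koszul_cohomology_ann i : {subset ideal_gen (codom x) <= Ann (Z i X)}.
Proof.
apply: span_min => _ /codomP [j ->]; apply/AnnP => h.
have [z <-] := koszul_class_surj h; rewrite -linearZ.
have [phi phif] := @koszul_dual_surj _ _ x _ _ (val z).
have phi0 g : (phi : {linear _ -> _}) (koszul_bd x i g) = 0.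
  have := cocycleP z; rewrite -phif koszul_dualD -(linear0 (koszul_dual x X i.+1)) => /koszul_dual_inj e.
  exact: (congr1 (fun h : hom _ _ => (h : {linear _ -> _}) g) e).
case: i h z phi phif phi0 => [|i] h z phi phif phi0.
  rewrite (_ : x j *: z = 0) ?linear0 //; apply: val_inj.
  rewrite [LHS](_ : _ = x j *: val z) // -phif -linearZ [X in koszul_dual _ _ _ X](_ : _ = 0) ?linear0 //.
  apply: hom_eq => g; rewrite -[RHS](phi0 (koszul_wedge_lin 0 j g)) koszul_wedge_homotopy0.
  by rewrite linearZ.
apply/koszul_classS_eq0; exists (koszul_dual x X i (hom_precomp (koszul_wedge_lin i j) phi)).
rewrite koszul_dualD [RHS](_ : _ = x j *: val z) // -phif -linearZ; congr (koszul_dual _ _ _ _).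
apply: hom_eq => g; rewrite [RHS](_ : _ = x j *: (phi : {linear _ -> _}) g) // -linearZ.
by rewrite -koszul_wedge_homotopy linearD phi0 add0r.
Qed.

End Classes.

Context (C : lmodType R -> Prop).
Hypothesis CS : serre C.

Lemma koszul_cohomology_in X i : C X -> C (Z i X).
Proof.
move=> CX; apply: (serre_quot CS (@koszul_class_surj X i)).
have evL (S : {set 'I_r}) : linear (fun z : cocycle (K X) i => val (val z) S).
  by move=> a u v; rewrite /= !ffunE.
apply: (@serre_family _ C CS _ (enum {set 'I_r}) (cocycle (K X) i) X (fun S => lin_of (evL S)) CX).
move=> z z0.
do 2!apply: val_inj; apply/ffunP => S; rewrite [RHS]ffunE; apply: z0.
exact: mem_enum.
Qed.

Lemma koszul_cohomology_mapE X X' (f : {linear X -> X'}) i (z : cocycle (K X) i) :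
  exists2 z' : cocycle (K X') i, val z' = koszul_map f i (val z) &
    koszul_cohomology_map f i (koszul_class _ i z) = koszul_class _ i z'.
Proof.
exists (cocycle_map (@koszul_map_diff X X' f) i z) => //; exact: quotmod_mapE.
Qed.

Lemma koszul_map_eq0 X' X X'' (f : {linear X' -> X}) (g : {linear X -> X''}) i (t : K X i) :
  short_exact f g -> koszul_map g i t = 0 <-> exists s, koszul_map f i s = t.
Proof.
case=> fi fg _; split=> [gt|[s <-]]; last first.
  apply: val_inj; apply/ffunP => S; rewrite !koszul_mapE [RHS]ffunE.
  by apply/fg; exists (val s S).
apply: koszul_map_lift => // S; apply/fg.
by rewrite -koszul_mapE gt ffunE.
Qed.

Lemma koszul_cohomology_delta X' X X'' (f : {linear X' -> X}) (g : {linear X -> X''}) i :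
  short_exact f g -> C (Z i X) -> C (Z i.+1 X') -> C (Z i X'').
Proof.
move=> S; have [fi fg gs] := S.
pose diffX : {linear (K X i * K X' i.+1)%type -> K X i.+1} :=
  (cdiff (K X) i \o fst) \- (koszul_map f i.+1 \o snd).
pose D := submod (kernel diffX).
have DP (p : D) : cdiff (K X) i (val p).1 = koszul_map f i.+1 (val p).2.
  by apply/eqP; rewrite -subr_eq0; exact: (submod_valP p).
have D1 (p : D) : (koszul_map g i \o fst \o incl _ : {linear D -> _}) p \in kernel (cdiff (K X'') i).
  rewrite mem_kernel /= -koszul_map_diff DP; apply/eqP/(koszul_map_eq0 _ S).
  by exists (val p).2.
have D2 (p : D) : (snd \o incl _ : {linear D -> _}) p \in kernel (cdiff (K X') i.+1).
  rewrite mem_kernel; apply/eqP/(koszul_map_inj (f := f) fi).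
  by rewrite linear0 koszul_map_diff -DP cdiffK.
apply: (serre_exact CS (graph_rel (koszul_cohomology_map g i))
  (joint_image_rel (koszul_class _ i \o corestrict D1) (koszul_class _ i.+1 \o corestrict D2))).
- by move=> v <-; exact: linear0.
- move=> v; have [z <-] := koszul_class_surj v.
  have [t tz] := koszul_map_surj (val z) gs.
  have [s sE] : exists s, koszul_map f i.+1 s = cdiff (K X) i t.
    by apply/(koszul_map_eq0 _ S); rewrite koszul_map_diff tz; exact: cocycleP.
  have pK : (t, s) \in kernel diffX by rewrite mem_kernel /= sE subrr.
  eexists; exists (Submod pK); split; last reflexivity.
  by congr (koszul_class _ i _); apply: val_inj.
move=> v [p [<- /koszul_classS_eq0 [s sE]]].
have tK : (val p).1 - koszul_map f i s \in kernel (cdiff (K X) i).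
  by rewrite mem_kernel linearB DP -koszul_map_diff sE subrr.
have [z' z'E zE] := koszul_cohomology_mapE g (Submod tK).
exists (koszul_class _ i (Submod tK)); rewrite zE; congr (koszul_class _ i _).
apply: val_inj; rewrite z'E /= linearB /= (_ : koszul_map g i (koszul_map f i s) = 0) ?subr0 //.
by apply/(koszul_map_eq0 _ S); exists s.
Qed.

Lemma koszul_class_lift0 X X'' (g : {linear X -> X''}) i (t : K X i) (z : cocycle (K X'') i) :
  (forall w, exists v, g v = w) -> val z = koszul_map g i t -> koszul_class _ i z = 0 ->
  exists2 t' : K X i, koszul_map g i t' = 0 & cdiff (K X) i t' = cdiff (K X) i t.
Proof.
move=> gs zt; case: i t z zt => [|i] t z zt.
  by move=> /koszul_class0_eq0 z0; exists t; rewrite // -zt z0.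
move=> /koszul_classS_eq0 [s sz]; have [u us] := koszul_map_surj s gs.
exists (t - cdiff (K X) i u); last by rewrite linearB cdiffK subr0.
by rewrite linearB koszul_map_diff us sz zt subrr.
Qed.

(** Multiplication by y kills Koszul cohomology, so y z = d t for a cocycle z. If t
    vanishes in the cohomology of X / yX, then z is cohomologous to a cocycle with
    values in 0 :_X y. *)
Lemma koszul_cohomology_step X (y : R) i : (y : R^o) \in ideal_gen (codom x) ->
  C (Z i.+1 (colon0 X (pred1 y))) -> C (Z i (quotmod (lin_image (scale_lin y X)))) -> C (Z i.+1 X).
Proof.
move=> yb; pose X0 := colon0 X (pred1 y); pose j : {linear X0 -> X} := incl _.
pose g : {linear X -> quotmod (lin_image (scale_lin y X))} := quotmod_pi _.
have ji : injective j by exact: val_inj.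
pose diffX : {linear (cocycle (K X) i.+1 * K X i)%type -> K X i.+1} :=
  (scale_lin y _ \o incl _ \o fst) \- (cdiff (K X) i \o snd).
pose D := submod (kernel diffX).
have DP (p : D) : y *: val (val p).1 = cdiff (K X) i (val p).2.
  by apply/eqP; rewrite -subr_eq0; exact: (submod_valP p).
have gy n (u : K X n) : koszul_map g n (y *: u) = 0.
  apply: val_inj; apply/ffunP => S; rewrite koszul_mapE [RHS]ffunE.
  rewrite (_ : val (y *: u) S = y *: val u S); last by rewrite /= ffunE.
  by apply/eqP; rewrite quotmod_pi_eq0; exact: (mem_lin_image (scale_lin y X)).
have D2 (p : D) : (koszul_map g i \o snd \o incl _ : {linear D -> _}) p \in kernel (cdiff (K _) i).
  by rewrite mem_kernel /= -koszul_map_diff -DP gy.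
apply: (serre_exact CS (graph_rel (koszul_cohomology_map j i.+1))
  (joint_image_rel (koszul_class _ i.+1 \o fst \o incl _ : {linear D -> _})
    (koszul_class _ i \o corestrict D2))).
- by move=> v <-; exact: linear0.
- move=> v; have [z <-] := koszul_class_surj v.
  have [t tz] : exists t, cdiff (K X) i t = val (y *: z).
    apply/koszul_classS_eq0; rewrite linearZ.
    by have /AnnP := @koszul_cohomology_ann X i.+1 _ yb; apply.
  have pK : (z, t) \in kernel diffX by rewrite mem_kernel /= tz subrr.
  by eexists; exists (Submod pK); split; reflexivity.
move=> v [p [<- p0]].
have lift n (u : K X n) : koszul_map g n u = 0 -> exists u', u = y *: u'.
  move=> gu; have /choice [h hP] : forall S : {set 'I_r}, exists w, (#|S| != n -> w = 0) /\ y *: w = val u S.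
    move=> S; have [Sn|Sn] := eqVneq #|S| n; last first.
      by exists 0; rewrite scaler0; have /koszul_partP -> := submod_valP u.
    have /lin_imageP [w wE] : val u S \in lin_image (scale_lin y X).
      by rewrite -quotmod_pi_eq0 -[quotmod_pi _ _]/(g (val u S)) -koszul_mapE gu ffunE.
    by exists w.
  have hK : [ffun S : {set 'I_r} => h S] \in koszul_part r X n.
    by apply/koszul_partP => S Sn; rewrite ffunE; exact: (hP S).1.
  exists (Submod hK); apply: val_inj; apply/ffunP => S.
  by rewrite [RHS]ffunE /= ffunE (hP S).2.
have [//|t' /lift [u uE] t'E] := @koszul_class_lift0 _ _ g i (val p).2 (corestrict D2 p)
  (@quotmod_surj _ _ _) _ p0.
have yz : y *: (val (val p).1 - cdiff (K X) i u) = 0.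
  by rewrite scalerBr DP -t'E uE linearZ subrr.
have [z0 z0E] : exists z0 : K X0 i.+1, koszul_map j i.+1 z0 = val (val p).1 - cdiff (K X) i u.
  apply: koszul_map_lift => // S.
  have vS : val (val (val p).1 - cdiff (K X) i u) S \in
      @GRing.SubmodClosed.clone R X (@colon0_pred R X (pred1 y)) _.
    apply/colon0P => c; rewrite inE => /eqP ->.
    have := congr1 (fun u : K X i.+1 => val u S) yz; rewrite [X in _ = X]ffunE => <-.
    by rewrite /= !ffunE.
  by exists (Submod vS).
have z0K : z0 \in kernel (cdiff (K X0) i.+1).
  rewrite mem_kernel; apply/eqP/(koszul_map_inj ji).
  by rewrite linear0 koszul_map_diff z0E linearB cdiffK cocycleP subrr.
have [z' z'E zE] := koszul_cohomology_mapE j (Submod z0K).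
exists (koszul_class _ i.+1 (Submod z0K)); rewrite zE; apply/eqP; rewrite -subr_eq0 -linearB.
apply/eqP/koszul_classS_eq0; exists (- u).
by rewrite linearN [RHS](_ : _ = val z' - val (val p).1) // z'E z0E addrAC subrr add0r.
Qed.

Lemma koszul_cohomology_step0 X (y : R) : (y : R^o) \in ideal_gen (codom x) ->
  C (Z 0 (colon0 X (pred1 y))) -> C (Z 0 X).
Proof.
move=> yb; pose X0 := colon0 X (pred1 y); pose j : {linear X0 -> X} := incl _.
apply: (serre_quot CS (g := koszul_cohomology_map j 0)) => v.
have [z zv] := koszul_class_surj v.
have yz : y *: z = 0.
  apply: koszul_class0_eq0; rewrite linearZ zv.
  by have /AnnP := @koszul_cohomology_ann X 0 _ yb; apply.
have [z0 z0E] : exists z0 : K X0 0, koszul_map j 0 z0 = val z.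
  apply: koszul_map_lift => [|S]; first exact: val_inj.
  have vS : val (val z) S \in @GRing.SubmodClosed.clone R X (@colon0_pred R X (pred1 y)) _.
    apply/colon0P => c; rewrite inE => /eqP ->.
    have := congr1 (fun u : cocycle (K X) 0 => val (val u) S) yz; rewrite [X in _ = X]ffunE => <-.
    by rewrite /= !ffunE.
  by exists (Submod vS).
have z0K : z0 \in kernel (cdiff (K X0) 0).
  rewrite mem_kernel; apply/eqP/(koszul_map_inj (f := j) val_inj).
  by rewrite linear0 koszul_map_diff z0E cocycleP.
have [z' z'E zE] := koszul_cohomology_mapE j (Submod z0K).
exists (koszul_class _ 0 (Submod z0K)); rewrite zE -zv; congr (koszul_class _ _ _).
by apply: val_inj; rewrite z'E.
Qed.

(** An element of 0 :_X b is the value at the empty set of a cocycle of degree 0. *)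
Lemma koszul_colon0 X (b : ideal R) : b =i ideal_gen (codom x) ->
  C (Z 0 X) -> C (colon0 X (mem b)).
Proof.
move=> bx.
have vK (v : X) : [ffun S : {set 'I_r} => if S == set0 then v else 0] \in koszul_part r X 0.
  apply/koszul_partP => S Sn; rewrite ffunE; case: eqVneq => // S0.
  by rewrite S0 cards0 in Sn.
have vL : linear (fun v => Submod (vK v) : K X 0).
  move=> a u v; apply: val_inj; apply/ffunP => S; rewrite !ffunE.
  by case: ifP => // _; rewrite scaler0 addr0.
have cK (v : colon0 X (mem b)) : (lin_of vL \o incl _ : {linear _ -> _}) v \in kernel (cdiff (K X) 0).
  rewrite mem_kernel; apply/eqP/val_inj/ffunP => S; rewrite [RHS]ffunE /= ffunE.
  apply: big1 => j _; rewrite ffunE; case: ifP => _; last by rewrite !scaler0.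
  have /colon0P v0 := submod_valP v; rewrite (v0 (x j)) ?scaler0 //.
  suff : (x j : R^o) \in b by [].
  by rewrite bx; apply: mem_span; exact: codom_f.
apply: (serre_sub CS (f := koszul_class X 0 \o corestrict cK)).
apply: inj_linear => v /koszul_class0_eq0 /(congr1 (fun z : cocycle (K X) 0 => val (val z) set0)).
by rewrite /= !ffunE eqxx => v0; apply: val_inj.
Qed.

End KoszulCoefficients.

(** * Regular sequences *)

Section RegularSequences.
Context (R : comNzRingType) (C : lmodType R -> Prop).
Hypothesis CS : serre C.
Implicit Types (X V W : lmodType R).

Lemma colon0_inj V W (f : {linear V -> W}) (A : {pred R}) :
  injective f -> C (colon0 W A) -> C (colon0 V A).
Proof.
move=> fi; have fA (v : colon0 V A) : (f \o incl _ : {linear _ -> _}) v \in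
    @GRing.SubmodClosed.clone R W (@colon0_pred R W A) _.
  apply/colon0P => c cA; rewrite /= -linearZ.
  have /colon0P v0 := submod_valP v.
  by rewrite [X in f X](v0 c cA) linear0.
apply: (serre_sub CS (f := corestrict fA)) => u v /(congr1 val) e.
by apply: val_inj; apply: fi.
Qed.

Lemma colon0_bij V W (f : {linear V -> W}) (A : {pred R}) :
  injective f -> (forall w, exists v, f v = w) -> C (colon0 V A) <-> C (colon0 W A).
Proof.
move=> fi fs; split; last exact: (colon0_inj fi).
have [|h hP] := @lift_injective _ _ _ _ f (idfun : {linear W -> W}) fi; first exact: fs.
by apply: (colon0_inj (f := h)) => u v e; rewrite -[u](hP u) -[v](hP v) e.
Qed.

Section ModCons.
Context (X : lmodType R) (y : R) (t : seq R).
Local Notation Xy := (quotmod (lin_image (scale_lin y X))).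
Local Notation g := (quotmod_pi (lin_image (scale_lin y X)) : {linear X -> Xy}).
Local Notation yt := (y :: t).

Lemma mod_cons_maps_to : maps_to g (ideal_mul (ideal_gen yt) (top X)) (ideal_mul (ideal_gen t) (top Xy)).
Proof.
move=> v vP; rewrite -lin_preimageP; apply: ideal_mul_min vP => c w cyt _.
rewrite lin_preimageP; have [d [e [et ->]]] := span_consP cyt.
rewrite scalerDl linearD rpredD //; last by rewrite linearZ; exact: mem_ideal_mul.
suff -> : g ((d *: (y : R^o) : R) *: w) = 0 by exact: rpred0.
apply/eqP; rewrite quotmod_pi_eq0.
have -> : (d *: (y : R^o) : R) = y * d by exact: mulrC.
by rewrite -scalerA; exact: (mem_lin_image (scale_lin y X) (d *: w)).
Qed.

Lemma mem_mod_cons v : g v \in ideal_mul (ideal_gen t) (top Xy) ->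
  v \in ideal_mul (ideal_gen yt) (top X).
Proof.
have K : linear_closed (fun q : Xy => exists2 w, w \in ideal_mul (ideal_gen yt) (top X) & g w = q).
  split=> [|a _ _ [w wP <-] [w' wP' <-]]; first by exists 0; rewrite ?rpred0 ?linear0.
  by exists (a *: w + w'); rewrite ?linearP // rpredD ?rpredZ.
move=> /(span_ind K) [_ [c [q [ct _ ->]]]|w wP gw].
  have [w <-] := quotmod_surj q; exists ((c : R) *: w); last by rewrite linearZ.
  apply: mem_ideal_mul => //; apply: span_min ct => d dt; apply: mem_span.
  by rewrite inE dt orbT.
have /lin_imageP [u uE] : v - w \in lin_image (scale_lin y X).
  by rewrite -quotmod_pi_eq0 linearB gw subrr.
rewrite -(subrK w v) rpredD // -uE; apply: mem_ideal_mul => //.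
by apply: mem_span; rewrite mem_head.
Qed.

Lemma mod_cons_bij : exists2 f : {linear mod_ideal X (ideal_gen yt) -> mod_ideal Xy (ideal_gen t)},
  injective f & forall w, exists v, f v = w.
Proof.
exists (quotmod_map mod_cons_maps_to).
  apply: inj_linear => q; have [v <-] := quotmod_surj q; rewrite /= quotmod_mapE => /eqP.
  by rewrite quotmod_pi_eq0 => /mem_mod_cons vP; apply/eqP; rewrite quotmod_pi_eq0.
move=> q; have [q' <-] := quotmod_surj q; have [v <-] := quotmod_surj q'.
by exists (quotmod_pi _ v); rewrite /= quotmod_mapE.
Qed.

End ModCons.

Lemma mod_nil_bij X : exists2 f : {linear X -> mod_ideal X (ideal_gen [::])},
  injective f & forall w, exists v, f v = w.
Proof.
exists (quotmod_pi _); last exact: quotmod_surj.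
apply: inj_linear => v /eqP; rewrite quotmod_pi_eq0; apply: (span_ind (zero_closed X)).
by move=> _ [c [w [/span_nil -> _ ->]]]; rewrite scale0r.
Qed.

Lemma regular_seq_cons X (y : R) (s : seq R) : regular_seq C X (y :: s) <->
  C (colon0 X (pred1 y)) /\ regular_seq C (quotmod (lin_image (scale_lin y X))) s.
Proof.
have [f0 f0i f0s] := mod_nil_bij X; split=> [reg|[Cy reg]].
  split=> [|j js]; first by apply/(colon0_bij _ f0i f0s); exact: (reg 0%N).
  have [f fi fs] := mod_cons_bij X y (take j s).
  by apply/(colon0_bij _ fi fs); exact: (reg j.+1).
case=> [_|j js]; first by apply/(colon0_bij _ f0i f0s).
have [f fi fs] := mod_cons_bij X y (take j s).
by apply/(colon0_bij _ fi fs); exact: (reg j).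
Qed.

Hypothesis noethR : noetherian R.
Context (b : ideal R) (r : nat) (x : 'I_r -> R).
Hypotheses (CM : melkersson C b) (bx : b =i ideal_gen (codom x)).
Local Notation Z i X := (koszul_cohomology x X i).

(** Induction on the sequence, through H^i(x; 0 :_X y), which is in C in all degrees,
    and H^i(x; X/yX), which is in C in one degree less. *)
Lemma koszul_of_regular_seq (s : seq R) X : {subset s <= b} -> regular_seq C X s ->
  forall i, (i < size s)%N -> C (Z i X).
Proof.
elim: s X => // y s IHs X sb /regular_seq_cons [Cy reg] i.
have yb : (y : R^o) \in ideal_gen (codom x) by rewrite -bx; apply: sb; exact: mem_head.
have Cy' k : C (Z k (colon0 X (pred1 y))) by exact: koszul_cohomology_in.
case: i => [_|i le_is]; first by apply: (koszul_cohomology_step0 CS yb).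
apply: (koszul_cohomology_step CS yb) => //; apply: IHs => //.
by move=> c cs; apply: sb; rewrite inE cs orbT.
Qed.

Fact torsion_closed X : linear_closed (fun v : X => exists k, forall c, c \in ideal_pow b k -> (c : R) *: v = 0).
Proof.
split=> [|d u v [k uk] [l vl]]; first by exists 0%N => c _; rewrite scaler0.
exists (maxn k l) => c cb; rewrite scalerDr scalerA mulrC -scalerA.
rewrite uk ?vl ?scaler0 ?addr0 //; first by apply: ideal_pow_le cb; exact: leq_maxr.
by apply: ideal_pow_le cb; exact: leq_maxl.
Qed.
Definition torsion_part X : submodClosed X := sub_of (torsion_closed X).

(** The generators x_j of b send a representative of v into the b-torsion of X, and
    one power of b kills all of these finitely many elements. *)
Lemma torsion_part_quot X (v : quotmod (torsion_part X)) :
  (forall c : R^o, c \in b -> (c : R) *: v = 0) -> v = 0.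
Proof.
have [u <-] := quotmod_surj v => bu.
have [k uk] : exists k, forall c d, c \in codom x -> d \in ideal_pow b k -> (d : R) *: (c *: u) = 0.
  have : forall c, c \in codom x -> exists k, forall d, d \in ideal_pow b k -> (d : R) *: (c *: u) = 0.
    move=> c cx; apply/(sub_ofP (torsion_closed X)); rewrite -quotmod_pi_eq0 linearZ; apply/eqP.
    by apply: bu; rewrite bx; apply: mem_span.
  elim: (codom x) => [|c s IHs] sP; first by exists 0%N.
  have [|k kP] := IHs; first by move=> d ds; apply: sP; rewrite inE ds orbT.
  have [l lP] := sP c (mem_head _ _); exists (maxn k l) => e d.
  rewrite inE => /predU1P [->|es] db.
    by apply: lP; apply: ideal_pow_le db; exact: leq_maxr.
  by apply: kP => //; apply: ideal_pow_le db; exact: leq_maxl.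
apply/eqP; rewrite quotmod_pi_eq0; apply/sub_ofP; exists k.+1 => c cb.
have K : linear_closed (fun c : R^o => (c : R) *: u = 0) by exact: ann_elt_closed.
apply: (span_ind K _ cb) => _ [d [e [db eb ->]]].
have K' : linear_closed (fun d : R^o => (e : R) *: ((d : R) *: u) = 0).
  split=> [|a d1 d2 e1 e2]; first by rewrite scale0r scaler0.
  by rewrite scalerDl scalerDr -scalerA scalerA mulrC -scalerA e1 e2 scaler0 addr0.
have -> : (d : R) *: e = (e : R) * (d : R) by exact: mulrC.
rewrite -scalerA; move: db; rewrite bx => db.
by apply: (span_ind K' _ db) => d' d'x; exact: uk.
Qed.

(** By the Melkersson condition Gamma_b(X) lies in C when 0 :_X b does; an element
    of b regular on X / Gamma_b(X) then has its annihilator inside Gamma_b(X). *)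
Lemma regular_element_in X : finitely_generated X -> C (Z 0 X) ->
  exists2 y : R, (y : R^o) \in b & C (colon0 X (pred1 y)).
Proof.
move=> fgX /(koszul_colon0 CS bx) Cb.
have CG : C (submod (torsion_part X)).
  apply: CM.2; last exact: (colon0_inj (f := incl (torsion_part X)) val_inj Cb).
  move=> [v vG]; have /sub_ofP [k vk] := vG; exists k => c ck; apply: val_inj; exact: vk.
have [y yb yreg] := regular_element noethR (fg_quot (torsion_part X) fgX) (@torsion_part_quot X).
exists y => //; have yG (v : colon0 X (pred1 y)) : (incl _ : {linear _ -> _}) v \in torsion_part X.
  rewrite -quotmod_pi_eq0; apply/eqP/yreg.
  have /colon0P v0 := submod_valP v; have {v0}v0 : y *: val v = 0 by apply: v0; rewrite inE.
  by rewrite -linearZ; apply/eqP; rewrite quotmod_pi_eq0 [X in X \in _]v0 rpred0.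
apply: (serre_sub CS (f := corestrict yG)) CG => u v /(congr1 val) e.
exact: val_inj.
Qed.

(** If 0 :_X y is in C, then H^i(x; yX) is in C along with H^i(x; X), and therefore so
    is H^i(x; X/yX), except in degree n. *)
Lemma regular_seq_of_koszul n X : finitely_generated X -> (forall i, (i <= n)%N -> C (Z i X)) ->
  exists s : seq R, [/\ size s = n.+1, {subset s <= b} & regular_seq C X s].
Proof.
elim: n X => [|n IHn] X fgX CZ; have [y yb Cy] := regular_element_in fgX (CZ 0%N isT).
  exists [:: y]; split=> // [c|]; first by rewrite inE => /eqP ->.
  by apply/regular_seq_cons; split.
have [|i le_in|s [sn sb reg]] := IHn (quotmod (lin_image (scale_lin y X))).
- exact: fg_quot.
- have CyX k : (k <= n.+1)%N -> C (Z k (submod (lin_image (scale_lin y X)))).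
    move=> kn; apply: (koszul_cohomology_delta CS (short_exact_lin_image (scale_lin y X))); first exact: CZ.
    apply: koszul_cohomology_in => //; have yK (v : submod (kernel (scale_lin y X))) :
        (incl _ : {linear _ -> _}) v \in @GRing.SubmodClosed.clone R X (@colon0_pred R X (pred1 y)) _.
      apply/colon0P => c; rewrite inE => /eqP ->; apply/eqP; exact: (submod_valP v).
    apply: (serre_sub CS (f := corestrict yK)) Cy => u v /(congr1 val) e; exact: val_inj.
  apply: (koszul_cohomology_delta CS (short_exact_sub (lin_image (scale_lin y X)))).
    exact/CZ/leqW.
  exact: CyX.
exists (y :: s); split; first by rewrite /= sn.
  by move=> c; rewrite inE => /predU1P [->|/sb].
by apply/regular_seq_cons.
Qed.

End RegularSequences.

Theorem corollary2p17 (R : comNzRingType) (a : ideal R) (M : lmodType R)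
    (r : nat) (x : 'I_r -> R) (C : lmodType R -> Prop) (X : lmodType R) :
  noetherian R ->
  finitely_generated M ->
  ideal_add a (Ann M) =i ideal_gen (codom x) ->
  melkersson C (ideal_add a (Ann M)) ->
  (forall n : nat,
    [/\ (forall i : nat, (i <= n)%N -> C (gen_local_cohomology a M i X)) <->
        (forall i : nat, (i <= n)%N -> C (Ext i (mod_ideal M a) X)),
        (forall i : nat, (i <= n)%N -> C (Ext i (mod_ideal M a) X)) <->
        (forall i : nat, (i <= n)%N -> C (koszul_cohomology x X i))
      & finitely_generated X ->
        ((forall i : nat, (i <= n)%N -> C (koszul_cohomology x X i)) <->
         (exists y : seq R,
            [/\ size y = n.+1, {subset y <= ideal_add a (Ann M)}
              & regular_seq C X y]))]) /\
  ((forall i : nat, C (gen_local_cohomology a M i X)) <->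
   (forall i : nat, C (Ext i (mod_ideal M a) X))) /\
  ((forall i : nat, C (Ext i (mod_ideal M a) X)) <->
   (forall i : nat, C (koszul_cohomology x X i))).
Proof.
move=> noethR fgM bx CM; have CS := CM.1.
have glcP n := glc_Ext_nilpotent_in X n noethR fgM bx CM.
have ExtP n := Ext_nilpotent_inP X CS noethR a n fgM.
have koszulP n := koszul_nilpotent_inP X n noethR CS bx.
have all_degrees (D D' : nat -> lmodType R) :
    (forall n, (forall i, (i <= n)%N -> C (D i)) <-> (forall i, (i <= n)%N -> C (D' i))) ->
    (forall i, C (D i)) <-> (forall i, C (D' i)).
  move=> DD'; split=> CD n; have [h1 h2] := DD' n.
    exact: (h1 (fun i _ => CD i) n (leqnn n)).
  exact: (h2 (fun i _ => CD i) n (leqnn n)).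
have i_ii n := iff_trans (glcP n) (iff_sym (ExtP n)).
have ii_iii n := iff_trans (ExtP n) (iff_sym (koszulP n)).
split; last by split; exact: all_degrees.
move=> n; split=> // fgX; split=> [|[y [yn yb reg]] i le_in].
  exact: regular_seq_of_koszul.
by apply: (koszul_of_regular_seq CS bx yb reg); rewrite yn.
Qed.
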